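(* (a) Assume Dickson's conjecture. Then the set $\left\{ \frac{\sigma(p+1)}{\sigma(p-1)} : p \text{ and } p+2 \text{ are both prime} \right\}$ is dense in $[0,\infty)$. (b) (Unconditionally) The set $\left\{ \frac{\sigma(p+1)}{\sigma(p)} : p \text{ prime} \right\}$ is dense in $\left[\tfrac{3}{2},\infty\right)$. (c) Assume Dickson's conjecture. Then the set $\left\{ \frac{\sigma(p+1)}{\sigma(p)} : p \text{ and } p+2 \text{ are both prime} \right\}$ is dense in $[2,\infty)$.
   Context: $\sigma(n)=\sum_{d\mid n} d$ denotes the sum-of-divisors function. Dickson's conjecture is the following assertion: if $f_1,\dots,f_k \in \mathbb{Z}[t]$ are linear polynomials with positive leading coefficients and the product $f=f_1f_2\cdots f_k$ does not vanish identically modulo any prime (i.e., for every prime $q$ there is an integer $t$ with $q \nmid f(t)$), then there are infinitely many positive integers $t$ for which $f_1(t),\dots,f_k(t)$ are simultaneously prime. *)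

(* Defs.v *)
From HB Require Import structures.
From mathcomp Require Import all_boot all_order all_algebra.
From mathcomp Require Import reals.
Set Implicit Arguments. Unset Strict Implicit. Unset Printing Implicit Defensive.
Import Order.TTheory GRing.Theory Num.Theory.

(* sum-of-divisors function sigma(n) = sum_{d | n} d  (divisors 0 = [::]) *)
Definition sigma (n : nat) : nat := \sum_(d <- divisors n) d.

Definition lin_eval (f : int * int) (t : int) : int := (f.1 * t + f.2)%R.

Definition int_prime (z : int) : bool := (0 < z)%R && prime `|z|%N.

Definition Dickson_conjecture : Prop :=
  forall fs : seq (int * int),
    (forall f, f \in fs -> (0 < f.1)%R) ->
    (forall q : nat, prime q ->
        exists t : int, ~~ (q%:Z %| (\prod_(f <- fs) lin_eval f t)%R)%Z) ->
    forall N : nat, exists t : nat,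
      (N < t)%N /\ (forall f, f \in fs -> int_prime (lin_eval f t%:Z)).

Definition dense_in_halfline (R : realType) (S : R -> Prop) (a : R) : Prop :=
  forall x : R, (a <= x)%R -> forall e : R, (0 < e)%R ->
    exists y, S y /\ (`|y - x| < e)%R.

(* Main.v *)
(** For (a) and (c), Dickson's conjecture is applied to forms making p + 1 (and, in
    (a), p - 1) a prescribed integer times a single large prime, so that the ratio is
    close to one built from sigma(m)/m with m a product of consecutive primes.  These
    products can be steered to any target because the product of the 1 + 1/q diverges.

    For (b), put S = the primes in (z, Y] with (3/2) prod_(q in S) (1 + 1/q) close to
    the target, and prescribe p modulo M = 4 * (the odd primes up to Z), with Z >= Y:
    p = 1 mod 4, p = -1 mod q for q in S and p = 1 mod q for the other q.  Then
    sigma(p+1)/(p+1) is as wanted provided that the sum of 1/q over the primes q > Z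
    dividing p + 1 is small.  This holds on average over the primes p of the class,
    with weights ln p / p: a quantitative Dirichlet theorem gives total weight
    ln x / phi(M) + O(1), and a weak Brun-Titchmarsh bound, losing only a factor
    ln(Mq), bounds the weight of those p with q | p + 1.  The resulting average is
    O(phi(M)/M), which tends to 0 as Z grows.

    Dirichlet's theorem is proved without characters.  On functions f of zero mean on
    the units modulo N, let (L f)(m) = sum_n f(mn)/n.  With P f x the sum of
    f(p) ln p / p over p <= x, Mertens' argument shows that P (L f) is bounded, while
    P f x = - f(1) ln x + O(1) if L f = 0.  A nonzero element of the kernel of L,
    normalised by f(1) = 1 = max |f|, turns out to be a real character chi with
    L(1, chi) = 0, which is impossible; so L is injective, hence surjective. *)

Require Import Defs.
From HB Require Import structures.
From mathcomp Require Import all_boot all_order all_algebra.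
From mathcomp Require Import cyclic boolp classical_sets reals exp.
From mathcomp Require Import zify ring lra.
Set Implicit Arguments. Unset Strict Implicit. Unset Printing Implicit Defensive.
Import Order.TTheory GRing.Theory Num.Theory.

(** * The von Mangoldt and Moebius functions *)

Section Arithmetic.
Variable R : realType.
Local Open Scope ring_scope.
Implicit Types (n m d p : nat).

(** Write h(n) = sigma(n)/n. The endpoints are forced local factors: p + 1 is even and h(2) = 3/2;
    twin primes beyond 3 have 6 | p + 1 and h(6) = 2. In (a) the even neighbours p - 1 and p + 1
    share a single extra 2, and 3 must go to p + 1; giving 12 to p + 1 and 2 to p - 1 produces the
    factor h(12)/h(2) = 14/9. In (b) the cofactor of p + 1 cannot be made prime, so its large primes
    have to be averaged out. The weak sieve suffices because the average already carries a weight
    1/q: what must converge is the sum of ln(Mq)/q^2 over q > Z, which is O(1 + ln M / Z), and ln M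
    = O(Z) by Chebyshev. In Dirichlet's theorem the obstacle is that no single class is known to
    contain primes. The argument works with the classes whose prime sum is unbounded: a function
    invariant under them has prime sum f(1) ln x + O(1), which forces it to be constant on the
    units. This replaces the decomposition into characters and stays within real functions. A
    normalised kernel element equals -1 on these classes, since 1 + f is nonnegative with bounded
    prime sum; this yields its values and its multiplicativity. *)

Definition mangoldt n : R := if size (primes n) == 1%N then ln (pdiv n)%:R else 0.

Definition moebius n : R := \prod_(p <- primes n) (if logn p n == 1%N then -1 else 0).

Lemma sum_divisors_interval n x (F : nat -> R) : (0 < n <= x)%N ->
  \sum_(d <- divisors n) F d = \sum_(1 <= d < x.+1 | (d %| n)%N) F d.
Proof.
move=> /andP[n0 nx]; rewrite -[RHS]big_filter; apply: perm_big; apply: uniq_perm.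
- exact: divisors_uniq.
- by rewrite filter_uniq // iota_uniq.
move=> d; rewrite mem_filter mem_index_iota -dvdn_divisors //.
case dn: (d %| n)%N => //=.
have := dvdn_leq n0 dn; have : (0 < d)%N by apply: dvdn_gt0 dn.
by lia.
Qed.

Lemma sum_multiples d x (G : nat -> R) : (0 < d)%N ->
  \sum_(1 <= n < x.+1 | (d %| n)%N) G (n %/ d)%N = \sum_(1 <= e < (x %/ d).+1) G e.
Proof.
move=> d0; elim: x => [|x IH]; first by rewrite div0n !big_geq.
rewrite big_mkcond big_nat_recr //= -big_mkcond IH /=.
rewrite divnS //; case: (boolP (d %| x.+1)%N) => dx; last by rewrite add0n addr0.
by rewrite add1n [RHS]big_nat_recr.
Qed.

(** Both sides run over the factorisations n = d e with d e <= x. Every Dirichlet convolution below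
    is rearranged in this way. *)
Lemma sum_divisors_swap x (F : nat -> nat -> R) :
  \sum_(1 <= n < x.+1) \sum_(d <- divisors n) F d (n %/ d)%N =
  \sum_(1 <= d < x.+1) \sum_(1 <= e < (x %/ d).+1) F d e.
Proof.
transitivity (\sum_(1 <= n < x.+1) \sum_(1 <= d < x.+1 | (d %| n)%N) F d (n %/ d)%N).
  by apply: eq_big_nat => n nx; apply: sum_divisors_interval; lia.
under eq_bigr do rewrite big_mkcond.
rewrite exchange_big /=; apply: eq_big_nat => d /andP[d0 _].
by rewrite -big_mkcond sum_multiples.
Qed.

Lemma primesPM p n : prime p -> (0 < n)%N -> ~~ (p %| n)%N ->
  perm_eq (primes (p * n)%N) (p :: primes n).
Proof.
move=> pp n0 pn; apply: uniq_perm; rewrite ?primes_uniq //=.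
  by rewrite primes_uniq andbT mem_primes pp n0 /=.
by move=> q; rewrite primesM ?(prime_gt0 pp) // (primes_prime pp) !inE.
Qed.

Lemma moebius1 : moebius 1 = 1.
Proof. by rewrite /moebius big_nil. Qed.

Lemma moebius_norm n : `|moebius n| <= 1.
Proof.
rewrite /moebius; elim/big_rec: _ => [|p x _ IH]; first by rewrite normr1.
by rewrite normrM; case: ifP => _; rewrite ?normrN1 ?mul1r // normr0 mul0r.
Qed.

Lemma moebiusPM p n : prime p -> (0 < n)%N -> ~~ (p %| n)%N ->
  moebius (p * n)%N = - moebius n.
Proof.
move=> pp n0 pn; rewrite /moebius (perm_big _ (primesPM pp n0 pn)) big_cons /=.
have -> : logn p (p * n)%N = 1%N.
  by rewrite lognM ?(prime_gt0 pp) // (logn_prime _ pp) eqxx lognE (negPf pn) !andbF.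
rewrite eqxx mulN1r; congr (- _); apply: eq_big_seq => q; rewrite mem_primes.
move=> /and3P[qp _ qn]; rewrite lognM ?(prime_gt0 pp) // (logn_prime _ pp).
by have -> : (q == p) = false by apply: contraNF pn => /eqP <-.
Qed.

Lemma moebius_eq0 p n : prime p -> (p %| n)%N -> (0 < n)%N -> logn p n != 1%N ->
  moebius n = 0.
Proof.
move=> pp pn n0 ln; rewrite /moebius (bigD1_seq p) ?primes_uniq //=.
  by rewrite (negPf ln) mul0r.
by rewrite mem_primes pp n0.
Qed.

(* Pairs each squarefree divisor d prime to p with p * d. *)
Lemma sum_moebius_split p n (g : nat -> R) : prime p -> (p %| n)%N -> (0 < n)%N ->
  \sum_(d <- divisors n) moebius d * g d =
  \sum_(d <- divisors n | ~~ (p %| d)%N) moebius d * (g d - g (p * d)%N).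
Proof.
move=> pp pn n0; rewrite (bigID (fun d => p %| d)%N) /= addrC.
under [in RHS]eq_bigr do rewrite mulrBr.
rewrite sumrB; congr (_ + _).
rewrite (bigID (fun d => logn p d == 1%N)) /= [X in _ + X]big1_seq ?addr0; last first.
  move=> d /andP[/andP[pd ld]]; rewrite -dvdn_divisors // => dn.
  by rewrite (moebius_eq0 pp pd) ?mul0r // (dvdn_gt0 n0).
rewrite -big_filter -sumrN -[RHS]big_filter.
set s := [seq d <- divisors n | ~~ (p %| d)%N].
have sP : forall d, (d \in s) = (~~ (p %| d)%N && (d %| n)%N).
  by move=> d; rewrite mem_filter -dvdn_divisors.
transitivity (\sum_(d <- [seq (p * d)%N | d <- s]) moebius d * g d).
  apply: perm_big; apply: uniq_perm.
  - by rewrite filter_uniq // divisors_uniq.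
  - rewrite map_inj_uniq ?filter_uniq ?divisors_uniq // => a b /eqP.
    by rewrite eqn_pmul2l ?prime_gt0 // => /eqP.
  move=> d; rewrite mem_filter -dvdn_divisors //; apply/idP/mapP.
    move=> /andP[/andP[/dvdnP[e ->] l1]] dn; exists e; last by rewrite mulnC.
    rewrite sP (dvdn_trans _ dn) ?dvdn_mulr // andbT; apply/negP => pe.
    have e0 : (0 < e)%N.
      by have := dvdn_gt0 n0 dn; rewrite muln_gt0 => /andP[].
    move: l1; rewrite lognM ?(prime_gt0 pp) // (logn_prime _ pp) eqxx.
    by rewrite (lognE p e) pp pe e0 addn1.
  move=> [e]; rewrite sP => /andP[pe en] ->; rewrite dvdn_mulr //=.
  have e0 := dvdn_gt0 n0 en.
  rewrite lognM ?(prime_gt0 pp) // (logn_prime _ pp) eqxx lognE (negPf pe) !andbF /=.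
  by rewrite Gauss_dvd ?pn ?en // prime_coprime.
rewrite big_map; apply: eq_big_seq => d; rewrite sP => /andP[pd dn].
by rewrite moebiusPM // ?mulNr // (dvdn_gt0 n0).
Qed.

Lemma sum_moebius n : (0 < n)%N ->
  \sum_(d <- divisors n) moebius d = (n == 1%N)%:R.
Proof.
move=> n0; have [->|n1] := eqVneq n 1%N; first by rewrite big_cons big_nil addr0 moebius1.
have pp : prime (pdiv n) by apply: pdiv_prime; lia.
under eq_bigr do rewrite -[moebius _]mulr1.
rewrite (sum_moebius_split (fun=> 1) pp (pdiv_dvd n) n0) big1 // => d _.
by rewrite subrr mulr0.
Qed.

Lemma mangoldt_ge0 n : 0 <= mangoldt n.
Proof. by rewrite /mangoldt; case: ifP => // _; rewrite ln_ge0 // ler1n pdiv_gt0. Qed.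

Lemma mangoldt_prime p : prime p -> mangoldt p = ln p%:R.
Proof. by move=> pp; rewrite /mangoldt primes_prime //= pdiv_id. Qed.

Lemma mangoldtX p k : prime p -> (0 < k)%N -> mangoldt (p ^ k)%N = ln p%:R.
Proof.
move=> pp k0; rewrite /mangoldt primesX // primes_prime //=.
by rewrite -(prednK k0) pdiv_pfactor.
Qed.

Lemma mangoldt_neq0 n : mangoldt n != 0 ->
  exists p k, [/\ prime p, (0 < k)%N & n = (p ^ k)%N].
Proof.
rewrite /mangoldt; case: ifP; rewrite ?eqxx // => /eqP s1 _.
have [p pE] : exists p, primes n = [:: p].
  by case: (primes n) s1 => // p [] // _; exists p.
have : p \in primes n by rewrite pE inE.
rewrite mem_primes => /and3P[pp n0 pn].
have : p.-nat n.
  apply/pnatP => // q qp qn.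
  have : q \in primes n by rewrite mem_primes qp n0.
  by rewrite pE inE.
move=> /p_natP[k nE]; exists p, k; split => //.
by rewrite lt0n; apply: contraTneq pn => k0; rewrite nE k0 expn0 Euclid_dvd1.
Qed.

(** Among the divisors of p m that do not divide m, the only prime power is p to the exponent
    [(logn p m).+1]; it contributes ln p. *)
Lemma sum_mangoldtPM p m : prime p -> (0 < m)%N ->
  \sum_(d <- divisors (p * m)%N) mangoldt d =
  \sum_(d <- divisors m) mangoldt d + ln p%:R.
Proof.
move=> pp m0; have p0 := prime_gt0 pp; have pm0 : (0 < p * m)%N by rewrite muln_gt0 p0.
rewrite (bigID (fun d => d %| m)%N) /=; congr (_ + _).
  rewrite -big_filter; apply: perm_big; apply: uniq_perm.
  - by rewrite filter_uniq // divisors_uniq.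
  - exact: divisors_uniq.
  move=> d; rewrite mem_filter -!dvdn_divisors //.
  by apply/andP/idP => [[]//|dm]; split => //; apply: dvdn_mull.
rewrite -big_filter; set e := (p ^ (logn p m).+1)%N.
have em : ~~ (e %| m)%N by rewrite pfactor_dvdn // ltnn.
rewrite (bigD1_seq e) ?filter_uniq ?divisors_uniq //=; last first.
  rewrite mem_filter em -dvdn_divisors //= pfactor_dvdn //.
  by rewrite lognM // (logn_prime _ pp) eqxx.
rewrite mangoldtX // [X in _ + X]big1_seq ?addr0 // => d /andP[de].
rewrite mem_filter -dvdn_divisors // => /andP[dm dpm].
apply/eqP; apply: contraNT de => /mangoldt_neq0[q [k [qp k0 dE]]].
move: dm dpm; rewrite dE; have [->|qp'] := eqVneq q p.
  rewrite !pfactor_dvdn // lognM // (logn_prime _ pp) eqxx => h1 h2.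
  by rewrite /e; apply/eqP; congr (_ ^ _)%N; lia.
move=> /negP dm; rewrite Gauss_dvdr //.
by rewrite coprimeXl // prime_coprime // dvdn_prime2.
Qed.

Lemma sum_mangoldt n : (0 < n)%N -> \sum_(d <- divisors n) mangoldt d = ln n%:R.
Proof.
elim/ltn_ind: n => n IH n0; have [->|n1] := eqVneq n 1%N.
  by rewrite big_cons big_nil addr0 ln1 /mangoldt.
have pp : prime (pdiv n) by apply: pdiv_prime; lia.
have [m nE] := dvdnP (pdiv_dvd n); have p0 := prime_gt0 pp.
have m0 : (0 < m)%N by move: n0; rewrite nE muln_gt0 => /andP[].
rewrite nE mulnC sum_mangoldtPM // IH //; last first.
  by rewrite [X in (_ < X)%N]nE -[X in (X < _)%N]muln1 ltn_pmul2l // prime_gt1.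
by rewrite natrM lnM ?posrE ?ltr0n // addrC.
Qed.

(** Pairing d with p d, for one prime p of n, leaves - ln p times the sum of [moebius] over the
    divisors of the part of n prime to p. That sum is 1 if n is a power of p, and 0 otherwise. *)
Lemma sum_moebius_ln n : (0 < n)%N ->
  \sum_(d <- divisors n) moebius d * ln d%:R = - mangoldt n.
Proof.
move=> n0; have [->|n1] := eqVneq n 1%N.
  by rewrite big_cons big_nil addr0 ln1 mulr0 /mangoldt oppr0.
have pp : prime (pdiv n) by apply: pdiv_prime; lia.
have pn := pdiv_dvd n; set p := pdiv n in pp pn *; have p0 := prime_gt0 pp.
rewrite (sum_moebius_split (fun d => ln d%:R) pp pn n0).
have -> : \sum_(d <- divisors n | ~~ (p %| d)%N)
     moebius d * (ln d%:R - ln (p * d)%:R) =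
   - ln p%:R * \sum_(d <- divisors n | ~~ (p %| d)%N) moebius d.
  rewrite mulr_sumr big_seq_cond [RHS]big_seq_cond.
  apply: eq_bigr => d /andP[]; rewrite -dvdn_divisors // => dn _.
  rewrite natrM lnM ?posrE ?ltr0n ?(dvdn_gt0 n0) //.
  by rewrite opprD addrCA subrr addr0 mulrC.
have m0 : (0 < n`_p^')%N by [].
have -> : \sum_(d <- divisors n | ~~ (p %| d)%N) moebius d =
    \sum_(d <- divisors n`_p^') moebius d.
  rewrite -big_filter; apply: perm_big; apply: uniq_perm.
  - by rewrite filter_uniq // divisors_uniq.
  - exact: divisors_uniq.
  move=> d; rewrite mem_filter -!dvdn_divisors //; apply/andP/idP.
    move=> [pd dn]; rewrite -(partnC p n0) Gauss_dvdr // in dn.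
    by rewrite p_part coprimeXr // coprime_sym prime_coprime.
  move=> dm; split; last by apply: dvdn_trans dm (dvdn_part _ _).
  apply/negP => pd; have := dvdn_trans pd dm.
  have /pnatP := part_pnat p^' n => /(_ m0 p pp) h /h.
  by rewrite inE /= inE eqxx.
rewrite sum_moebius //; have [m1|m1] := eqVneq.
  have nE : n = (p ^ logn p n)%N by rewrite -p_part -[LHS](partnC p n0) m1 muln1.
  rewrite mulr1 [in RHS]nE mangoldtX //.
  by rewrite logn_gt0 mem_primes pp n0.
rewrite mulr0; apply/eqP; rewrite eq_sym oppr_eq0; apply: contraNT m1.
move=> /mangoldt_neq0[q [k [qp k0 nE]]].
have pq : p = q by move: pn; rewrite nE Euclid_dvdX // k0 andbT dvdn_prime2 // => /eqP.
by rewrite partn_eq1 // pnatNK nE -pq pnatX pnat_id.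
Qed.

End Arithmetic.

(** * Chebyshev and Mertens estimates *)

Section Analysis.
Variable R : realType.
Local Open Scope ring_scope.
Implicit Types (n m d p x : nat) (f g h : nat -> R).

Lemma ln_nat_ge0 n : 0 <= ln n%:R :> R.
Proof. by case: n => [|n]; [rewrite ln0|rewrite ln_ge0 // ler1n]. Qed.

Lemma ler_ln_nat m n : (0 < m <= n)%N -> ln m%:R <= ln n%:R :> R.
Proof.
by move=> /andP[m0 mn]; rewrite ler_ln ?posrE ?ltr0n ?ler_nat // (leq_trans m0).
Qed.

Lemma ln_nat_le n : ln n%:R <= n%:R :> R.
Proof. by case: n => [|n]; [rewrite ln0|rewrite ltW // ln_sublinear]. Qed.

Lemma lnS_bounds n : (0 < n)%N ->
  0 <= ln n.+1%:R - ln n%:R :> R /\ n%:R * (ln n.+1%:R - ln n%:R) <= 1 :> R.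
Proof.
move=> n0; have n0R : 0 < n%:R :> R by rewrite ltr0n.
split; first by rewrite subr_ge0 ler_ln_nat //; lia.
rewrite -ln_div ?posrE ?ltr0n // -addn1 natrD mulrDl divff ?gt_eqF // mul1r.
have h : 0 < n%:R^-1 :> R by rewrite invr_gt0.
have := @le_ln1Dx R n%:R^-1; rewrite -(ler_pM2l n0R) divff ?gt_eqF //.
by apply; lra.
Qed.

(** A weak Stirling bound: x ln x - x grows by at most ln(x + 1) at each step, because x (ln(x + 1)
    - ln x) <= 1. *)
Lemma lnfact_ge x : x%:R * ln x%:R - x%:R <= \sum_(1 <= n < x.+1) ln n%:R :> R.
Proof.
elim: x => [|x IH]; first by rewrite mul0r subrr big_geq.
rewrite big_nat_recr //=; case: x IH => [|x] IH.
  by rewrite big_geq // ln1 mulr0; lra.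
have [_ h] := @lnS_bounds x.+1 isT.
have e : x.+2%:R = x.+1%:R + 1 :> R by rewrite -[x.+2]addn1 natrD.
rewrite e in h *; set l := ln (_ + 1) in h *.
by rewrite mulrDl mul1r; lra.
Qed.

Lemma lnfact_le x : \sum_(1 <= n < x.+1) ln n%:R <= x%:R * ln x%:R :> R.
Proof.
have -> : x%:R * ln x%:R = \sum_(1 <= n < x.+1) ln x%:R :> R.
  by rewrite sumr_const_nat subn1 mulr_natl.
by apply: ler_sum_nat => n nx; apply: ler_ln_nat; lia.
Qed.

Definition psi x : R := \sum_(1 <= n < x.+1) mangoldt R n.

Lemma lnfact_mangoldt x :
  \sum_(1 <= n < x.+1) ln n%:R = \sum_(1 <= d < x.+1) mangoldt R d * (x %/ d)%:R.
Proof.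
transitivity (\sum_(1 <= n < x.+1) \sum_(d <- divisors n) mangoldt R d).
  by apply: eq_big_nat => n /andP[n0 _]; rewrite sum_mangoldt.
rewrite (sum_divisors_swap x (fun d _ => mangoldt R d)); apply: eq_bigr => d _.
by rewrite sumr_const_nat subn1 mulr_natr.
Qed.

(** Chebyshev's comparison of ln (2m)! with 2 ln m!: in terms of [mangoldt], the weight of d in the
    difference is nonnegative, and at least 1 for m < d <= 2m. The constant 4 is 2 ln 2 + 2 with ln
    2 <= 1. *)
Lemma psi_double m : psi m.*2 <= psi m + 4 * m%:R.
Proof.
case: m => [|m]; first by rewrite /psi !big_geq // mulr0 addr0.
set n := m.+1.
have h1 := lnfact_le n.*2; have h2 := lnfact_ge n.
rewrite !lnfact_mangoldt in h1 h2.
have e : ln n.*2%:R = ln 2 + ln n%:R :> R.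
  by rewrite -mul2n natrM lnM ?posrE ?ltr0n.
have l2 : ln 2 <= 1 :> R by have := @le_ln1Dx R 1; apply; lra.
suff : psi n.*2 - psi n <= \sum_(1 <= d < n.*2.+1) mangoldt R d * (n.*2 %/ d)%:R -
    2 * \sum_(1 <= d < n.+1) mangoldt R d * (n %/ d)%:R.
  move: h1 h2; rewrite e -mul2n natrM; set A := \sum_(_ <= _ < _) _.
  set B := \sum_(_ <= _ < _) _; move=> h1 h2 h3.
  have n0 : 0 <= n%:R :> R by rewrite ler0n.
  have : n%:R * ln 2 <= n%:R :> R by rewrite ler_piMr.
  by move: h1 h2 h3; set L := ln n%:R; lra.
rewrite /psi !(@big_cat_nat _ _ _ n.+1 1 n.*2.+1) //=; [|lia|lia].
rewrite mulr_sumr addrAC subrr add0r addrAC -sumrB.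
rewrite -[X in X <= _]add0r; apply: lerD.
  rewrite big_nat sumr_ge0 // => d /andP[d0 dn].
  rewrite mulrCA -mulrBr mulr_ge0 ?mangoldt_ge0 // -natrM subr_ge0 ler_nat.
  by rewrite leq_divRL // -mulnA -mul2n leq_mul2l leq_divM.
apply: ler_sum_nat => d dn; rewrite -[X in X <= _]mulr1 ler_wpM2l ?mangoldt_ge0 //.
by rewrite ler1n divn_gt0; lia.
Qed.

(** Induction by halving. For n = 2m + 1 the step adds 4m and ln n <= 2m + 1, so a bound C n
    reproduces itself once C >= 6. *)
Lemma psi_le x : psi x <= 6 * x%:R.
Proof.
elim/ltn_ind: x => x IH; case: x IH => [|x] IH; first by rewrite /psi big_geq // mulr0.
set n := x.+1 in IH *; have := odd_double_half n; set m := n./2 => nE.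
have mn : (m < n)%N by lia.
have := IH _ mn; have := psi_double m; case: (odd n) nE => /= nE h1 h2.
  have -> : psi n = psi m.*2 + mangoldt R n.
    by rewrite /psi -nE add1n big_nat_recr.
  have h : mangoldt R n <= n%:R.
    apply: le_trans (ln_nat_le n).
    rewrite /mangoldt; case: ifP => _; last exact: ln_nat_ge0.
    by apply: ler_ln_nat; rewrite pdiv_gt0 /=; apply: pdiv_leq.
  have nR : n%:R = 1 + 2 * m%:R :> R by rewrite -nE natrD -mul2n natrM.
  by rewrite nR in h *; lra.
rewrite -nE add0n -mul2n natrM mul2n.
by have : 0 <= m%:R :> R by []; lra.
Qed.

(** In ln x! = sum of [mangoldt] d times the floor of x/d, dropping the floors costs at most psi(x)
    <= 6x; then Stirling and a division by x. *)
Lemma mertens_mangoldt x : (0 < x)%N ->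
  `|\sum_(1 <= n < x.+1) mangoldt R n / n%:R - ln x%:R| <= 6.
Proof.
move=> x0; have x0R : 0 < x%:R :> R by rewrite ltr0n.
have := psi_le x; have := lnfact_ge x; have := lnfact_le x.
rewrite !lnfact_mangoldt; set A := \sum_(_ <= _ < _) _; set S := \sum_(_ <= _ < _) _.
have h1 : A <= x%:R * S.
  rewrite mulr_sumr; apply: ler_sum_nat => d /andP[d0 _].
  rewrite mulrCA ler_wpM2l ?mangoldt_ge0 // ler_pdivlMr ?ltr0n // -natrM ler_nat.
  exact: leq_divM.
have h2 : x%:R * S <= A + psi x.
  rewrite mulr_sumr -big_split; apply: ler_sum_nat => d /andP[d0 _] /=.
  rewrite mulrCA -[X in _ <= _ + X]mulr1 -mulrDr ler_wpM2l ?mangoldt_ge0 //.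
  rewrite ler_pdivrMr ?ltr0n // -(natrD _ _ 1) -natrM ler_nat addn1 ltnW //.
  exact: ltn_ceil.
move=> h3 h4 h5; rewrite ler_norml; apply/andP; split.
  rewrite -(ler_pM2l x0R) mulrBr; lra.
by rewrite -(ler_pM2l x0R) mulrBr; lra.
Qed.

Lemma abel_bound f (a : nat -> R) (B : R) m k :
  (forall j, (m <= j)%N -> `|\sum_(m <= n < j) f n| <= B) ->
  (forall n, (m <= n)%N -> 0 <= a n.+1 <= a n) -> 0 <= a m ->
  `|\sum_(m <= n < k) f n * a n| <= B * a m.
Proof.
move=> hB ha am0; have B0 : 0 <= B by have := hB m (leqnn m); rewrite big_geq // normr0.
have [km|/ltnW mk] := leqP k m.
  by rewrite big_geq // normr0 mulr_ge0.
have a0 n : (m <= n)%N -> 0 <= a n.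
  by rewrite leq_eqVlt => /predU1P[<-//|]; case: n => // n /ha /andP[].
have E : \sum_(m <= n < k) f n * a n = (\sum_(m <= n < k) f n) * a k +
   \sum_(m <= n < k) (\sum_(m <= i < n.+1) f i) * (a n - a n.+1).
  elim: k mk => [|k IH]; first by rewrite leqn0 => /eqP ->; rewrite !big_geq // mul0r addr0.
  rewrite leq_eqVlt => /predU1P[<-|]; first by rewrite !big_geq // mul0r addr0.
  rewrite ltnS => mk; rewrite !(big_nat_recr k) //= IH //.
  by set T := \sum_(_ <= _ < _) _; set S := \sum_(_ <= _ < _) _; ring.
rewrite E; apply: le_trans (ler_normD _ _) _.
have -> : B * a m = B * a k + \sum_(m <= n < k) B * (a n - a n.+1).
  rewrite -mulr_sumr -mulrDr; congr (_ * _).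
  have := @telescope_sumr R m k (fun n => - a n) mk.
  under eq_bigr do rewrite opprK addrC.
  by move=> ->; lra.
apply: lerD.
  by rewrite normrM ler_pM // ?hB // ger0_norm // a0.
apply: le_trans (ler_norm_sum _ _ _) _; apply: ler_sum_nat => n /andP[mn _].
have /andP[_ an] := ha n mn; rewrite normrM ler_pM // ?hB //; first by lia.
by rewrite ger0_norm // subr_ge0.
Qed.

(** The intervals of radius [w n] around [u n] meet pairwise, so the supremum of their lower ends
    lies in all of them. The rate of convergence comes with the limit. *)
Lemma limit_exists (u w : nat -> R) :
  (forall m n, (0 < m <= n)%N -> `|u m - u n| <= w m) ->
  exists l, forall n, (0 < n)%N -> `|u n - l| <= w n.
Proof.
move=> h; pose E := [set z : R | exists2 m, (0 < m)%N & z = u m - w m]%classic.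
have key m n : (0 < m)%N -> (0 < n)%N -> u m - w m <= u n + w n.
  move=> m0 n0; have [mn|/ltnW mn] := leqP m n.
    have := h m n; rewrite m0 mn => /(_ isT).
    have := h n n; rewrite n0 leqnn => /(_ isT); rewrite subrr normr0.
    by rewrite ler_norml => h1 /andP[]; lra.
  have := h n m; rewrite n0 mn => /(_ isT).
  have := h m m; rewrite m0 leqnn => /(_ isT); rewrite subrr normr0.
  by rewrite ler_norml => h1 /andP[]; lra.
have ub n : (0 < n)%N -> ubound E (u n + w n).
  by move=> n0 _ [m m0 ->]; apply: key.
exists (sup E) => n n0; rewrite ler_norml; apply/andP; split.
  have : sup E <= u n + w n by apply: ge_sup; [exists (u n - w n); exists n|apply: ub].
  by lra.
have : u n - w n <= sup E.
  by apply: ub_le_sup; [exists (u n + w n); apply: ub|exists n].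
by lra.
Qed.

End Analysis.

(** * Convergent series and sums over primes weighted by ln p / p *)

Section PrimeSums.
Variable R : realType.
Local Open Scope ring_scope.
Implicit Types (n m d p x : nat) (f g h : nat -> R).

Definition rt n : R := Num.sqrt n%:R.

Lemma rt_gt0 n : (0 < n)%N -> 0 < rt n.
Proof. by move=> n0; rewrite sqrtr_gt0 ltr0n. Qed.

Lemma rt_sq n : rt n * rt n = n%:R.
Proof. by rewrite -expr2 sqr_sqrtr. Qed.

Lemma rt_le m n : (m <= n)%N -> rt m <= rt n.
Proof. by move=> mn; rewrite ler_wsqrtr // ler_nat. Qed.

Lemma ln_le_rt n : ln n%:R <= 2 * rt n.
Proof.
case: n => [|n]; first by rewrite ln0 // /rt sqrtr0 mulr0.
have r0 := @rt_gt0 n.+1 isT.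
rewrite -(rt_sq n.+1) lnM ?posrE //; have := @ln_sublinear R _ r0; lra.
Qed.

(** Each term is at most 2 (1/sqrt(n - 1) - 1/sqrt n), and these telescope. *)
Lemma sum_pow32 k : \sum_(2 <= n < k) (n%:R * rt n)^-1 <= 2.
Proof.
have [k2|k2] := leqP k 2; first by rewrite big_geq.
apply: (@le_trans _ _ (\sum_(2 <= n < k) 2 * ((rt n.-1)^-1 - (rt n)^-1))); last first.
  rewrite -mulr_sumr.
  have h := @telescope_sumr R 1 k.-1 (fun n => - (rt n)^-1).
  rewrite big_add1 /=; under eq_bigr do rewrite -[X in X - _]opprK addrC.
  rewrite h; last by lia.
  have : 0 < (rt k.-1)^-1 by rewrite invr_gt0 rt_gt0 //; lia.
  by rewrite /rt sqrtr1 invr1; lra.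
apply: ler_sum_nat => n /andP[n2 _]; case: n n2 => // n n1 /=.
rewrite -(rt_sq n.+1); have a0 := rt_gt0 (n1 : (0 < n)%N); have b0 := @rt_gt0 n.+1 isT.
have ab := rt_le (leqnSn n); set a := rt n in a0 ab *; set b := rt n.+1 in b0 ab *.
have e : (b - a) * (a + b) = 1.
  have -> : (b - a) * (a + b) = b * b - a * a by ring.
  by rewrite /a /b !rt_sq -natrB // subSnn.
have -> : a^-1 - b^-1 = (a * b * (a + b))^-1.
  have ab0 : 0 < a + b by rewrite addr_gt0.
  rewrite -[RHS]mul1r -e; field; by rewrite !gt_eqF.
have -> : 2 * (a * b * (a + b))^-1 = (a * b * (a + b) / 2)^-1 by rewrite invf_div.
rewrite lef_pV2 ?posrE ?mulr_gt0 ?invr_gt0 ?addr_gt0 //.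
rewrite -(ler_pM2l (ltr0Sn _ 1)) mulrCA divff ?mulr1 ?pnatr_eq0 //.
have : a * b <= b * b by rewrite ler_pM2r.
have : a * (b * b) <= b * (b * b) by rewrite ler_pM2r // mulr_gt0.
have : a * a * b <= b * b * b by rewrite ler_pM2r // ler_pM // ltW.
by rewrite mulrDr; nra.
Qed.

Lemma ln_div_sq n : (0 < n)%N -> ln n%:R / n%:R ^+ 2 <= 2 * (n%:R * rt n)^-1.
Proof.
move=> n0; have r0 := rt_gt0 n0.
rewrite ler_pdivrMr ?exprn_gt0 ?ltr0n //; apply: le_trans (ln_le_rt n) _.
rewrite -(rt_sq n); set r := rt n in r0 *; rewrite le_eqVlt; apply/orP; left.
by apply/eqP; field; rewrite gt_eqF.
Qed.

Lemma sum_geom_tail m K : (2 <= m)%N ->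
  \sum_(2 <= k < K) (m%:R ^+ k)^-1 <= 2 / m%:R ^+ 2 :> R.
Proof.
move=> m2; have [K2|K2] := leqP K 2.
  by rewrite big_geq // divr_ge0 // exprn_ge0.
under eq_bigr do rewrite -exprVn.
rewrite -exprVn; set r : R := m%:R^-1.
have r0 : 0 <= r by rewrite invr_ge0.
have r2 : r <= 2^-1 by rewrite lef_pV2 ?posrE ?ltr0n ?ler_nat //; lia.
have h : (1 - r) * \sum_(2 <= k < K) r ^+ k = r ^+ 2 - r ^+ K.
  elim: K K2 => // K IH; rewrite ltnS leq_eqVlt => /predU1P[<-|K2].
    by rewrite big_nat1 !exprS expr0; ring.
  rewrite big_nat_recr ?(ltnW K2) //= mulrDr IH //.
  by rewrite [r ^+ K.+1]exprS; ring.
have := exprn_ge0 K r0; have : 0 <= \sum_(2 <= k < K) r ^+ k.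
  by rewrite sumr_ge0 // => k _; rewrite exprn_ge0.
by set S := \sum_(_ <= _ < _) _ in h *; nra.
Qed.

(** The higher prime powers are overcounted by all m^k with m, k >= 2. The geometric series in k
    leaves 2 ln m / m^2 <= 4 m^(-3/2), and the sum over m is at most 8. *)
Lemma sum_mangoldt_nonprime x :
  \sum_(1 <= n < x.+1 | ~~ prime n) mangoldt R n / n%:R <= 8.
Proof.
pose c m k : R := ln m%:R * (m%:R ^+ k)^-1.
have c0 m k : 0 <= c m k by rewrite mulr_ge0 ?ln_nat_ge0 // invr_ge0 exprn_ge0.
apply: (@le_trans _ _ (\sum_(1 <= n < x.+1) \sum_(2 <= m < x.+1) \sum_(2 <= k < x.+1)
    (if n == (m ^ k)%N then c m k else 0))).
  rewrite big_mkcond; apply: ler_sum_nat => n /andP[n0 nx].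
  have nn m k : 0 <= (if n == (m ^ k)%N then c m k else 0) by case: ifP.
  case: ifP => [np|_]; last by rewrite sumr_ge0 // => m _; rewrite sumr_ge0.
  have [->|/mangoldt_neq0[p [k [pp k0 nE]]]] := eqVneq (mangoldt R n) 0.
    by rewrite mul0r sumr_ge0 // => m _; rewrite sumr_ge0.
  have k1 : k != 1%N by apply: contraNneq np => k1; rewrite nE k1 expn1.
  have p1 := prime_gt1 pp.
  have kn : (k < n)%N by rewrite nE ltn_expl.
  have pn : (p <= n)%N by rewrite nE -[X in (X <= _)%N]expn1 leq_exp2l.
  rewrite (bigD1_seq p) ?mem_index_iota ?iota_uniq //=; last by lia.
  rewrite (bigD1_seq k) ?mem_index_iota ?iota_uniq //=; last by lia.
  rewrite {3}nE eqxx [in X in X <= _]nE mangoldtX // natrX -/(c p k) -addrA lerDl.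
  by rewrite addr_ge0 // sumr_ge0 // => m _; rewrite sumr_ge0.
rewrite exchange_big_nat /=.
apply: (@le_trans _ _ (\sum_(2 <= m < x.+1) 4 * (m%:R * rt m)^-1)); last first.
  by rewrite -mulr_sumr; have := sum_pow32 x.+1; lra.
apply: ler_sum_nat => m /andP[m2 _]; rewrite exchange_big_nat /=.
apply: (@le_trans _ _ (\sum_(2 <= k < x.+1) c m k)).
  apply: ler_sum_nat => k _; rewrite -big_mkcond big_nat1_eq.
  by case: ifP.
rewrite -mulr_sumr; have := @sum_geom_tail m x.+1 m2.
have := @ln_div_sq m (ltnW m2); set S := \sum_(_ <= _ < _) _.
have l0 := @ln_nat_ge0 R m.
move=> h1 /(ler_wpM2l l0); rewrite mulrCA; lra.
Qed.

Definition primesum f x : R := \sum_(1 <= p < x.+1 | prime p) f p * (ln p%:R / p%:R).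

Lemma primesum_mangoldt f (S : R) x : (forall n, `|f n| <= S) ->
  `|\sum_(1 <= n < x.+1) f n * (mangoldt R n / n%:R) - primesum f x| <= 8 * S.
Proof.
move=> fS; have S0 : 0 <= S by apply: le_trans (fS 0%N).
rewrite (bigID prime) /= /primesum.
have -> : \sum_(1 <= i < x.+1 | prime i) f i * (mangoldt R i / i%:R) =
  \sum_(1 <= p < x.+1 | prime p) f p * (ln p%:R / p%:R).
  by apply: eq_bigr => p pp; rewrite mangoldt_prime.
rewrite addrAC subrr add0r; apply: le_trans (ler_norm_sum _ _ _) _.
apply: (@le_trans _ _ (S * \sum_(1 <= n < x.+1 | ~~ prime n) mangoldt R n / n%:R)).
  rewrite mulr_sumr; apply: ler_sum => n _.
  have m0 : 0 <= mangoldt R n / n%:R by rewrite divr_ge0 ?mangoldt_ge0.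
  by rewrite normrM (ger0_norm m0) ler_wpM2r.
by rewrite mulrC ler_wpM2r // sum_mangoldt_nonprime.
Qed.

Definition Bdd h := exists C : R, forall x, (0 < x)%N -> `|h x| <= C.

Lemma Bdd_ext h1 h2 : (forall x, (0 < x)%N -> h1 x = h2 x) -> Bdd h1 -> Bdd h2.
Proof. by move=> e [C hC]; exists C => x x0; rewrite -e // hC. Qed.

Lemma Bdd_const (c : R) : Bdd (fun=> c).
Proof. by exists `|c|. Qed.

Lemma Bdd_add h1 h2 : Bdd h1 -> Bdd h2 -> Bdd (fun x => h1 x + h2 x).
Proof.
move=> [C hC] [D hD]; exists (C + D) => x x0.
by apply: le_trans (ler_normD _ _) _; rewrite lerD ?hC ?hD.
Qed.

Lemma Bdd_scale (c : R) h : Bdd h -> Bdd (fun x => c * h x).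
Proof.
by move=> [C hC]; exists (`|c| * C) => x x0; rewrite normrM ler_wpM2l ?hC.
Qed.

Lemma Bdd_sub h1 h2 : Bdd h1 -> Bdd h2 -> Bdd (fun x => h1 x - h2 x).
Proof.
move=> b1 /(Bdd_scale (-1)) b2; apply: Bdd_ext (Bdd_add b1 b2) => x _.
by rewrite mulN1r.
Qed.

Lemma Bdd_sum (I : Type) (r : seq I) (P : pred I) (F : I -> nat -> R) :
  (forall i, P i -> Bdd (F i)) -> Bdd (fun x => \sum_(i <- r | P i) F i x).
Proof.
move=> hF; elim: r => [|i r IH].
  by apply: Bdd_ext (Bdd_const 0) => x _; rewrite big_nil.
case Pi: (P i); last by apply: Bdd_ext IH => x _; rewrite big_cons Pi.
by apply: Bdd_ext (Bdd_add (hF i Pi) IH) => x _; rewrite big_cons Pi.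
Qed.

Lemma Bdd_le h1 h2 : (forall x, (0 < x)%N -> `|h1 x| <= `|h2 x|) -> Bdd h2 -> Bdd h1.
Proof. by move=> le [C hC]; exists C => x x0; apply: le_trans (le x x0) (hC x x0). Qed.

(** Used to compare coefficients: two expansions c ln x + O(1) of the same sum must have the same
    c. *)
Lemma ln_unbounded (c : R) : Bdd (fun x => c * ln x%:R) -> c = 0.
Proof.
move=> [C hC]; apply/eqP; case: (eqVneq c 0) => // c0; exfalso.
have l2 : 0 < ln 2 :> R by rewrite ln_gt0 // ltr1n.
have n0 : 0 < `|c| by rewrite normr_gt0.
set k := Num.Def.archi_bound (C / (`|c| * ln 2)).
have := hC (2 ^ k)%N; rewrite expn_gt0 => /(_ isT).
rewrite natrX lnXn // normrM [X in _ * X]ger0_norm; last by rewrite mulrn_wge0 // ltW.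
have : C / (`|c| * ln 2) < k%:R by rewrite unstable.ltr_bound.
rewrite ltr_pdivrMr ?mulr_gt0 // -mulr_natl; set a := `|c|; nra.
Qed.

Lemma primesumD f g x : primesum (fun n => f n + g n) x = primesum f x + primesum g x.
Proof. by rewrite /primesum -big_split; apply: eq_bigr => p _ /=; rewrite mulrDl. Qed.

Lemma primesumZ (c : R) f x : primesum (fun n => c * f n) x = c * primesum f x.
Proof. by rewrite /primesum mulr_sumr; apply: eq_bigr => p _; rewrite -!mulrA. Qed.

Lemma eq_primesum f g x : (forall n, f n = g n) -> primesum f x = primesum g x.
Proof. by move=> e; apply: eq_bigr => p _; rewrite e. Qed.

Lemma primesum_ge0 f x : (forall n, 0 <= f n) -> 0 <= primesum f x.
Proof.
by move=> f0; apply: sumr_ge0 => p _; rewrite mulr_ge0 // divr_ge0 // ln_nat_ge0.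
Qed.

Lemma primesum_le f g x : (forall n, f n <= g n) -> primesum f x <= primesum g x.
Proof.
by move=> fg; apply: ler_sum => p _; rewrite ler_wpM2r // divr_ge0 // ln_nat_ge0.
Qed.

End PrimeSums.

(** * The operator L on functions of zero mean modulo N *)

Section Periodic.
Variable R : realType.
Local Open Scope ring_scope.
Implicit Types (n m d p x : nat) (f g h : nat -> R).

(** Convergence is required with rate O(1/x), as Abel summation provides it for functions of zero
    mean; uniqueness and linearity then follow by adding constants. *)
Definition is_Lval f (l : R) :=
  exists C, forall x, (0 < x)%N -> `|\sum_(1 <= n < x.+1) f n / n%:R - l| <= C / x.+1%:R.

Definition Lval f : R := xget 0 [set l | is_Lval f l]%classic.

Lemma is_Lval_unique f l1 l2 : is_Lval f l1 -> is_Lval f l2 -> l1 = l2.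
Proof.
move=> [C hC] [D hD]; apply/eqP; rewrite -subr_eq0 -normr_le0; apply/ler_addgt0Pr => e e0; rewrite add0r.
set k := Num.Def.archi_bound ((C + D) / e).
have : (C + D) / e < k%:R by rewrite unstable.ltr_bound.
rewrite ltr_pdivrMr // => h; have k0 : 0 < k.+2%:R :> R by rewrite ltr0n.
have hk : k%:R <= k.+2%:R :> R by rewrite ler_nat; lia.
have := hC k.+1 isT; have := hD k.+1 isT; set s := \sum_(_ <= _ < _) _.
rewrite !ler_pdivlMr // => h1 h2.
rewrite -(ler_pM2r k0); apply: (@le_trans _ _ (C + D)); last by nra.
apply: le_trans (lerD h2 h1); rewrite -mulrDl ler_pM2r //.
have -> : l1 - l2 = (s - l2) - (s - l1) by ring.
by have := ler_normB (s - l2) (s - l1); lra.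
Qed.

Lemma Lval_eq f l : is_Lval f l -> Lval f = l.
Proof.
move=> h; apply: is_Lval_unique (h); rewrite /Lval.
by case: xgetP => [l' _ //|/(_ l)].
Qed.

Lemma Lval_bound f (B : R) :
  (forall m j, `|\sum_(m <= n < j) f n| <= B) ->
  forall x, (0 < x)%N -> `|\sum_(1 <= n < x.+1) f n / n%:R - Lval f| <= B / x.+1%:R.
Proof.
move=> hB; have [l hl] : exists l, forall x, (0 < x)%N ->
    `|\sum_(1 <= n < x.+1) f n / n%:R - l| <= B / x.+1%:R.
  apply: limit_exists => m n /andP[m0 mn].
  rewrite (@big_cat_nat _ _ _ m.+1 1 n.+1) //= opprD addNKr normrN.
  apply: abel_bound => [j _|i mi|]; first exact: hB.
    by rewrite invr_ge0 ler0n lef_pV2 ?posrE ?ltr0n ?ler_nat //; lia.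
  by rewrite invr_ge0.
by rewrite (Lval_eq (l := l)) //; exists B.
Qed.

Lemma is_LvalD f g l1 l2 : is_Lval f l1 -> is_Lval g l2 ->
  is_Lval (fun n => f n + g n) (l1 + l2).
Proof.
move=> [C hC] [D hD]; exists (C + D) => x x0.
under eq_bigr do rewrite mulrDl.
rewrite big_split /= opprD addrACA mulrDl; apply: le_trans (ler_normD _ _) _.
by rewrite lerD ?hC ?hD.
Qed.

Lemma is_LvalZ (c : R) f l : is_Lval f l -> is_Lval (fun n => c * f n) (c * l).
Proof.
move=> [C hC]; exists (`|c| * C) => x x0.
under eq_bigr do rewrite -mulrA.
by rewrite -mulr_sumr -mulrBr normrM -mulrA ler_wpM2l ?hC.
Qed.

Lemma is_Lval0 : is_Lval (fun=> 0) 0.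
Proof. by exists 0 => x _; rewrite big1 ?subrr ?normr0 ?mul0r // => n _; rewrite mul0r. Qed.

Variable N : nat.
Hypothesis N0 : (0 < N)%N.

Definition class_fun f :=
  (forall n, f (n %% N)%N = f n) /\ (forall n, ~~ coprime n N -> f n = 0).

Definition mean_zero f := class_fun f /\ \sum_(0 <= n < N) f n = 0.

Definition translate m f n := f (m * n)%N.

Lemma unit_inverse m : coprime m N ->
  exists m', coprime m' N /\ forall n, (m' * (m * n) = n %[mod N])%N.
Proof.
move=> cm; exists (m ^ (totient N).-1)%N; split; first exact: coprimeXl.
move=> n; rewrite mulnA -expnSr prednK ?totient_gt0 //.
by rewrite -modnMml Euler_exp_totient // modnMml mul1n.
Qed.

Lemma sum_translate f m : (forall n, f (n %% N)%N = f n) -> coprime m N ->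
  \sum_(0 <= n < N) f (m * n)%N = \sum_(0 <= n < N) f n.
Proof.
move=> fp cm; rewrite !big_mkord.
pose h (i : 'I_N) := Ordinal (ltn_pmod (m * i) N0).
have hI : injective h.
  move=> i j /(congr1 val) /= e; have [m' [_ hm']] := unit_inverse cm.
  apply: val_inj; rewrite /= -[LHS](modn_small (ltn_ord i)) -[RHS](modn_small (ltn_ord j)).
  by rewrite -(hm' i) -(hm' j) -modnMmr e modnMmr.
rewrite [RHS](reindex_inj hI); apply: eq_bigr => i _ /=; by rewrite fp.
Qed.

Lemma class_fun_translate f m : coprime m N -> class_fun f -> class_fun (translate m f).
Proof.
move=> cm [fp fs]; split=> n; first by rewrite /translate -fp modnMmr fp.
by move=> cn; apply: fs; rewrite coprimeMl negb_and cn orbT.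
Qed.

Lemma mean_zero_translate f m : coprime m N -> mean_zero f -> mean_zero (translate m f).
Proof.
by move=> cm [cf f0]; split; [exact: class_fun_translate|rewrite sum_translate //; case: cf].
Qed.

Definition l1norm f : R := \sum_(0 <= n < N) `|f n|.

Lemma class_fun_le f n : class_fun f -> `|f n| <= l1norm f.
Proof.
move=> [fp _]; rewrite -fp /l1norm (bigD1_seq (n %% N)%N) ?iota_uniq //=; last first.
  by rewrite mem_index_iota ltn_pmod.
by rewrite lerDl sumr_ge0.
Qed.

(** Full periods cancel, so an initial sum reduces to part of one period; an interval is the
    difference of two initial sums. *)
Lemma mean_zero_partial f m j : mean_zero f ->
  `|\sum_(m <= n < j) f n| <= 2 * l1norm f.
Proof.
move=> [[fp fs] f0]; have l0 : 0 <= l1norm f by apply: sumr_ge0.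
have F x : `|\sum_(0 <= n < x) f n| <= l1norm f.
  have shift y : \sum_(0 <= n < y + N) f n = \sum_(0 <= n < y) f n.
    elim: y => [|y IH]; first by rewrite add0n f0 big_geq.
    by rewrite addSn !big_nat_recr //= IH -(fp (y + N)%N) modnDr fp.
  rewrite (divn_eq x N) addnC; elim: (x %/ N)%N => [|k IH].
    rewrite mul0n addn0; apply: le_trans (ler_norm_sum _ _ _) _.
    rewrite /l1norm [X in _ <= X](@big_cat_nat _ _ _ (x %% N)%N 0 N) //=; last first.
      by rewrite ltnW // ltn_pmod.
    by rewrite lerDl sumr_ge0.
  by rewrite mulSn addnCA addnC shift.
have [mj|/ltnW mj] := leqP m j; last first.
  by rewrite big_geq // normr0 mulr_ge0.
have -> : \sum_(m <= n < j) f n = \sum_(0 <= n < j) f n - \sum_(0 <= n < m) f n.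
  by rewrite [in RHS](@big_cat_nat _ _ _ m 0 j) //= addrAC subrr add0r.
by apply: le_trans (ler_normB _ _) _; rewrite mulrDl mul1r lerD.
Qed.

Lemma l1norm_translate f m : coprime m N -> class_fun f -> l1norm (translate m f) = l1norm f.
Proof.
move=> cm [fp _]; apply: (sum_translate (f := fun n => `|f n|)) => // n.
by rewrite fp.
Qed.

(* On a character chi, [Lop] acts as multiplication by L(1, chi). *)
Definition Lop f m : R := if coprime m N then Lval (translate m f) else 0.

Lemma Lop_spec f m : mean_zero f -> coprime m N -> is_Lval (translate m f) (Lop f m).
Proof.
move=> mf cm; rewrite /Lop cm; exists (2 * l1norm (translate m f)) => x x0.
by apply: Lval_bound => // i j; apply: mean_zero_partial; apply: mean_zero_translate.
Qed.

(** The constant is uniform in d because translation by a unit permutes the residues and preserves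
    [l1norm]; if d is not a unit, both the sum and [Lop f d] vanish. *)
Lemma Lop_approx f x d : mean_zero f -> (0 < d <= x)%N ->
  `|\sum_(1 <= e < (x %/ d).+1) f (d * e)%N / e%:R - Lop f d| <=
  2 * l1norm f * (d%:R / x%:R).
Proof.
move=> mf /andP[d0 dx]; have [[fp fs] f0] := mf.
have l0 : 0 <= l1norm f by apply: sumr_ge0.
have [cd|cd] := boolP (coprime d N); last first.
  rewrite /Lop (negPf cd) subr0 big1; first by rewrite normr0 mulr_ge0 ?divr_ge0 // mulr_ge0.
  by move=> e _; rewrite fs ?mul0r // coprimeMl (negPf cd).
rewrite /Lop cd; have x0 : (0 < x)%N by lia.
have hx : (0 < x %/ d)%N by rewrite divn_gt0.
have := @Lval_bound (translate d f) (2 * l1norm f) _ _ hx.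
move=> h; apply: le_trans (h _) _.
  move=> m j; rewrite -(l1norm_translate cd mf.1).
  by apply: mean_zero_partial; apply: mean_zero_translate.
rewrite ler_wpM2l ?mulr_ge0 // -[X in X <= _]mul1r ler_pdivrMr ?ltr0n // mulrAC.
by rewrite ler_pdivlMr ?ltr0n // mul1r -natrM ler_nat mulnC ltnW // ltn_ceil.
Qed.

Lemma ln4_ge1 : 1 <= ln 4 :> R.
Proof.
have h : ln 2^-1 = - ln 2 :> R by rewrite lnV ?posrE.
have -> : 4 = 2 * 2 :> R by rewrite -natrM.
rewrite lnM ?posrE //.
have := @le_ln1Dx R (- 2^-1); have -> : 1 + - 2^-1 = 2^-1 :> R by lra.
by rewrite h; lra.
Qed.

Lemma sum_ln_div_Bdd f : mean_zero f ->
  Bdd (fun x => \sum_(1 <= n < x.+1) f n * (ln n%:R / n%:R)).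
Proof.
move=> mf; pose g n := f n * (ln n%:R / n%:R) : R.
exists (\sum_(1 <= n < 4) `|g n| + 2 * l1norm f * (ln 4 / 4)) => x _.
(* The weight ln n / n decreases as soon as ln n >= 1, which is available from n = 4 on by
   [ln4_ge1]; the terms before 4 are bounded separately. *)
have tail : `|\sum_(4 <= n < x.+1) g n| <= 2 * l1norm f * (ln 4 / 4).
  apply: (@abel_bound R f (fun n => ln n%:R / n%:R)).
  - by move=> j _; apply: mean_zero_partial.
  - move=> n n4; rewrite divr_ge0 ?ln_nat_ge0 //=.
    have n0 : (0 < n)%N by lia.
    rewrite ler_pdivrMr ?ltr0n // mulrAC ler_pdivlMr ?ltr0n //.
    have [_ h] := lnS_bounds R n0.
    have := ler_ln_nat R (m := 4) (n := n); rewrite n4 => /(_ isT).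
    by have := ln4_ge1; rewrite -[n.+1]addn1 natrD in h *; lra.
  - by rewrite divr_ge0 // ln_nat_ge0.
have [x4|x4] := leqP 4 x.+1.
  rewrite (@big_cat_nat _ _ _ 4 1 x.+1) //=; apply: le_trans (ler_normD _ _) _.
  by apply: lerD => //; apply: ler_norm_sum.
apply: le_trans (ler_norm_sum _ _ _) _.
rewrite [X in _ <= X + _](@big_cat_nat _ _ _ x.+1 1 4) //=; last by lia.
rewrite -addrA lerDl addr_ge0 ?sumr_ge0 //; apply: le_trans tail; exact: normr_ge0.
Qed.

Lemma primesum_Bdd_mangoldt f (S : R) h : (forall n, `|f n| <= S) ->
  Bdd (fun x => \sum_(1 <= n < x.+1) f n * (mangoldt R n / n%:R) + h x) ->
  Bdd (fun x => primesum f x + h x).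
Proof.
move=> fS b; pose u x := \sum_(1 <= n < x.+1) f n * (mangoldt R n / n%:R) - primesum f x.
have bu : Bdd u by exists (8 * S) => x _; apply: primesum_mangoldt.
by apply: Bdd_ext (Bdd_sub b bu) => x _; rewrite /u; ring.
Qed.

Lemma Lop_class_fun f : mean_zero f -> class_fun (Lop f).
Proof.
move=> mf; have [[fp fs] _] := mf; split=> n; last by move=> cn; rewrite /Lop (negPf cn).
rewrite /Lop coprime_modl; case: ifP => // _; congr Lval.
by apply/funext => m; rewrite /translate -fp modnMml fp.
Qed.

(** Expand ln n as the sum of [mangoldt] d over d | n in the bounded sum of f(n) ln n / n. The inner
    sum over e of f(de)/e is [Lop f d] up to O(d/x), and Chebyshev's bound absorbs the total
    error. *)
Lemma primesum_Lop_Bdd f : mean_zero f -> Bdd (primesum (Lop f)).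
Proof.
move=> mf; have cL := Lop_class_fun mf.
have l0 : 0 <= l1norm f by apply: sumr_ge0.
apply: (@Bdd_ext R (fun x => primesum (Lop f) x + 0)); first by move=> x _; rewrite addr0.
apply: primesum_Bdd_mangoldt (fun n => class_fun_le n cL) _.
have b := sum_ln_div_Bdd mf.
have b2 : Bdd (fun x => \sum_(1 <= n < x.+1) f n * (ln n%:R / n%:R) -
    \sum_(1 <= n < x.+1) Lop f n * (mangoldt R n / n%:R)).
  exists (2 * l1norm f * 6) => x x0; have x0R : 0 < x%:R :> R by rewrite ltr0n.
  pose F d e : R := mangoldt R d / d%:R * (f (d * e)%N / e%:R).
  have -> : \sum_(1 <= n < x.+1) f n * (ln n%:R / n%:R) =
      \sum_(1 <= n < x.+1) \sum_(d <- divisors n) F d (n %/ d)%N.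
    apply: eq_big_nat => n /andP[n0 _]; rewrite -sum_mangoldt //.
    rewrite mulr_suml mulr_sumr; apply: eq_big_seq => d; rewrite -dvdn_divisors // => dn.
    have d0 := dvdn_gt0 n0 dn; rewrite /F mulnC divnK //.
    have nE : n%:R = (n %/ d)%:R * d%:R :> R by rewrite -natrM divnK.
    rewrite nE; set k := (n %/ d)%N.
    have k0 : (0 < k)%N by rewrite divn_gt0 // dvdn_leq.
    by field; rewrite !pnatr_eq0 -!lt0n d0 k0.
  rewrite (sum_divisors_swap x F) -sumrB; apply: le_trans (ler_norm_sum _ _ _) _.
  apply: (@le_trans _ _ (\sum_(1 <= d < x.+1) 2 * l1norm f / x%:R * mangoldt R d)).
    apply: ler_sum_nat => d /andP[d0 dx].
    rewrite /F -mulr_sumr [X in _ - X]mulrC -mulrBr normrM.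
    have d0R : 0 < d%:R :> R by rewrite ltr0n.
    have m0 : 0 <= mangoldt R d / d%:R by rewrite divr_ge0 ?mangoldt_ge0.
    rewrite (ger0_norm m0).
    have dx' : (0 < d <= x)%N by rewrite d0.
    apply: le_trans (ler_wpM2l m0 (Lop_approx mf dx')) _.
    rewrite le_eqVlt; apply/orP; left; apply/eqP; field.
    by rewrite !gt_eqF.
  rewrite -mulr_sumr -/(psi R x) -mulrA ler_wpM2l ?mulr_ge0 // mulrC ler_pdivrMr //.
  exact: psi_le.
by apply: Bdd_ext (Bdd_sub b b2) => x _; ring.
Qed.

(** Rests on the identity: the sum of moebius(d) ln(x/d) over d | n is mangoldt(n), plus ln x if n =
    1. When [Lop f] vanishes, the inner sums are pure error O(d/x), and the sum of ln(x/d) over d <=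
    x is at most x by Stirling. *)
Lemma primesum_kernel f : mean_zero f -> (forall n, Lop f n = 0) ->
  Bdd (fun x => primesum f x + f 1%N * ln x%:R).
Proof.
move=> mf L0; have [cf _] := mf.
have l0 : 0 <= l1norm f by apply: sumr_ge0.
apply: primesum_Bdd_mangoldt (fun n => class_fun_le n cf) _.
exists (2 * l1norm f) => x x0; have x0R : 0 < x%:R :> R by rewrite ltr0n.
pose F d e : R := moebius R d / d%:R * (ln x%:R - ln d%:R) * (f (d * e)%N / e%:R).
have -> : \sum_(1 <= n < x.+1) f n * (mangoldt R n / n%:R) + f 1%N * ln x%:R =
    \sum_(1 <= n < x.+1) \sum_(d <- divisors n) F d (n %/ d)%N.
  transitivity (\sum_(1 <= n < x.+1) f n / n%:R * (mangoldt R n + (n == 1%N)%:R * ln x%:R)).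
    under [RHS]eq_bigr do rewrite mulrDr.
    rewrite big_split /=; congr (_ + _); first by apply: eq_bigr => n _; ring.
    rewrite big_ltn // big1_seq ?addr0 /=; first by rewrite divr1 mul1r.
    move=> n; rewrite mem_index_iota => /andP[n1 _].
    by rewrite (gtn_eqF n1) mul0r mulr0.
  apply: eq_big_nat => n /andP[n0 _].
  rewrite -[mangoldt R n]opprK -sum_moebius_ln // -sum_moebius // mulr_suml -sumrN -big_split.
  rewrite mulr_sumr /=; apply: eq_big_seq => d; rewrite -dvdn_divisors // => dn.
  have d0 := dvdn_gt0 n0 dn; rewrite /F [in RHS]mulnC divnK //.
  have nE : n%:R = (n %/ d)%:R * d%:R :> R by rewrite -natrM divnK.
  rewrite nE; set k := (n %/ d)%N.
  have k0 : (0 < k)%N by rewrite divn_gt0 // dvdn_leq.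
  by field; rewrite !pnatr_eq0 -!lt0n d0 k0.
rewrite (sum_divisors_swap x F); apply: le_trans (ler_norm_sum _ _ _) _.
apply: (@le_trans _ _ (\sum_(1 <= d < x.+1) 2 * l1norm f / x%:R * (ln x%:R - ln d%:R))).
  apply: ler_sum_nat => d /andP[d0 dx].
  have d0R : 0 < d%:R :> R by rewrite ltr0n.
  have dx' : (0 < d <= x)%N by rewrite d0.
  have := Lop_approx mf dx'; rewrite L0 subr0 /F -mulr_sumr.
  set T := \sum_(_ <= _ < _) _ => hT.
  have lx : 0 <= ln x%:R - ln d%:R :> R by rewrite subr_ge0 ler_ln_nat.
  rewrite !normrM (ger0_norm lx) normfV (ger0_norm (ltW d0R)).
  apply: (@le_trans _ _ (1 / d%:R * (ln x%:R - ln d%:R) * (2 * l1norm f * (d%:R / x%:R)))).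
    apply: ler_pM => //; first by rewrite mulr_ge0 // mulr_ge0 // invr_ge0 ltW.
    by rewrite ler_wpM2r // ler_wpM2r ?moebius_norm // invr_ge0 ltW.
  rewrite le_eqVlt; apply/orP; left; apply/eqP; field.
  by rewrite !gt_eqF.
rewrite -mulr_sumr sumrB sumr_const_nat subn1 /= -[ln _ *+ x]mulr_natl.
rewrite -mulrA; apply: ler_piMr; first by rewrite mulr_ge0.
rewrite (ler_pdivrMl _ _ x0R) mulr1.
by have := lnfact_ge R x; lra.
Qed.

End Periodic.

(** * Divisors of coprime products and of prime powers *)

Section Divisors.
Implicit Types (n m d p : nat).

Lemma divisorsM a b : 0 < a -> 0 < b -> coprime a b ->
  perm_eq (divisors (a * b)) [seq d * e | d <- divisors a, e <- divisors b].
Proof.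
move=> a0 b0 ab; have ab0 : 0 < a * b by rewrite muln_gt0 a0.
have gl d e : d %| a -> e %| b -> gcdn (d * e) a = d.
  move=> da eb; rewrite gcdnC Gauss_gcdl; first exact/gcdn_idPr.
  exact: coprime_dvdr eb ab.
have gr d e : d %| a -> e %| b -> gcdn (d * e) b = e.
  move=> da eb; rewrite gcdnC Gauss_gcdr; first exact/gcdn_idPr.
  by rewrite coprime_sym; apply: coprime_dvdl da ab.
apply: uniq_perm; first exact: divisors_uniq.
  apply: allpairs_uniq; try exact: divisors_uniq.
  move=> [d e] [d' e'] /allpairsP[[x y] /= [hx hy [-> ->]]].
  move=> /allpairsP[[x' y'] /= [hx' hy' [-> ->]]] /= eq.
  move: hx hy hx' hy'; rewrite -!dvdn_divisors // => hx hy hx' hy'.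
  by rewrite -(gl x y) // -{2}(gr x y) // eq gl // gr.
move=> d; rewrite -dvdn_divisors //; apply/idP/allpairsP.
  move=> dab; exists (gcdn d a, gcdn d b) => /=.
  rewrite -!dvdn_divisors ?dvdn_gcdr //; split => //.
  apply/eqP; rewrite eqn_dvd; apply/andP; split.
    rewrite muln_gcdr dvdn_gcd dvdn_mull //= muln_gcdl dvdn_gcd dab andbT.
    exact: dvdn_mulr.
  rewrite Gauss_dvd ?dvdn_gcdl //.
  by apply: coprime_dvdl (dvdn_gcdr _ _) _; apply: coprime_dvdr (dvdn_gcdr _ _) ab.
by move=> [[x y] /= []]; rewrite -!dvdn_divisors // => xa yb ->; apply: dvdn_mul.
Qed.

Lemma divisors_pfactor p k : prime p ->
  perm_eq (divisors (p ^ k)) [seq p ^ i | i <- iota 0 k.+1].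
Proof.
move=> pp; apply: uniq_perm; first exact: divisors_uniq.
  by rewrite map_inj_uniq ?iota_uniq // => i j /eqP; rewrite eqn_exp2l ?prime_gt1 // => /eqP.
move=> d; rewrite -dvdn_divisors ?expn_gt0 ?prime_gt0 //.
apply/(dvdn_pfactor _ _ pp)/mapP => [[i ik ->]|[i ik ->]]; exists i => //.
  by rewrite mem_iota.
by move: ik; rewrite mem_iota.
Qed.

Lemma prime_power_split n : 1 < n -> exists p k m,
  [/\ prime p, 0 < k, ~~ (p %| m), 0 < m < n & n = p ^ k * m].
Proof.
move=> n1; have n0 := ltnW n1; have pp := pdiv_prime n1; set p := pdiv n in pp.
have k0 : 0 < logn p n by rewrite logn_gt0 mem_primes pp n0 pdiv_dvd.
have [m pm nE] := pfactor_coprime pp n0.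
have m0 : 0 < m by move: n0; rewrite nE muln_gt0 => /andP[].
exists p, (logn p n), m; split => //; first by rewrite -prime_coprime.
  by rewrite m0 [X in _ < X]nE ltn_Pmulr // -[1](expn0 p) ltn_exp2l // prime_gt1.
by rewrite mulnC.
Qed.

End Divisors.

Section DivisorsSum.
Variable R : realType.
Local Open Scope ring_scope.

Lemma sum_divisorsM (F : nat -> R) a b : (0 < a)%N -> (0 < b)%N -> coprime a b ->
  (forall d e, F (d * e)%N = F d * F e) ->
  \sum_(d <- divisors (a * b)) F d =
  (\sum_(d <- divisors a) F d) * (\sum_(d <- divisors b) F d).
Proof.
move=> a0 b0 ab FM; rewrite (perm_big _ (divisorsM a0 b0 ab)) big_allpairs_dep /= mulr_suml.
by apply: eq_bigr => d _; rewrite mulr_sumr; apply: eq_bigr => e _.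
Qed.

Lemma sum_divisors_pfactor (F : nat -> R) p k : prime p ->
  \sum_(d <- divisors (p ^ k)) F d = \sum_(0 <= i < k.+1) F (p ^ i)%N.
Proof. by move=> pp; rewrite (perm_big _ (divisors_pfactor k pp)) big_map. Qed.

End DivisorsSum.

(** * Nonvanishing of L(1, chi) for real characters *)

Section RealCharacter.
Variable R : realType.
Local Open Scope ring_scope.
Variables (N : nat) (N0 : (0 < N)%N) (chi : nat -> R).
Hypothesis chi0 : mean_zero N chi.
Hypothesis chi1 : chi 1%N = 1.
Hypothesis chiM : forall m n, chi (m * n)%N = chi m * chi n.
Hypothesis chi_real : forall n, chi n = 0 \/ chi n = 1 \/ chi n = -1.

Let A n : R := \sum_(d <- divisors n) chi d.

Lemma chiX p k : chi (p ^ k)%N = chi p ^+ k.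
Proof. by elim: k => [|k IH]; rewrite ?expn0 ?expr0 // expnS chiM IH exprS. Qed.

Lemma sum_char_prime_power p k : prime p -> 0 <= A (p ^ k)%N /\ (~~ odd k -> 1 <= A (p ^ k)%N).
Proof.
move=> pp; rewrite /A sum_divisors_pfactor //.
under eq_bigr do rewrite chiX.
have [->|[->|->]] := chi_real p.
- rewrite big_ltn // expr0 big1_seq ?addr0 //.
  by move=> i /=; rewrite mem_index_iota => /andP[i0 _]; rewrite expr0n gtn_eqF.
- have -> : \sum_(0 <= i < k.+1) 1 ^+ i = k.+1%:R :> R.
    by under eq_bigr do rewrite expr1n; rewrite sumr_const_nat subn0.
  by rewrite ler0n ler1n.
have -> : \sum_(0 <= i < k.+1) (-1) ^+ i = (~~ odd k)%:R :> R.
  elim: k => [|k IH]; first by rewrite big_nat1 expr0.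
  rewrite big_nat_recr //= IH -signr_odd /=.
  by case: (odd k); rewrite /= ?expr1 ?expr0 ?addr0 ?add0r ?subrr.
by rewrite ler0n; split => // ->.
Qed.

Lemma sum_char_ge0 n : (0 < n)%N ->
  0 <= A n /\ ((forall q, ~~ odd (logn q n)) -> 1 <= A n).
Proof.
elim/ltn_ind: n => n IH n0; have [->|n1] := eqVneq n 1%N.
  by rewrite /A big_cons big_nil addr0 chi1.
have [|p [k [m [pp k0 pm /andP[m0 mn] nE]]]] := @prime_power_split n; first by lia.
have pk0 : (0 < p ^ k)%N by rewrite expn_gt0 prime_gt0.
have cop : coprime (p ^ k) m by rewrite coprimeXl // prime_coprime.
have -> : A n = A (p ^ k)%N * A m by rewrite nE /A sum_divisorsM.
have [h1 h2] := IH m mn m0; have [h3 h4] := sum_char_prime_power k pp.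
split; first exact: mulr_ge0.
move=> ev; have ek : ~~ odd k.
  have := ev p; rewrite nE lognM // lognX (logn_prime _ pp) eqxx muln1.
  by rewrite (lognE p m) (negPf pm) !andbF addn0.
have em q : ~~ odd (logn q m).
  have [->|qp] := eqVneq q p; first by rewrite lognE (negPf pm) !andbF.
  have := ev q; rewrite nE lognM // lognX (logn_prime _ pp) (negPf qp).
  by rewrite muln0.
by have := h2 em; have := h4 ek; nra.
Qed.

Lemma sum_char_square m : (0 < m)%N -> 1 <= A (m ^ 2)%N.
Proof.
move=> m0; have [|_ ->] // := @sum_char_ge0 (m ^ 2)%N; first by rewrite expn_gt0 m0.
by move=> q; rewrite lognX oddM.
Qed.

Let H k : R := \sum_(1 <= e < k.+1) (rt R e)^-1.

Lemma sum_inv_ge_ln x : ln x.+1%:R <= \sum_(1 <= m < x.+1) m%:R^-1 :> R.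
Proof.
elim: x => [|x IH]; first by rewrite ln1 big_geq.
rewrite big_nat_recr //=; have [_ h] := @lnS_bounds R x.+1 isT.
have x0 : 0 < x.+1%:R :> R by rewrite ltr0n.
have : ln x.+2%:R - ln x.+1%:R <= x.+1%:R^-1 :> R.
  by rewrite -(ler_pM2l x0) divff // gt_eqF.
move=> h2; apply: le_trans (lerD IH (lexx _)); rewrite -lerBlDl; exact: h2.
Qed.

(* [B] diverges because A >= 1 at squares; if L(1, chi) = 0, the hyperbola method bounds it. *)
Let B x : R := \sum_(1 <= n < x.+1) A n / rt R n.

(** Only the terms with n = m^2 are kept, each at least 1/m; the others are nonnegative. *)
Lemma B_square_ge y : ln y.+1%:R <= B (y ^ 2).
Proof.
apply: le_trans (sum_inv_ge_ln y) _.
have T0 n : (0 < n)%N -> 0 <= A n / rt R n.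
  by move=> n0; rewrite divr_ge0 ?sqrtr_ge0 //; case: (sum_char_ge0 n0).
elim: y => [|y IH]; first by rewrite /B !big_geq.
rewrite big_nat_recr //= /B (@big_cat_nat _ _ _ (y ^ 2).+1 1 (y.+1 ^ 2).+1); [|by []|by rewrite ltnS leq_exp2r].
apply: lerD => //; rewrite big_nat_recr ?ltn_exp2r //.
rewrite -[X in X <= _]add0r; apply: lerD.
  by rewrite big_nat sumr_ge0 // => i /andP[i0 _]; rewrite T0 //; lia.
have -> : rt R (y.+1 ^ 2) = y.+1%:R by rewrite /rt natrX sqrtr_sqr ger0_norm.
by rewrite ler_pdivlMr ?ltr0n // mulVf ?pnatr_eq0 // sum_char_square.
Qed.

Lemma rtS_bounds e : (0 < e)%N ->
  (rt R e.+1)^-1 <= 2 * (rt R e.+1 - rt R e) <= (rt R e)^-1.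
Proof.
move=> e0; have a0 := rt_gt0 R e0; have b0 := @rt_gt0 R e.+1 isT.
have ab := rt_le R (leqnSn e).
have h : (rt R e.+1 - rt R e) * (rt R e.+1 + rt R e) = 1.
  rewrite -subr_sqr !expr2 !rt_sq -natrB // subSnn //.
move: a0 b0 ab h; set a := rt R e; set b := rt R e.+1 => a0 b0 ab h.
have sq : 0 <= (b - a) * (b - a) by rewrite -expr2 sqr_ge0.
apply/andP; split.
  by rewrite -(ler_pM2r b0) mulVf ?gt_eqF //; lra.
by rewrite -(ler_pM2r a0) mulVf ?gt_eqF //; lra.
Qed.

(** H(k) - 2 sqrt k decreases, and its decrease from m to n is at most 1/sqrt m - 1/sqrt n. The
    limit c is zeta(1/2). *)
Lemma H_asymp : exists c, forall k, (0 < k)%N -> `|H k - 2 * rt R k - c| <= (rt R k)^-1.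
Proof.
apply: limit_exists => m n /andP[m0 mn].
have : 0 <= (H m - 2 * rt R m) - (H n - 2 * rt R n) <= (rt R m)^-1 - (rt R n)^-1.
  elim: n mn => [|n IH]; first by lia.
  rewrite leq_eqVlt => /predU1P[<-|]; first by rewrite !subrr lexx.
  rewrite ltnS => mn; have n0 : (0 < n)%N by lia.
  have := rtS_bounds n0; have := IH mn.
  have -> : H n.+1 = H n + (rt R n.+1)^-1 by rewrite /H big_nat_recr.
  by move=> /andP[h1 h2] /andP[h3 h4]; apply/andP; split; lra.
have : 0 < (rt R n)^-1 by rewrite invr_gt0 rt_gt0 //; lia.
by move=> h /andP[h1 h2]; rewrite ger0_norm //; lra.
Qed.

Lemma H_le k : H k <= 2 * rt R k.
Proof.
elim: k => [|k IH]; first by rewrite /H big_geq // mulr_ge0 // sqrtr_ge0.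
rewrite /H big_nat_recr //= -/(H k); case: k IH => [|k] IH.
  by rewrite /H big_geq // /rt sqrtr1 invr1; lra.
by have /andP[h _] := @rtS_bounds k.+1 isT; lra.
Qed.

Lemma H_mono j k : (j <= k)%N -> H j <= H k.
Proof.
move=> jk; rewrite /H [X in _ <= X](@big_cat_nat _ _ _ j.+1) //= lerDl.
by rewrite sumr_ge0 // => e _; rewrite invr_ge0 sqrtr_ge0.
Qed.

Lemma B_square_bounded : Lval chi = 0 -> exists C, forall y, (0 < y)%N -> B (y ^ 2) <= C.
Proof.
move=> L0; have [c hc] := H_asymp; set K := 2 * l1norm N chi.
have K0 : 0 <= K by rewrite mulr_ge0 // sumr_ge0.
have [chic _] := chi0.
have part m j : `|\sum_(m <= n < j) chi n| <= K by apply: mean_zero_partial.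
exists (2 * K + `|c| * K + 4 + K * 2) => y y0.
have ry := rt_gt0 R y0; have y0R : 0 < y%:R :> R by rewrite ltr0n.
pose F d e : R := chi d / rt R d * (rt R e)^-1.
have BE : B (y ^ 2) = \sum_(1 <= d < (y ^ 2).+1) chi d * ((rt R d)^-1 * H (y ^ 2 %/ d)).
  transitivity (\sum_(1 <= n < (y ^ 2).+1) \sum_(d <- divisors n) F d (n %/ d)%N).
    apply: eq_big_nat => n /andP[n0 _]; rewrite /A mulr_suml.
    apply: eq_big_seq => d; rewrite -dvdn_divisors // => dn.
    rewrite /F -mulrA -invfM; congr (_ / _).
    by rewrite /rt -sqrtrM ?ler0n // -natrM mulnC divnK.
  rewrite (sum_divisors_swap (y ^ 2) F); apply: eq_bigr => d _.
  by rewrite /F -mulr_sumr mulrA.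
have yy : (y <= y ^ 2)%N by rewrite -mulnn leq_pmulr.
(* For d > y the weight H(y^2/d)/sqrt d is nonincreasing in d and starts at a value at most 2, so
   Abel summation bounds this range by 2 K. *)
rewrite BE (@big_cat_nat _ _ _ y.+1) //=.
apply: lerD; last first.
  apply: le_trans (ler_norm _) _.
  apply: le_trans (@abel_bound R chi (fun d => (rt R d)^-1 * H (y ^ 2 %/ d)) K _ _ _ _ _) _ => //.
  - move=> n yn; have n0 : (0 < n)%N by lia.
    have r1 := rt_gt0 R n0; have r2 := @rt_gt0 R n.+1 isT.
    have Hp k : 0 <= H k by rewrite sumr_ge0 // => e _; rewrite invr_ge0 sqrtr_ge0.
    apply/andP; split; first by rewrite mulr_ge0 // invr_ge0 ltW.
    apply: ler_pM => //.
    + by rewrite invr_ge0 ltW.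
    + by rewrite lef_pV2 ?posrE // rt_le.
    by apply: H_mono; apply: leq_div2l.
  - by rewrite mulr_ge0 ?invr_ge0 ?sqrtr_ge0 // sumr_ge0 // => e _; rewrite invr_ge0 sqrtr_ge0.
  apply: ler_wpM2l => //; rewrite ler_pdivrMl ?rt_gt0 //.
  have hk : (y ^ 2 %/ y.+1 <= y)%N.
    by rewrite -ltnS ltn_divLR // -mulnn; nia.
  apply: le_trans (H_mono hk) _; apply: le_trans (H_le y) _.
  by rewrite mulrC ler_wpM2r // rt_le.
apply: le_trans (ler_norm _) _.
have app d : (0 < d <= y)%N ->
    `|H (y ^ 2 %/ d) - 2 * (y%:R / rt R d) - c| <= 4 * (rt R d / y%:R).
  move=> /andP[d0 dy]; set k := (y ^ 2 %/ d)%N.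
  have k0 : (0 < k)%N by rewrite divn_gt0 // (leq_trans dy).
  have rk := rt_gt0 R k0; have rd := rt_gt0 R d0.
  have lo : (k * d <= y ^ 2)%N by apply: leq_divM.
  have hi : (y ^ 2 < k.+1 * d)%N by apply: ltn_ceil.
  have ryE : rt R (y ^ 2) = y%:R by rewrite /rt natrX sqrtr_sqr ger0_norm.
  have rM a b : rt R (a * b) = rt R a * rt R b by rewrite /rt natrM sqrtrM.
  have lo' : rt R k * rt R d <= y%:R by rewrite -rM -ryE rt_le.
  have hi' : y%:R <= rt R k.+1 * rt R d by rewrite -rM -ryE rt_le // ltnW.
  have hi2 : y%:R <= 2 * rt R k * rt R d.
    have r4 : rt R 4 = 2 by rewrite /rt (_ : 4%:R = 2 ^+ 2) ?sqrtr_sqr ?ger0_norm // -natrX.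
    by rewrite -r4 -!rM -ryE rt_le //; nia.
  have /andP[_ s1] := rtS_bounds k0; have := hc k k0.
  have e1 : 2 * (y%:R / rt R d) <= 2 * rt R k.+1.
    by rewrite ler_pM2l // ler_pdivrMr.
  have e2 : 2 * rt R k <= 2 * (y%:R / rt R d).
    by rewrite ler_pM2l // ler_pdivlMr.
  have e3 : (rt R k)^-1 <= 2 * (rt R d / y%:R).
    by rewrite mulrA ler_pdivlMr // mulrC ler_pdivrMr //; lra.
  rewrite !ler_norml => /andP[h1 h2]; apply/andP; split; lra.
(* For d <= y, H is replaced by its asymptotics. The main term is 2 y times a partial sum of L(1,
   chi) = 0, hence at most 2 K; the term in c is bounded by Abel summation; the errors add up to
   4. *)
rewrite (_ : \sum_(1 <= d < y.+1) _ =
  2 * y%:R * \sum_(1 <= d < y.+1) chi d / d%:R +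
  c * (\sum_(1 <= d < y.+1) chi d * (rt R d)^-1) +
  \sum_(1 <= d < y.+1) chi d / rt R d * (H (y ^ 2 %/ d) - 2 * (y%:R / rt R d) - c)); last first.
  rewrite !mulr_sumr -!big_split; apply: eq_big_nat => d /andP[d0 _] /=.
  by rewrite -(rt_sq R d); field; rewrite gt_eqF // rt_gt0.
apply: le_trans (ler_normD _ _) _; apply: lerD; last first.
  apply: le_trans (ler_norm_sum _ _ _) _.
  apply: (@le_trans _ _ (\sum_(1 <= d < y.+1) 4 / y%:R)).
    apply: ler_sum_nat => d dy; have /andP[d0 _] := dy.
    have rd := rt_gt0 R d0; rewrite !normrM normfV (ger0_norm (ltW rd)).
    apply: (@le_trans _ _ (1 / rt R d * (4 * (rt R d / y%:R)))).
      apply: ler_pM => //; last by apply: app; lia.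
        by rewrite divr_ge0 // ltW.
      rewrite ler_wpM2r ?invr_ge0 ?(ltW rd) //.
      by have [->|[->|->]] := chi_real d; rewrite ?normr0 ?normrN ?normr1.
    rewrite le_eqVlt; apply/orP; left; apply/eqP; field.
    by rewrite !gt_eqF.
  by rewrite sumr_const_nat subn1 /= -[(4 / _) *+ _]mulr_natr mulfVK ?gt_eqF.
apply: le_trans (ler_normD _ _) _; apply: lerD.
  rewrite normrM ger0_norm; last by rewrite mulr_ge0.
  rewrite -mulrA ler_pM2l // -ler_pdivlMl //.
  have := Lval_bound part y0; rewrite L0 subr0 => h; apply: le_trans h _.
  by rewrite mulrC ler_wpM2r // lef_pV2 ?posrE ?ltr0n // ler_nat.
rewrite normrM ler_wpM2l //.
apply: le_trans (@abel_bound R chi (fun d => (rt R d)^-1) K _ _ _ _ _) _ => //.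
- move=> n n0; rewrite invr_ge0 sqrtr_ge0 /= lef_pV2 ?posrE ?rt_gt0 // rt_le //.
- by rewrite invr_ge0 sqrtr_ge0.
by rewrite /rt sqrtr1 invr1 mulr1.
Qed.

Lemma Lval_real_character_neq0 : Lval chi != 0.
Proof.
apply/negP => /eqP /B_square_bounded [C hC].
have : (1 : R) = 0; last by move/eqP; rewrite oner_eq0.
apply: ln_unbounded; exists C => x x0; rewrite mul1r ger0_norm ?ln_nat_ge0 //.
apply: le_trans (hC x x0); apply: le_trans (B_square_ge x).
by apply: ler_ln_nat; rewrite x0 leqnSn.
Qed.

End RealCharacter.

(** * Primes in arithmetic progressions *)

Section Dirichlet.
Variable R : realType.
Local Open Scope ring_scope.
Variables (N : nat) (N0 : (0 < N)%N).
Implicit Types (n m d p x c u : nat) (f g h : nat -> R).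

Notation mean_zero := (mean_zero N).
Notation class_fun := (@class_fun R N).
Notation Lop := (@Lop R N).

Definition unit_ind n : R := (coprime n N)%:R.
Definition delta c n : R := (n %% N == c %% N)%N%:R.

Lemma class_fun_unit_ind : class_fun unit_ind.
Proof.
split=> n; first by rewrite /unit_ind coprime_modl.
by rewrite /unit_ind => /negPf ->.
Qed.

Lemma class_fun_delta c : coprime c N -> class_fun (delta c).
Proof.
move=> cc; split=> n; first by rewrite /delta modn_mod.
move=> cn; rewrite /delta; case: eqP => // e.
by move: cn; rewrite -coprime_modl e coprime_modl cc.
Qed.

Lemma class_funD f g : class_fun f -> class_fun g -> class_fun (fun n => f n + g n).
Proof.
by move=> [fp fs] [gp gs]; split=> n; rewrite ?fp ?gp // => cn; rewrite fs // gs ?addr0.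
Qed.

Lemma class_funZ (a : R) f : class_fun f -> class_fun (fun n => a * f n).
Proof. by move=> [fp fs]; split=> n; rewrite ?fp // => cn; rewrite fs // mulr0. Qed.

Lemma class_fun_decomp f n : class_fun f -> f n = \sum_(0 <= c < N) f c * delta c n.
Proof.
move=> [fp fs]; rewrite (bigD1_seq (n %% N)%N) ?iota_uniq //=; last first.
  by rewrite mem_index_iota ltn_pmod.
rewrite /delta modn_mod eqxx mulr1 fp big1_seq ?addr0 // => c /andP[cn].
rewrite mem_index_iota => /andP[_ cN]; rewrite (modn_small cN) eq_sym (negPf cn).
by rewrite mulr0.
Qed.

Lemma primesum_decomp f x : class_fun f ->
  primesum f x = \sum_(0 <= c < N) f c * primesum (delta c) x.
Proof.
move=> cf; rewrite (eq_primesum x (fun n => class_fun_decomp n cf)).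
under [RHS]eq_bigr do rewrite -primesumZ.
rewrite /primesum [RHS]exchange_big /=; apply: eq_bigr => p _.
by rewrite mulr_suml.
Qed.

Lemma primesum_one : Bdd (fun x => primesum unit_ind x - ln x%:R : R).
Proof.
pose h p : R := (~~ coprime p N)%:R.
have e x : primesum unit_ind x = primesum (fun=> 1) x - primesum h x.
  rewrite -[X in _ - X]mul1r -mulNr -primesumZ -primesumD; apply: eq_primesum => n.
  by rewrite /unit_ind /h; case: coprime; rewrite /=; ring.
have b1 : Bdd (primesum h).
  exists (\sum_(1 <= p < N.+1) ln p%:R / p%:R) => x _.
  have t0 p : 0 <= ln p%:R / p%:R :> R by rewrite divr_ge0 // ln_nat_ge0.
  have h0 p : 0 <= h p by [].
  rewrite ger0_norm ?primesum_ge0 //.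
  apply: (@le_trans _ _ (primesum h (x + N))).
    rewrite /primesum [X in _ <= X](@big_cat_nat _ _ _ x.+1) //=; last by lia.
    by rewrite lerDl sumr_ge0 // => p _; rewrite mulr_ge0.
  rewrite /primesum (@big_cat_nat _ _ _ N.+1) //=; last by lia.
  rewrite [X in _ + X]big_nat_cond [X in _ + X]big1 ?addr0; last first.
    move=> p /andP[/andP[Np _] pp]; rewrite /h prime_coprime // negbK.
    by case: (boolP (p %| N)%N) => [/(dvdn_leq N0)|_]; rewrite ?mul0r //; lia.
  rewrite big_mkcond; apply: ler_sum => p _; case: ifP => // _.
  by rewrite ler_piMl // /h; case: coprime.
have b2 : Bdd (fun x => primesum (fun=> 1) x + - ln x%:R : R).
  apply: (@primesum_Bdd_mangoldt R _ 1) => [n|]; first by rewrite normr1.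
  exists 6 => x x0; under eq_bigr do rewrite mul1r; exact: mertens_mangoldt.
by apply: Bdd_ext (Bdd_sub b2 b1) => x _; rewrite e; ring.
Qed.

(** The remaining classes contribute only O(1) to any prime sum, so a class function matters only
    through its values on these. *)
Definition heavy c := coprime c N /\ ~ Bdd (primesum (delta c)).

Definition invariant g := forall u n, heavy u -> g (u * n)%N = g n.

Lemma translateA m n f : translate m (translate n f) = translate (n * m) f.
Proof. by apply/funext => k; rewrite /translate mulnA. Qed.

Lemma translate1 f : translate 1 f = f.
Proof. by apply/funext => k; rewrite /translate mul1n. Qed.

Lemma Lop_translate n m f : coprime n N -> Lop (translate n f) m = Lop f (n * m)%N.
Proof. by move=> cn; rewrite /Lop coprimeMl cn /= translateA. Qed.

(** By invariance g takes the value g(1) on every heavy class, so g - g(1) [unit_ind] lives on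
    classes of bounded prime sum. *)
Lemma primesum_invariant g : class_fun g -> invariant g ->
  Bdd (fun x => primesum g x - g 1%N * ln x%:R).
Proof.
move=> cg ig; pose h n := g n + - g 1%N * unit_ind n.
have ch : class_fun h.
  by apply: class_funD => //; apply: class_funZ; exact: class_fun_unit_ind.
have bh : Bdd (primesum h).
  apply: (@Bdd_ext R (fun x => \sum_(0 <= c < N) h c * primesum (delta c) x)).
    by move=> x _; rewrite -primesum_decomp.
  apply: Bdd_sum => c _; have [cc|cc] := boolP (coprime c N); last first.
    by apply: Bdd_ext (Bdd_const 0) => x _; rewrite (ch.2 c cc) mul0r.
  have [b|nb] := pselect (Bdd (primesum (delta c))); first exact: Bdd_scale.
  apply: Bdd_ext (Bdd_const 0) => x _.
  have := ig c 1%N (conj cc nb); rewrite muln1 => e.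
  by rewrite /h /unit_ind cc e mulr1 subrr mul0r.
have := Bdd_add bh (Bdd_scale (g 1%N) primesum_one); apply: Bdd_ext => x _.
by rewrite /h primesumD primesumZ; ring.
Qed.

(** [Lop g] is invariant too, and its prime sum is bounded; so it vanishes at 1 and, after
    translation, everywhere. Then the translate of g by n has prime sum - g(n) ln x as a kernel
    element and + g(n) ln x as an invariant function, whence 2 g(n) = 0. *)
Lemma invariant_mean_zero g : mean_zero g -> invariant g -> forall n, g n = 0.
Proof.
move=> mg ig; have cg := mg.1.
have inv_tr h m : invariant h -> invariant (translate m h).
  by move=> ih u n hu; rewrite /translate mulnCA ih.
have cL := Lop_class_fun mg.
have iL : invariant (Lop g).
  move=> u n [cu hu]; rewrite /Lop coprimeMl cu /=; case: ifP => // _; congr Lval.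
  by apply/funext => k; rewrite /translate -mulnA ig.
have L0 n : Lop g n = 0.
  have [cn|cn] := boolP (coprime n N); last by rewrite cL.2.
  have := primesum_invariant (class_fun_translate cn cL) (inv_tr _ n iL).
  have := primesum_Lop_Bdd N0 (mean_zero_translate N0 cn mg).
  move=> b1 b2; apply: ln_unbounded; apply: Bdd_ext (Bdd_sub b1 b2) => x _.
  have -> : primesum (Lop (translate n g)) x = primesum (translate n (Lop g)) x.
    by apply: eq_primesum => m; rewrite Lop_translate.
  by rewrite /translate muln1; ring.
move=> n; have [cn|cn] := boolP (coprime n N); last by rewrite cg.2.
have mt := mean_zero_translate N0 cn mg.
have b1 : Bdd (fun x => primesum (translate n g) x + translate n g 1 * ln x%:R).
  by apply: (primesum_kernel N0 mt) => m; rewrite Lop_translate.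
have b2 := primesum_invariant (class_fun_translate cn cg) (inv_tr _ n ig).
have : 2 * g n = 0; last by move/eqP; rewrite mulf_eq0 pnatr_eq0 => /eqP.
apply: ln_unbounded; apply: Bdd_ext (Bdd_sub b1 b2) => x _.
by rewrite /translate muln1; ring.
Qed.

Lemma sum_unit_ind : \sum_(0 <= c < N) unit_ind c = (totient N)%:R.
Proof.
rewrite totient_count_coprime natr_sum; apply: eq_bigr => c _.
by rewrite /unit_ind coprime_sym.
Qed.

Definition mean f : R := (\sum_(0 <= c < N) f c) / (totient N)%:R.

Lemma mean_zero_center f : class_fun f -> mean_zero (fun n => f n + - mean f * unit_ind n).
Proof.
move=> cf; split.
  by apply: class_funD => //; apply: class_funZ; exact: class_fun_unit_ind.
rewrite big_split /= -mulr_sumr sum_unit_ind mulNr /mean divfK ?subrr //.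
by rewrite pnatr_eq0 -lt0n totient_gt0.
Qed.

Lemma unit_ind_translate u n : coprime u N -> unit_ind (u * n) = unit_ind n.
Proof. by move=> cu; rewrite /unit_ind coprimeMl cu. Qed.

(** In terms of groups: the heavy classes generate the units modulo N. *)
Lemma invariant_const g : class_fun g -> invariant g ->
  forall n, coprime n N -> g n = g 1%N.
Proof.
move=> cg ig n cn.
have h := invariant_mean_zero (mean_zero_center cg).
have ih : invariant (fun n => g n + - mean g * unit_ind n).
  by move=> u k hu; rewrite ig // unit_ind_translate //; case: hu.
have := h ih n; have := h ih 1%N; rewrite /unit_ind cn coprime1n /= !mulr1.
by move=> h1 h2; apply: (addIr (- mean g)); rewrite h1 h2.
Qed.

Lemma mean_zeroZ (a : R) f : mean_zero f -> mean_zero (fun n => a * f n).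
Proof. by move=> [cf f0]; split; [exact: class_funZ|rewrite -mulr_sumr f0 mulr0]. Qed.

Lemma mean_zeroD f g : mean_zero f -> mean_zero g -> mean_zero (fun n => f n + g n).
Proof.
by move=> [cf f0] [cg g0]; split; [exact: class_funD|rewrite big_split /= f0 g0 addr0].
Qed.

Lemma LopZ (a : R) f m : mean_zero f -> Lop (fun n => a * f n) m = a * Lop f m.
Proof.
move=> mf; have [cm|cm] := boolP (coprime m N); last first.
  by rewrite /Lop (negPf cm) mulr0.
apply: is_Lval_unique (Lop_spec N0 (mean_zeroZ a mf) cm) _.
exact: is_LvalZ (Lop_spec N0 mf cm).
Qed.

Lemma LopD f g m : mean_zero f -> mean_zero g ->
  Lop (fun n => f n + g n) m = Lop f m + Lop g m.
Proof.
move=> mf mg; have [cm|cm] := boolP (coprime m N); last first.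
  by rewrite /Lop (negPf cm) addr0.
apply: is_Lval_unique (Lop_spec N0 (mean_zeroD mf mg) cm) _.
exact: is_LvalD (Lop_spec N0 mf cm) (Lop_spec N0 mg cm).
Qed.

(** By linearity of L-values: the translates of f by all residues m add up to zero, since for a unit
    n the values f(m n) run through a full period. *)
Lemma Lop_mean_zero f : mean_zero f -> mean_zero (Lop f).
Proof.
move=> mf; split; first exact: Lop_class_fun.
have [[fp fs] f0] := mf.
have h : forall s : seq nat, is_Lval (fun n => \sum_(m <- s) translate m f n)
    (\sum_(m <- s) Lop f m).
  elim=> [|m s IH].
    rewrite big_nil (_ : (fun _ => _) = fun=> 0); first exact: is_Lval0.
    by apply/funext => n; rewrite big_nil.
  rewrite big_cons (_ : (fun _ => _) =
    fun n => translate m f n + \sum_(m <- s) translate m f n); last first.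
    by apply/funext => n; rewrite big_cons.
  apply: is_LvalD IH; have [cm|cm] := boolP (coprime m N); first exact: Lop_spec.
  rewrite /Lop (negPf cm) (_ : translate m f = fun=> 0); first exact: is_Lval0.
  by apply/funext => n; rewrite /translate fs // coprimeMl (negPf cm).
apply: is_Lval_unique (h _) _.
rewrite (_ : (fun _ => _) = fun=> 0); first exact: is_Lval0.
apply/funext => n; have [cn|cn] := boolP (coprime n N); last first.
  by rewrite big1 // => m _; rewrite /translate fs // coprimeMl (negPf cn) andbF.
rewrite /translate; under eq_bigr do rewrite mulnC.
by rewrite sum_translate.
Qed.

Section Kernel.
Variable f : nat -> R.
Hypothesis f0 : mean_zero f.
Hypothesis Lf : forall n, Lop f n = 0.
Hypothesis f1 : f 1%N = 1.
Hypothesis f_le : forall n, `|f n| <= 1.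

(* [1 + f n * f (n k)] is nonnegative in k and has a bounded prime sum, so it vanishes on
   the heavy classes. *)
Lemma kernel_heavy n u : `|f n| = 1 -> heavy u -> f (n * u)%N = - f n.
Proof.
move=> fn [cu nb]; have [cf _] := f0.
have cn : coprime n N.
  by apply: contraTT isT => cn; move: fn; rewrite cf.2 // normr0 => /esym/eqP; rewrite oner_eq0.
have ff : f n * f n = 1 by rewrite -expr2 -real_normK ?num_real // fn expr1n.
pose h k := unit_ind k + f n * translate n f k.
have h0 k : 0 <= h k.
  rewrite /h /unit_ind /translate; have [ck|ck] := boolP (coprime k N).
    have : `|f n * f (n * k)%N| <= 1 by rewrite normrM fn mul1r.
    by rewrite ler_norml /= => /andP[]; lra.
  by rewrite [f (n * k)%N]cf.2 ?mulr0 ?addr0 // coprimeMl (negPf ck) andbF.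
have bh : Bdd (primesum h).
  have mt := mean_zero_translate N0 cn f0.
  have b1 : Bdd (fun x => primesum (translate n f) x + translate n f 1 * ln x%:R).
    by apply: (primesum_kernel N0 mt) => m; rewrite Lop_translate.
  apply: Bdd_ext (Bdd_add primesum_one (Bdd_scale (f n) b1)) => x _.
  rewrite primesumD primesumZ {2}/translate muln1 mulrDr mulrA ff; ring.
have ch : class_fun h.
  apply: class_funD; first exact: class_fun_unit_ind.
  by apply: class_funZ; exact: class_fun_translate.
have hu0 : h u = 0.
  apply: contrapT => /eqP hu; apply: nb.
  apply: (@Bdd_le R _ (fun x => (h u)^-1 * primesum h x)); last exact: Bdd_scale.
  move=> x _; have hup : 0 < h u by rewrite lt_neqAle eq_sym hu h0.
  have d0 c k : 0 <= delta c k by [].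
  rewrite !ger0_norm ?mulr_ge0 ?invr_ge0 ?primesum_ge0 //.
  rewrite ler_pdivlMl // -primesumZ; apply: primesum_le => k.
  rewrite /delta; case: eqP => [e|_]; last by rewrite mulr0.
  by rewrite mulr1 -(ch.1 u) -(ch.1 k) e.
move: hu0; rewrite /h /unit_ind cu /translate => e.
have : f n * (1 + f n * f (n * u)%N) = 0 by rewrite e mulr0.
by rewrite mulrDr mulr1 mulrA ff mul1r => /eqP; rewrite addrC addr_eq0 => /eqP.
Qed.

(** By [kernel_heavy] the set where |f| = 1 is stable under heavy classes, so its indicator is
    invariant, hence constant on the units; it contains 1. *)
Lemma kernel_norm n : coprime n N -> `|f n| = 1.
Proof.
move=> cn; have [cf _] := f0.
pose E n : R := (`|f n| == 1)%:R.
have cE : class_fun E.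
  split=> k; first by rewrite /E cf.1.
  by move=> ck; rewrite /E cf.2 // normr0 eq_sym oner_eq0.
have step u k : heavy u -> `|f k| = 1 -> `|f (u * k)%N| = 1.
  by move=> hu fk; rewrite mulnC kernel_heavy // normrN.
have iE : invariant E.
  move=> u k hu; rewrite /E; congr (nat_of_bool _)%:R; apply/eqP/eqP; last exact: step.
  (* Multiplying by u another phi(N) - 1 times leads back to k, since u^phi(N) = 1 modulo N. *)
  move=> h; have : `|f (u ^ (totient N).-1 * (u * k))%N| = 1.
    elim: (totient N).-1 => [|j IH]; first by rewrite expn0 mul1n.
    by rewrite expnS -mulnA; apply: step.
  rewrite mulnA -expnSr prednK ?totient_gt0 // -cf.1 -modnMml.
  by rewrite Euler_exp_totient ?modnMml ?mul1n ?cf.1 //; case: hu.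
have := invariant_const cE iE cn; rewrite /E f1 normr1 eqxx.
by case: eqP => // _ /eqP; rewrite eq_sym oner_eq0.
Qed.

(** A heavy class changes the sign of both f(m k) and f(k), so k -> f(m k) f(k) is invariant and
    equals f(m) on the units. As f(k)^2 = 1 there, f is multiplicative: a real character with L(1,
    f) = 0. *)
Lemma kernel_absurd : False.
Proof.
have [cf _] := f0.
have sq n : coprime n N -> f n * f n = 1.
  by move=> cn; rewrite -expr2 -real_normK ?num_real // kernel_norm // expr1n.
have fM m n : f (m * n)%N = f m * f n.
  have [cm|cm] := boolP (coprime m N); last first.
    by rewrite [f m]cf.2 // mul0r cf.2 // coprimeMl (negPf cm).
  have [cn|cn] := boolP (coprime n N); last first.
    by rewrite [f n]cf.2 // mulr0 cf.2 // coprimeMl (negPf cn) andbF.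
  pose g k := f (m * k)%N * f k.
  have cg : class_fun g.
    split=> k; first by rewrite /g -cf.1 modnMmr !cf.1.
    by move=> ck; rewrite /g [f k]cf.2 // mulr0.
  have ig : invariant g.
    move=> u k hu; rewrite /g; have [ck|ck] := boolP (coprime k N); last first.
      by rewrite [f k]cf.2 // [f (u * k)%N]cf.2 ?mulr0 // coprimeMl (negPf ck) andbF.
    have -> : f (m * (u * k))%N = - f (m * k)%N.
      by rewrite mulnCA mulnC kernel_heavy // kernel_norm // coprimeMl cm.
    have -> : f (u * k)%N = - f k by rewrite mulnC kernel_heavy // kernel_norm.
    by rewrite mulrNN.
  have := invariant_const cg ig cn; rewrite /g muln1 f1 mulr1 => <-.
  by rewrite -mulrA sq // mulr1.
have freal n : f n = 0 \/ f n = 1 \/ f n = -1.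
  have [cn|cn] := boolP (coprime n N); last by left; rewrite cf.2.
  right; have := kernel_norm cn.
  by case: (ger0P (f n)) => _ <-; [left|right; rewrite opprK].
have := Lval_real_character_neq0 N0 f0 f1 fM freal.
have := Lf 1; rewrite /Lop coprime1n translate1 => ->.
by rewrite eqxx.
Qed.

End Kernel.

Lemma Lop_injective f : mean_zero f -> (forall n, Lop f n = 0) -> forall n, f n = 0.
Proof.
move=> mf Lf n; have [cf _] := mf.
pose i0 : 'I_N := Ordinal N0.
have [m _ hm] := @arg_maxP _ _ _ i0 xpredT (fun i : 'I_N => `|f i|) isT.
have max k : `|f k| <= `|f m|.
  by rewrite -cf.1; apply: (hm (Ordinal (ltn_pmod k N0))).
have [fm0|fm] := eqVneq (f m) 0.
  by apply/eqP; rewrite -normr_le0 (le_trans (max n)) // fm0 normr0.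
have cm : coprime m N by apply: contraNT fm => /cf.2 ->.
exfalso; apply: (@kernel_absurd (fun k => (f m)^-1 * translate m f k)).
- exact/mean_zeroZ/mean_zero_translate.
- by move=> k; rewrite LopZ ?Lop_translate ?Lf ?mulr0 //; apply: mean_zero_translate.
- by rewrite /translate muln1 mulVf.
by move=> k; rewrite normrM normfV ler_pdivrMl ?normr_gt0 // mulr1; apply: max.
Qed.

Definition row_fun (v : 'rV[R]_N) n : R := v 0 (Ordinal (ltn_pmod n N0)).

Definition cut f n : R := unit_ind n * f n.

Definition proj f n : R := cut f n + - mean (cut f) * unit_ind n.

Lemma row_funP v n : row_fun v (n %% N) = row_fun v n.
Proof. by rewrite /row_fun; congr (v _ _); apply: val_inj; rewrite /= modn_mod. Qed.

Lemma cut_class_fun v : class_fun (cut (row_fun v)).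
Proof.
split=> n; first by rewrite /cut row_funP class_fun_unit_ind.1.
by move=> cn; rewrite /cut class_fun_unit_ind.2 // mul0r.
Qed.

Lemma proj_mean_zero v : mean_zero (proj (row_fun v)).
Proof. exact: mean_zero_center (cut_class_fun v). Qed.

Lemma row_funD (a : R) v w n : row_fun (a *: v + w) n = a * row_fun v n + row_fun w n.
Proof. by rewrite /row_fun !mxE. Qed.

Lemma projD (a : R) v w n : proj (row_fun (a *: v + w)) n = a * proj (row_fun v) n + proj (row_fun w) n.
Proof.
rewrite /proj /cut row_funD; have -> : mean (fun n => unit_ind n * row_fun (a *: v + w) n) =
   a * mean (fun n => unit_ind n * row_fun v n) + mean (fun n => unit_ind n * row_fun w n).
  rewrite /mean mulrA -mulrDl; congr (_ / _); rewrite mulr_sumr -big_split.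
  by apply: eq_bigr => c _ /=; rewrite row_funD; ring.
by ring.
Qed.

(* [Lop] extended to all functions modulo N by the identity on a complement of the
   functions of zero mean, so that matrix algebra applies. *)
Definition Lop_row (v : 'rV[R]_N) : 'rV[R]_N := \row_i (Lop (proj (row_fun v)) i + row_fun v i - proj (row_fun v) i).

Lemma Lop_row_linear : linear Lop_row.
Proof.
move=> a v w; apply/rowP => i; rewrite !mxE projD row_funD.
have -> : Lop (proj (row_fun (a *: v + w))) i = a * Lop (proj (row_fun v)) i + Lop (proj (row_fun w)) i.
  rewrite -(LopZ a i (proj_mean_zero v)).
  rewrite -(LopD i (mean_zeroZ a (proj_mean_zero v)) (proj_mean_zero w)).
  by congr (Lop _ _); apply/funext => n; rewrite projD.
by ring.
Qed.

HB.instance Definition _ := GRing.isLinear.Build R 'rV[R]_N 'rV[R]_N _ Lop_row Lop_row_linear.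

Lemma Lop_surjective f : mean_zero f -> exists g, mean_zero g /\ forall n, Lop g n = f n.
Proof.
move=> mf; pose v : 'rV[R]_N := \row_i f i.
have fv n : row_fun v n = f n by rewrite /row_fun mxE /= mf.1.1.
(* If the extended operator sends [w] to a function of zero mean, then the complementary part [r] of
   [w] has zero mean as well; being constant on the units, it vanishes. *)
have key w t : mean_zero t -> (forall n, row_fun (Lop_row w) n = t n) ->
    forall n, Lop (proj (row_fun w)) n = t n.
  move=> mu e n; have mw := proj_mean_zero w.
  pose r k := row_fun w k - proj (row_fun w) k.
  have e2 k : t k = Lop (proj (row_fun w)) k + r k.
    rewrite -e /row_fun mxE /= -addrA /r; congr (_ + (_ - _)).
    + by rewrite (Lop_class_fun mw).1.
    + by rewrite row_funP.
    by rewrite mw.1.1.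
  have mr : mean_zero r.
    have -> : r = fun k => t k + -1 * Lop (proj (row_fun w)) k.
      by apply/funext => k; rewrite e2; ring.
    by apply: mean_zeroD => //; apply: mean_zeroZ; exact: Lop_mean_zero.
  rewrite e2; suff -> : r n = 0 by rewrite addr0.
  have [cn|cn] := boolP (coprime n N); last by rewrite mr.1.2.
  have rE k : coprime k N -> r k = mean (cut (row_fun w)).
    by move=> ck; rewrite /r /proj /cut /unit_ind ck /=; ring.
  have : \sum_(0 <= c < N) r c = mean (cut (row_fun w)) * (totient N)%:R.
    rewrite -sum_unit_ind mulr_sumr; apply: eq_bigr => c _.
    have [cc|cc] := boolP (coprime c N); first by rewrite rE // /unit_ind cc mulr1.
    by rewrite mr.1.2 // /unit_ind (negPf cc) mulr0.
  rewrite mr.2 rE // => /esym/eqP; rewrite mulf_eq0 pnatr_eq0 => /orP[/eqP//|].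
  by rewrite eqn0Ngt totient_gt0 N0.
have inj (w : 'rV[R]_N) : w *m lin1_mx Lop_row = 0 -> w = 0.
  rewrite (mul_rV_lin1 Lop_row) => e.
  have m0 : mean_zero (fun=> 0 : R).
    by split; [split|rewrite big1].
  have p0 : forall n, proj (row_fun w) n = 0.
    apply: (Lop_injective (proj_mean_zero w)); apply: (key w (fun=> 0)) => // n.
    by rewrite /row_fun e mxE.
  apply/rowP => i; rewrite mxE; have := congr1 (fun z : 'rV_N => z 0 i) e.
  rewrite !mxE p0 subr0 (_ : proj (row_fun w) = fun=> 0); last exact/funext.
  have -> : Lop (fun=> 0) i = 0.
    by have := LopZ 0 i m0; rewrite /= !mul0r.
  rewrite add0r => <-; rewrite /row_fun; congr (w _ _); apply: val_inj.
  by rewrite /= modn_small.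
have u : lin1_mx Lop_row \in unitmx by rewrite -row_free_unit; apply: inj_row_free.
pose w := v *m invmx (lin1_mx Lop_row).
have wv : Lop_row w = v by rewrite -(mul_rV_lin1 Lop_row) mulmxKV.
exists (proj (row_fun w)); split; first exact: proj_mean_zero.
apply: key => // n.
by rewrite wv.
Qed.

(** The indicator of the class minus its mean 1/phi(N) on the units is some [Lop g], with bounded
    prime sum; only the mean contributes to ln x. *)
Theorem dirichlet_mertens a : coprime a N ->
  Bdd (fun x => primesum (delta a) x - (totient N)%:R^-1 * ln x%:R : R).
Proof.
move=> ca; have cd := class_fun_delta ca.
have [g [mg hg]] := Lop_surjective (mean_zero_center cd).
have m1 : mean (delta a) = (totient N)%:R^-1.
  rewrite /mean (_ : \sum_(0 <= c < N) delta a c = 1) ?div1r //.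
  rewrite (bigD1_seq (a %% N)%N) ?iota_uniq //=; last by rewrite mem_index_iota ltn_pmod.
  rewrite /delta modn_mod eqxx big1_seq ?addr0 // => c /andP[ca'].
  by rewrite mem_index_iota => /andP[_ cN]; rewrite (modn_small cN) (negPf ca').
have b := primesum_Lop_Bdd N0 mg.
apply: Bdd_ext (Bdd_add b (Bdd_scale (totient N)%:R^-1 primesum_one)) => x _.
by rewrite (eq_primesum _ hg) primesumD primesumZ m1; ring.
Qed.

End Dirichlet.

(** * A weak Brun-Titchmarsh inequality *)

Section ProgressionFactorial.
Implicit Types (n m d p k J b : nat).

Lemma dvdn_prime_powers m n : 0 < m ->
  (forall p k, prime p -> p ^ k %| m -> p ^ k %| n) -> m %| n.
Proof.
elim/ltn_ind: m n => m IH n m0 h; have [->//|m1] := eqVneq m 1.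
have [|p [k [m' [pp k0 pm /andP[m'0 m'm] mE]]]] := @prime_power_split m; first by lia.
rewrite mE Gauss_dvd; last by rewrite coprimeXl // prime_coprime.
rewrite h //=; last by rewrite mE dvdn_mulr.
by apply: IH => // q j qp qm; apply: h => //; rewrite mE dvdn_mull.
Qed.

Lemma logn_fact_le p J : prime p -> logn p J`! <= J.
Proof.
move=> pp; rewrite logn_fact //.
have h : forall K n, \sum_(1 <= k < K.+1) n %/ p ^ k <= n.
  elim=> [|K IH] n; first by rewrite big_geq.
  rewrite big_ltn // big_add1 /= expn1.
  under eq_bigr do rewrite expnS divnMA.
  have := IH (n %/ p).
  have := leq_divM n 2; have := leq_div2l n (isT : 0 < 2) (prime_gt1 pp).
  by lia.
exact: h.
Qed.

Lemma fact_dvd_consecutive c J : J`! %| \prod_(j < J) (c + j).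
Proof.
case: J => [|J]; first by rewrite fact0 dvd1n.
suff -> : \prod_(j < J.+1) (c + j) = (c + J) ^_ J.+1 by rewrite -bin_ffact dvdn_mull.
rewrite ffact_prod (reindex_inj rev_ord_inj); apply: eq_bigr => j _ /=.
by have := ltn_ord j; lia.
Qed.

Lemma prod_modn (I : Type) (r : seq I) (F G : I -> nat) m :
  (forall i, F i = G i %[mod m]) -> \prod_(i <- r) F i = \prod_(i <- r) G i %[mod m].
Proof.
move=> e; elim: r => [|i r IH]; first by rewrite !big_nil.
by rewrite !big_cons -modnMm e IH modnMm.
Qed.

(** Checked one prime p at a time. If p | d, the factor d^J suffices since [logn p J]! is at most J.
    Otherwise multiplication by an inverse of d modulo p^k turns the progression into J consecutive
    integers. *)
Lemma fact_dvd_progression b d J : 0 < d -> J`! %| d ^ J * \prod_(j < J) (b + d * j).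
Proof.
move=> d0; apply: dvdn_prime_powers => [|p k pp pk]; first exact: fact_gt0.
have [pd|pd] := boolP (p %| d).
  apply: dvdn_mulr; apply: dvdn_trans (dvdn_exp2r J pd); apply: dvdn_exp2l.
  apply: leq_trans (logn_fact_le J pp); by rewrite -pfactor_dvdn ?fact_gt0.
apply: dvdn_mull; have pk0 : 0 < p ^ k by rewrite expn_gt0 prime_gt0.
have cop : coprime d (p ^ k) by rewrite coprimeXr // coprime_sym prime_coprime.
have [e [ce he]] := unit_inverse pk0 cop.
have cop2 : coprime (p ^ k) (e ^ J) by rewrite coprimeXr // coprime_sym.
rewrite -(Gauss_dvdr _ cop2) /dvdn.
have -> : e ^ J * \prod_(j < J) (b + d * j) = \prod_(j < J) (e * (b + d * j)).
  by rewrite big_split /= prod_nat_const card_ord.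
rewrite (@prod_modn _ _ _ (fun j : 'I_J => e * b + j)).
  exact: dvdn_trans pk (fact_dvd_consecutive _ _).
by move=> j; rewrite mulnDr -modnDmr he modnDmr.
Qed.

Lemma coprime_fact q J : prime q -> J < q -> coprime q J`!.
Proof.
move=> qp; elim: J => [|J IH] Jq; first by rewrite fact0 coprimen1.
rewrite factS coprimeMr IH ?(ltnW Jq) // andbT prime_coprime //.
by apply/negP => /dvdn_leq; lia.
Qed.

(** Primes above J are coprime to J!, so they survive its removal. This bounds the product of the
    primes by d^J times the product of the progression divided by J!. *)
Lemma primes_progression_dvd b d J : 0 < d ->
  (\prod_(j < J | prime (b + d * j) && (J < b + d * j)) (b + d * j)) * J`! %|
  d ^ J * \prod_(j < J) (b + d * j).
Proof.
move=> d0; rewrite Gauss_dvd; last first.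
  elim/big_rec: _ => [|j x /andP[pj jJ] IH]; first by rewrite coprime1n.
  by rewrite coprimeMl IH andbT coprime_fact.
rewrite fact_dvd_progression // andbT dvdn_mull //.
by rewrite [X in _ %| X](bigID (fun j : 'I_J => prime (b + d * j) && (J < b + d * j))) dvdn_mulr.
Qed.

End ProgressionFactorial.

Section BrunTitchmarsh.
Variable R : realType.
Local Open Scope ring_scope.
Implicit Types (n m d p k J b : nat).

Lemma ln_prod_nat (I : Type) (r : seq I) (P : pred I) (F : I -> nat) :
  (forall i, P i -> (0 < F i)%N) ->
  ln (\prod_(i <- r | P i) F i)%:R = \sum_(i <- r | P i) ln (F i)%:R :> R.
Proof.
move=> F0; have : (0 < \prod_(i <- r | P i) F i)%N /\
  ln (\prod_(i <- r | P i) F i)%:R = \sum_(i <- r | P i) ln (F i)%:R :> R; last by case.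
elim: r => [|i r [h1 h2]]; first by rewrite !big_nil ln1.
rewrite !big_cons; case: ifP => // Pi; rewrite muln_gt0 F0 // h1; split=> //.
by rewrite natrM lnM ?posrE ?ltr0n ?F0 // h2.
Qed.

(** After taking logarithms, the J ln J from the terms b + d j <= d J cancels against ln J!; the
    remaining 2 ln d is the loss of the method. *)
Lemma sum_ln_primes_progression b d J : (0 < b <= d)%N -> (0 < J)%N ->
  \sum_(j < J | prime (b + d * j) && (J < b + d * j)%N) ln (b + d * j)%:R <=
  J%:R * (2 * ln d%:R + 1) :> R.
Proof.
move=> /andP[b0 bd] J0; have d0 : (0 < d)%N by lia.
have pos (j : 'I_J) : (0 < b + d * j)%N by lia.
have := primes_progression_dvd b J d0.
move=> /dvdn_leq h; have {h} := h _; rewrite muln_gt0 expn_gt0 d0 prodn_gt0 // => /(_ isT) h.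
have h2 : (d ^ J * \prod_(j < J) (b + d * j) <= d ^ J * (d * J) ^ J)%N.
  rewrite leq_mul2l; apply/orP; right.
  apply: (@leq_trans (\prod_(j < J) (d * J))%N).
    apply: leq_prod => j _; apply: (@leq_trans (d + d * j)%N); first by rewrite leq_add2r.
    by rewrite -mulnS leq_mul2l ltn_ord orbT.
  by rewrite prod_nat_const card_ord.
have pp : (0 < \prod_(j < J | prime (b + d * j) && (J < b + d * j)) (b + d * j))%N.
  by rewrite prodn_gt0.
have h3 := leq_trans h h2; set P := (\prod_(j < J | _) _)%N in pp h3 h.
have := @ler_ln_nat R _ _ (introT andP (conj _ h3)).
rewrite muln_gt0 pp fact_gt0 => /(_ isT).
have -> : ln (P * J`!)%:R = ln P%:R + ln J`!%:R :> R.
  by rewrite natrM lnM ?posrE ?ltr0n ?fact_gt0.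
have dR : 0 < d%:R :> R by rewrite ltr0n.
have JR : 0 < J%:R :> R by rewrite ltr0n.
have -> : ln (d ^ J * (d * J) ^ J)%:R =
    J%:R * ln d%:R + J%:R * (ln d%:R + ln J%:R) :> R.
  rewrite natrM !natrX natrM lnM ?posrE ?exprn_gt0 ?mulr_gt0 //.
  by rewrite !lnXn ?mulr_gt0 // lnM // !mulr_natl.
have -> : ln J`!%:R = \sum_(1 <= n < J.+1) ln n%:R :> R.
  rewrite fact_prod big_nat ln_prod_nat; first by rewrite -big_nat.
  by move=> i /andP[].
have -> : ln P%:R = \sum_(j < J | prime (b + d * j) && (J < b + d * j)%N) ln (b + d * j)%:R :> R.
  by rewrite ln_prod_nat.
have := lnfact_ge R J; lra.
Qed.

Lemma sum_primes_dyadic b d I : (0 < b <= d)%N -> (3 <= d)%N ->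
  \sum_(1 <= j < 2 ^ I | prime (b + d * j)) ln (b + d * j)%:R / (b + d * j)%:R <=
  I%:R * (2 * (2 * ln d%:R + 1) / d%:R) :> R.
Proof.
move=> bd d3; have d0 : (0 < d)%N by lia.
have dR : 0 < d%:R :> R by rewrite ltr0n.
elim: I => [|I IH]; first by rewrite expn0 big_geq // mul0r.
rewrite (@big_cat_nat _ _ _ (2 ^ I)%N) ?expn_gt0 ?leq_exp2l //=.
rewrite -[I.+1]addn1 natrD mulrDl mul1r; apply: lerD => //.
rewrite addn1; have J0 : (0 < 2 ^ I.+1)%N by rewrite expn_gt0.
have := sum_ln_primes_progression bd J0; set S := \sum_(_ < _ | _) _ => hS.
have c0 : 0 < d%:R * (2 ^ I)%:R :> R by rewrite mulr_gt0 // ltr0n expn_gt0.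
apply: (@le_trans _ _ (S / (d%:R * (2 ^ I)%:R))); last first.
  rewrite ler_pdivrMr //; apply: le_trans hS _; rewrite expnS natrM.
  rewrite le_eqVlt; apply/orP; left; apply/eqP; field.
  by rewrite gt_eqF.
have -> : S = \sum_(0 <= j < 2 ^ I.+1 | prime (b + d * j) && (2 ^ I.+1 < b + d * j)%N)
   ln (b + d * j)%:R by rewrite big_mkord.
have ge0 j : 0 <= ln (b + d * j)%:R / (d%:R * (2 ^ I)%:R) :> R.
  by rewrite divr_ge0 ?ln_nat_ge0 // ltW.
rewrite mulr_suml [X in _ <= X](@big_cat_nat _ _ _ (2 ^ I)%N) ?leq_exp2l //=.
rewrite -[X in X <= _]add0r; apply: lerD; first by rewrite sumr_ge0.
rewrite [X in X <= _]big_nat_cond [X in _ <= X]big_nat_cond.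
rewrite [X in X <= _]big_mkcond [X in _ <= X]big_mkcond; apply: ler_sum => j _.
case: ifP => [/andP[/andP[j1 j2] pj]|_]; last by case: ifP.
(* Here d >= 3 enters: for j >= 2^I, b + d j exceeds 2^(I+1), so every prime of the block passes the
   size condition. *)
rewrite j1 j2 pj /= ifT; last first.
  rewrite expnS; have : (3 * 2 ^ I <= d * j)%N by apply: leq_mul.
  have : (0 < 2 ^ I)%N by rewrite expn_gt0.
  by lia.
rewrite ler_wpM2l ?ln_nat_ge0 // lef_pV2 ?posrE // ?ltr0n; last by lia.
by rewrite -natrM ler_nat (leq_trans (leq_mul (leqnn d) j1)) // leq_addl.
Qed.

Lemma sum_residue_class (F : nat -> R) b d K : (b < d)%N ->
  \sum_(0 <= n < d * K | (n %% d == b)%N) F n = \sum_(0 <= j < K) F (b + d * j)%N.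
Proof.
move=> bd; elim: K => [|K IH]; first by rewrite muln0 !big_geq.
rewrite big_nat_recr //= mulnS addnC (@big_cat_nat _ _ _ (d * K)%N) ?leq_addr //= IH.
congr (_ + _); rewrite -[X in index_iota X _]add0n big_addn addKn big_mkord.
rewrite (big_pred1 (Ordinal bd)) //= => i.
by rewrite addnC mulnC modnMDl modn_small.
Qed.

End BrunTitchmarsh.

(** * Averaging the large prime factors of p + 1 over a residue class *)

Section Averaging.
Variable R : realType.
Local Open Scope ring_scope.
Implicit Types (n m d p q k b : nat).

Lemma sum_primes_class b d x I : (0 < b < d)%N -> (3 <= d)%N -> (x < 2 ^ I)%N ->
  \sum_(1 <= p < x.+1 | prime p && (p %% d == b)%N) ln p%:R / p%:R <=
  ln b%:R / b%:R + I%:R * (2 * (2 * ln d%:R + 1) / d%:R) :> R.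
Proof.
move=> /andP[b0 bd] d3 xI; pose G n : R := if prime n then ln n%:R / n%:R else 0.
have t0 n : 0 <= ln n%:R / n%:R :> R by rewrite divr_ge0 ?ln_nat_ge0.
have G0 n : 0 <= G n by rewrite /G; case: ifP.
apply: (@le_trans _ _ (\sum_(0 <= n < d * 2 ^ I | (n %% d == b)%N) G n)).
  have dI : (0 < d * 2 ^ I)%N by rewrite muln_gt0 expn_gt0; lia.
  have xd : (x.+1 <= d * 2 ^ I)%N by apply: leq_trans xI _; rewrite leq_pmull //; lia.
  rewrite (@big_cat_nat _ _ _ 1 0 (d * 2 ^ I)) //=.
  rewrite (@big_cat_nat _ _ _ x.+1 1 (d * 2 ^ I)) //=.
  rewrite -[X in X <= _]add0r -[X in X <= _]addr0 -addrA; apply: lerD; first exact: sumr_ge0.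
  apply: lerD; last exact: sumr_ge0.
  rewrite big_mkcond [X in _ <= X]big_mkcond; apply: ler_sum => p _.
  by rewrite /G; case: (prime p); case: eqP.
(* The index j = 0 lies in no dyadic block; it gives the separate term of b, which carries no factor
   1/d. *)
rewrite sum_residue_class // big_ltn ?expn_gt0 // muln0 addn0; apply: lerD.
  by rewrite /G; case: ifP.
apply: le_trans (sum_primes_dyadic R I (b := b) (d := d) _ d3); last by lia.
by rewrite [X in _ <= X]big_mkcond.
Qed.

Lemma sum_inv_sq Z k : (0 < Z)%N -> \sum_(Z.+1 <= n < k) (n%:R ^+ 2)^-1 <= Z%:R^-1 :> R.
Proof.
move=> Z0; have [kZ|Zk] := leqP k Z.+1; first by rewrite big_geq // invr_ge0.
apply: (@le_trans _ _ (\sum_(Z.+1 <= n < k) (n.-1%:R^-1 - n%:R^-1))).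
  apply: ler_sum_nat => n /andP[Zn _]; case: n Zn => // n; rewrite ltnS => Zn /=.
  have n0 : 0 < n%:R :> R by rewrite ltr0n; lia.
  have n1 : 0 < n.+1%:R :> R by rewrite ltr0n.
  have -> : n%:R^-1 - n.+1%:R^-1 = (n%:R * n.+1%:R)^-1 :> R.
    by rewrite -natr1; field; rewrite natr1 !gt_eqF.
  by rewrite lef_pV2 ?posrE ?exprn_gt0 ?mulr_gt0 // expr2 ler_pM2r // ler_nat.
rewrite big_add1 /=; have h := @telescope_sumr R Z k.-1 (fun n => - n%:R^-1).
under eq_bigr do rewrite -[X in X - _]opprK addrC.
rewrite h; last by lia.
have : 0 <= k.-1%:R^-1 :> R by rewrite invr_ge0.
lra.
Qed.

Definition pow32 n : R := (n%:R * rt R n)^-1.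

Lemma pow32_ge0 n : 0 <= pow32 n.
Proof. by rewrite invr_ge0 mulr_ge0 ?sqrtr_ge0. Qed.

Lemma sum_pow32_le Z k : (0 < Z)%N -> \sum_(Z.+1 <= n < k) pow32 n <= 2.
Proof.
move=> Z0; have [kZ|Zk] := leqP k Z.+1; first by rewrite big_geq.
apply: le_trans (sum_pow32 R k); rewrite [X in _ <= X](@big_cat_nat _ _ _ Z.+1) //=; last by lia.
by rewrite lerDr sumr_ge0 // => n _; apply: pow32_ge0.
Qed.

(** Meant for the least element b of a class on which q | b + 1, so that b >= q - 1. It makes the
    isolated first terms summable over q. *)
Lemma ln_div_le_pow32 b q : (2 <= q)%N -> (q.-1 <= b)%N ->
  q%:R^-1 * (ln b%:R / b%:R) <= 4 * pow32 q.
Proof.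
move=> q2 qb; have b0 : (0 < b)%N by lia.
have rb := rt_gt0 R b0; have rq : 0 < rt R q by rewrite rt_gt0 //; lia.
have q0 : 0 < q%:R :> R by rewrite ltr0n; lia.
have b0R : 0 < b%:R :> R by rewrite ltr0n.
rewrite /pow32 invfM [X in _ <= X]mulrCA ler_wpM2l ?invr_ge0 ?(ltW q0) // ler_pdivrMr //.
apply: le_trans (ln_le_rt R b) _; rewrite mulrAC ler_pdivlMr // -(rt_sq R b).
have h : rt R q <= 2 * rt R b.
  have hq : rt R q * rt R q <= 4 * (rt R b * rt R b).
    by rewrite !rt_sq -natrM ler_nat; lia.
  by rewrite leNgt; apply/negP; nra.
by nra.
Qed.

Definition far_mass Z p : R := \sum_(Z.+1 <= q < p.+2 | prime q && (q %| p.+1)%N) q%:R^-1.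

Section Class.
Variables (M a Z : nat).
Hypothesis M2 : (2 <= M)%N.
Hypothesis ca : coprime a M.
Hypothesis Z0 : (0 < Z)%N.
Hypothesis hZ : forall q, prime q -> (Z < q)%N -> coprime q M.

(** The conditions p = a modulo M and p = -1 modulo q merge into one class b modulo M q, to which
    the sieve bound applies; ln(M q) is then split into ln M + ln q. *)
Lemma class_mass q x I : prime q -> (Z < q)%N -> (x < 2 ^ I)%N ->
  q%:R^-1 * \sum_(1 <= p < x.+1 | prime p && (p %% M == a %% M)%N && (q %| p.+1)%N) ln p%:R / p%:R <=
  4 * pow32 q + I%:R * (2 / M%:R) * ((2 * ln M%:R + 1) * (q%:R ^+ 2)^-1 + 4 * pow32 q).
Proof.
move=> qp Zq xI; have q1 := prime_gt1 qp; have q0 : 0 < q%:R :> R by rewrite ltr0n prime_gt0.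
have M0 : 0 < M%:R :> R by rewrite ltr0n; lia.
have cMq : coprime M q by rewrite coprime_sym hZ.
set b := (chinese M q a q.-1 %% (M * q))%N.
have Mq0 : (0 < M * q)%N by rewrite muln_gt0; lia.
have bM : (b = a %[mod M])%N by rewrite /b modn_dvdm ?dvdn_mulr // chinese_modl.
have bq : (b = q.-1 %[mod q])%N by rewrite /b modn_dvdm ?dvdn_mull // chinese_modr.
have qb : (q.-1 <= b)%N.
  by have := leq_mod b q; rewrite bq modn_small //; lia.
have bd : (0 < b < M * q)%N by rewrite ltn_mod Mq0 andbT; lia.
have d3 : (3 <= M * q)%N by nia.
have h := sum_primes_class bd d3 xI.
apply: (@le_trans _ _ (q%:R^-1 * (ln b%:R / b%:R +
    I%:R * (2 * (2 * ln (M * q)%:R + 1) / (M * q)%:R)))).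
  rewrite ler_wpM2l ?invr_ge0 ?(ltW q0) //; apply: le_trans h.
  have t0 n : 0 <= ln n%:R / n%:R :> R by rewrite divr_ge0 ?ln_nat_ge0.
  rewrite big_mkcond [X in _ <= X]big_mkcond; apply: ler_sum => p _.
  case: ifP => [/andP[/andP[pp pM] qp1]|_]; last by case: ifP.
  have pb : (p %% (M * q) = b %% (M * q))%N.
    apply/eqP; rewrite chinese_remainder // (eqP pM) bM eqxx /= bq.
    by rewrite -(eqn_modDr 1) !addn1 prednK ?prime_gt0 // modnn; exact: qp1.
  by rewrite pp pb /= modn_small ?eqxx //; case/andP: bd.
rewrite mulrDr; apply: lerD; first exact: ln_div_le_pow32.
have lMq : ln (M * q)%:R = ln M%:R + ln q%:R :> R by rewrite natrM lnM.
rewrite lMq natrM.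
have lq := @ln_div_sq R q (ltnW q1); rewrite -/(pow32 q) in lq.
have -> : q%:R^-1 * (I%:R * (2 * (2 * (ln M%:R + ln q%:R) + 1) / (M%:R * q%:R))) =
  I%:R * (2 / M%:R) * ((2 * ln M%:R + 1) * (q%:R ^+ 2)^-1 + 2 * (ln q%:R / q%:R ^+ 2)) :> R.
  by field; rewrite !gt_eqF.
rewrite ler_wpM2l ?mulr_ge0 ?invr_ge0 ?(ltW M0) // lerD2l; lra.
Qed.

(** If [far_mass] exceeded delta0 throughout the class, its weighted sum would be at least delta0 ln
    x / phi(M) + O(1), while exchanging the sums over p and q bounds it by 92 ln x / M + O(1).
    Comparing coefficients of ln x contradicts the last hypothesis. *)
Lemma exists_prime_few_large_factors (delta0 : R) : 0 < delta0 ->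
  ln M%:R <= 7 * Z%:R :> R -> 92 * (totient M)%:R < delta0 * M%:R ->
  exists p, [/\ prime p, (p %% M = a %% M)%N & far_mass Z p <= delta0].
Proof.
move=> d0 lM hd; apply: contrapT => no.
have far p : prime p -> (p %% M == a %% M)%N -> delta0 <= far_mass Z p.
  move=> pp /eqP pa; rewrite leNgt; apply/negP => lt; apply: no; exists p; split => //.
  exact: ltW.
have M0 : (0 < M)%N by lia.
have MR : 0 < M%:R :> R by rewrite ltr0n.
have ZR : 0 < Z%:R :> R by rewrite ltr0n.
have [C hC] := @dirichlet_mertens R M M0 a ca.
set phi : R := (totient M)%:R in hC hd.
have phi0 : 0 < phi by rewrite ltr0n totient_gt0.
have t0 n : 0 <= ln n%:R / n%:R :> R by rewrite divr_ge0 ?ln_nat_ge0.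
(* Here 8 = 4 * 2 comes from the first terms of the classes, and 46 = 2 * (15 + 8): 15 bounds (2 ln
   M + 1)/Z by ln M <= 7 Z, and 8 is again 4 times a sum of q^(-3/2). *)
have up x I : (x < 2 ^ I)%N ->
    delta0 * primesum (delta R M a) x <= 8 + I%:R * (46 / M%:R).
  move=> xI.
  apply: (@le_trans _ _ (\sum_(1 <= p < x.+1 | prime p && (p %% M == a %% M)%N)
     far_mass Z p * (ln p%:R / p%:R))).
    rewrite /primesum mulr_sumr [X in X <= _]big_mkcond [X in _ <= X]big_mkcond.
    apply: ler_sum => p _; rewrite /delta; case: (boolP (prime p)) => //= pp.
    case: eqP => /= pa; last by rewrite mul0r mulr0.
    by rewrite mul1r ler_wpM2r // far //; apply/eqP.
  apply: (@le_trans _ _ (\sum_(1 <= p < x.+1 | prime p && (p %% M == a %% M)%N)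
     \sum_(Z.+1 <= q < x.+2 | prime q) (if (q %| p.+1)%N then q%:R^-1 * (ln p%:R / p%:R) else 0))).
    rewrite big_nat_cond [X in _ <= X]big_nat_cond; apply: ler_sum => p /andP[/andP[p1 px] _].
    rewrite /far_mass mulr_suml -big_mkcondr /=.
    have [Zp|Zp] := leqP Z.+1 p.+2.
      rewrite [X in _ <= X](@big_cat_nat _ _ _ p.+2) //=.
      rewrite lerDl sumr_ge0 // => q _; rewrite mulr_ge0 // invr_ge0 //.
    by rewrite big_geq ?(ltnW Zp) // sumr_ge0 // => q _; rewrite mulr_ge0 // invr_ge0.
  rewrite exchange_big /=.
  apply: (@le_trans _ _ (\sum_(Z.+1 <= q < x.+2) (4 * pow32 q + I%:R * (2 / M%:R) *
     ((2 * ln M%:R + 1) * (q%:R ^+ 2)^-1 + 4 * pow32 q)))).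
    rewrite big_nat_cond [X in _ <= X]big_nat_cond.
    rewrite [X in X <= _]big_mkcond [X in _ <= X]big_mkcond.
    apply: ler_sum => q _; rewrite andbT; case: (Z.+1 <= q < x.+2)%N / andP => [[Zq _]|_] //=.
    case: ifP => qp.
      apply: le_trans (class_mass qp Zq xI); rewrite mulr_sumr -big_mkcondr /=.
      by rewrite le_eqVlt eqxx.
    have c0 := pow32_ge0 q; have l0 := @ln_nat_ge0 R M.
    have s0 : 0 <= (q%:R ^+ 2)^-1 :> R by rewrite invr_ge0 exprn_ge0.
    apply: addr_ge0; first exact: mulr_ge0.
    apply: mulr_ge0; first by rewrite mulr_ge0 // divr_ge0 // ltW.
    by apply: addr_ge0; apply: mulr_ge0 => //; lra.
  rewrite big_split /= -!mulr_sumr big_split /= -!mulr_sumr.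
  have s1 := @sum_pow32_le Z x.+2 Z0; have s2 := sum_inv_sq x.+2 Z0.
  apply: lerD; first by lra.
  have -> : I%:R * (46 / M%:R) = I%:R * (2 / M%:R) * 23 :> R by field; rewrite gt_eqF.
  rewrite ler_wpM2l ?mulr_ge0 ?invr_ge0 ?(ltW MR) //.
  have l0 := @ln_nat_ge0 R M.
  have : (2 * ln M%:R + 1) * \sum_(Z.+1 <= i < x.+2) (i%:R ^+ 2)^-1 <= 15 :> R.
    have c0 : 0 <= 2 * ln M%:R + 1 :> R by lra.
    apply: le_trans (ler_wpM2l c0 s2) _.
    rewrite ler_pdivrMr //; have : 1 <= Z%:R :> R by rewrite ler1n.
    by lra.
  by lra.
have : delta0 / phi - 92 / M%:R = 0.
  apply: ln_unbounded; exists (delta0 * C + 8 + 46 / M%:R) => x x0.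
  have l0 := @ln_nat_ge0 R x.
  have pos : 0 < delta0 / phi - 92 / M%:R.
    by rewrite subr_gt0 ltr_pdivrMr // mulrAC ltr_pdivlMr.
  rewrite ger0_norm; last by rewrite mulr_ge0 // ltW.
  set I := (trunc_log 2 x).+1.
  have xI : (x < 2 ^ I)%N by apply: trunc_log_ltn.
  have Ix : (2 ^ I.-1 <= x)%N by apply: trunc_logP.
  have lI : I.-1%:R * ln 2 <= ln x%:R :> R.
    rewrite mulr_natl -lnXn // -natrX ler_ln_nat // expn_gt0 //.
  have l2 : 1 <= 2 * ln 2 :> R.
    by have := ln4_ge1 R; rewrite (_ : 4%:R = 2 * 2) ?lnM ?posrE // -?natrM //; lra.
  (* Passing from base 2 to natural logarithms costs a factor 2, which turns 46 into 92. *)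
  have IR : I%:R <= 2 * ln x%:R + 1 :> R.
    have -> : I%:R = I.-1%:R + 1 :> R by rewrite natr1.
    by have : 0 <= I.-1%:R :> R by []; nra.
  have := up x I xI; have := hC x x0; rewrite ler_norml => /andP[h1 _] h2.
  have h3 : delta0 * (phi^-1 * ln x%:R - C) <= delta0 * primesum (delta R M a) x.
    by rewrite ler_pM2l //; lra.
  have h4 : I%:R * (46 / M%:R) <= (2 * ln x%:R + 1) * (46 / M%:R) :> R.
    by rewrite ler_wpM2r // divr_ge0 // ltW.
  have -> : (delta0 / phi - 92 / M%:R) * ln x%:R =
    delta0 * (phi^-1 * ln x%:R - C) + delta0 * C - 2 * ln x%:R * (46 / M%:R) by ring.
  by lra.
move/eqP; rewrite subr_eq0 => /eqP e.
have : delta0 / phi * (phi * M%:R) = 92 / M%:R * (phi * M%:R) by rewrite e.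
have -> : delta0 / phi * (phi * M%:R) = delta0 * M%:R by field; rewrite gt_eqF.
have -> : 92 / M%:R * (phi * M%:R) = 92 * phi by field; rewrite gt_eqF.
by lra.
Qed.

End Class.
End Averaging.

(** * Abundancy and Euler products *)

Section Sigma.
Implicit Types (n m p k : nat).

Lemma sigmaM m n : 0 < m -> 0 < n -> coprime m n -> sigma (m * n) = sigma m * sigma n.
Proof.
move=> m0 n0 mn; rewrite /sigma (perm_big _ (divisorsM m0 n0 mn)) big_allpairs_dep big_distrl /=.
by apply: eq_bigr => d _; rewrite big_distrr.
Qed.

Lemma sigma_pfactor p k : prime p -> sigma (p ^ k) = \sum_(0 <= i < k.+1) p ^ i.
Proof. by move=> pp; rewrite /sigma (perm_big _ (divisors_pfactor k pp)) big_map. Qed.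

Lemma sigma_prime p : prime p -> sigma p = p.+1.
Proof.
move=> pp; rewrite -[X in sigma X]expn1 sigma_pfactor // big_nat_recl // big_nat1.
by rewrite expn0 expn1 add1n.
Qed.

Lemma primesXM p k m : prime p -> 0 < k -> 0 < m -> ~~ (p %| m) ->
  perm_eq (primes (p ^ k * m)) (p :: primes m).
Proof.
move=> pp k0 m0 pm; apply: uniq_perm; rewrite ?primes_uniq //=.
  by rewrite primes_uniq andbT mem_primes pp m0.
move=> q; rewrite primesM // ?expn_gt0 ?(prime_gt0 pp) //.
by rewrite primesX // (primes_prime pp) !inE.
Qed.

End Sigma.

Section Abundancy.
Variable R : realType.
Local Open Scope ring_scope.
Implicit Types (n m p q k z Y : nat).

Definition abundancy n : R := (sigma n)%:R / n%:R.

Lemma abundancyM m n : (0 < m)%N -> (0 < n)%N -> coprime m n ->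
  abundancy (m * n) = abundancy m * abundancy n.
Proof. by move=> m0 n0 mn; rewrite /abundancy sigmaM // !natrM mulf_div. Qed.

Lemma abundancy1 : abundancy 1 = 1.
Proof. by rewrite /abundancy /sigma big_cons big_nil divr1. Qed.

Lemma abundancy_prime p : prime p -> abundancy p = 1 + p%:R^-1.
Proof.
move=> pp; rewrite /abundancy sigma_prime // -addn1 natrD mulrDl divff ?mul1r //.
by rewrite pnatr_eq0 -lt0n prime_gt0.
Qed.

Lemma abundancy_pfactor p k : prime p -> (0 < k)%N ->
  1 + p%:R^-1 <= abundancy (p ^ k) /\ abundancy (p ^ k) * (1 - p%:R^-1) <= 1.
Proof.
move=> pp k0; have p0 : 0 < p%:R :> R by rewrite ltr0n prime_gt0.
have pk0 n : 0 < p%:R ^+ n :> R by rewrite exprn_gt0.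
rewrite /abundancy sigma_pfactor // natrX natr_sum.
under eq_bigr do rewrite natrX.
split.
  case: k k0 => // k _; rewrite ler_pdivlMr // mulrDl mul1r exprS mulKf ?gt_eqF //.
  rewrite -exprS !big_nat_recr //=.
  have : 0 <= \sum_(0 <= i < k) p%:R ^+ i :> R by rewrite sumr_ge0 // => i _; rewrite ltW.
  by lra.
have e : (\sum_(0 <= i < k.+1) p%:R ^+ i) * (p%:R - 1) = p%:R ^+ k.+1 - 1 :> R.
  elim: (k.+1) => [|j IH]; first by rewrite big_geq // mul0r expr0 subrr.
  by rewrite big_nat_recr //= mulrDl IH [p%:R ^+ j.+1]exprS; ring.
have -> : 1 - p%:R^-1 = (p%:R - 1) / p%:R :> R by field; rewrite gt_eqF.
rewrite mulrACA e -invfM -exprSr ler_pdivrMr // mul1r; lra.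
Qed.

(** The local factor at q lies between 1 + 1/q and 1/(1 - 1/q) whatever its exponent, so both bounds
    depend only on the set of primes of n. *)
Lemma abundancy_bounds n : (0 < n)%N ->
  \prod_(q <- primes n) (1 + q%:R^-1) <= abundancy n /\
  abundancy n * \prod_(q <- primes n) (1 - q%:R^-1) <= 1.
Proof.
elim/ltn_ind: n => n IH n0; have [->|n1] := eqVneq n 1%N.
  by rewrite /= !big_nil abundancy1 mulr1.
have [|p [k [m [pp k0 pm /andP[m0 mn] nE]]]] := @prime_power_split n; first by lia.
have [h1 h2] := IH m mn m0; have [h3 h4] := abundancy_pfactor pp k0.
have cop : coprime (p ^ k) m by rewrite coprimeXl // prime_coprime.
have pk0 : (0 < p ^ k)%N by rewrite expn_gt0 prime_gt0.
rewrite nE !(perm_big _ (primesXM pp k0 m0 pm)) !big_cons /= abundancyM //.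
have p0 : 0 <= p%:R^-1 :> R by rewrite invr_ge0.
have a0 j : 0 <= abundancy j by rewrite divr_ge0.
have le1 q : prime q -> 0 <= 1 - q%:R^-1 :> R.
  by move=> qp; rewrite subr_ge0 invf_le1 ?ler1n ?ltr0n prime_gt0.
split.
  apply: ler_pM => //; first by lra.
  by apply: prodr_ge0 => q _; rewrite addr_ge0 // invr_ge0.
rewrite mulrACA; apply: mulr_ile1 => //; first by rewrite mulr_ge0 // le1.
rewrite mulr_ge0 // big_seq prodr_ge0 // => q.
by rewrite mem_primes => /and3P[qp _ _]; apply: le1.
Qed.

Lemma weierstrass_prod (I : Type) (r : seq I) (P : pred I) (F : I -> R) :
  (forall i, P i -> 0 <= F i <= 1) ->
  1 - \sum_(i <- r | P i) F i <= \prod_(i <- r | P i) (1 - F i).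
Proof.
move=> F01; have : 0 <= \prod_(i <- r | P i) (1 - F i) <= 1 /\
  1 - \sum_(i <- r | P i) F i <= \prod_(i <- r | P i) (1 - F i); last by case.
elim: r => [|i r [/andP[h1 h2] h3]]; first by rewrite !big_nil subr0 lexx ler01.
rewrite !big_cons; case: ifP => [Pi|_]; last by rewrite h1 h2.
have /andP[f0 f1] := F01 i Pi; move: h1 h2 h3.
set p := \prod_(_ <- _ | _) _; set s := \sum_(_ <- _ | _) _ => h1 h2 h3.
by split; [apply/andP; split|]; nra.
Qed.

Definition euler_prod z Y : R := \prod_(z.+1 <= q < Y.+1 | prime q) (1 + q%:R^-1).

Lemma euler_prod_ge1 z Y : 1 <= euler_prod z Y.
Proof.
rewrite /euler_prod; elim/big_rec: _ => // q x _ IH.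
have : 0 <= q%:R^-1 :> R by rewrite invr_ge0.
by nra.
Qed.

Lemma euler_prod_mono z Y Y' : (z <= Y <= Y')%N -> euler_prod z Y <= euler_prod z Y'.
Proof.
move=> /andP[zY YY']; rewrite /euler_prod [X in _ <= X](@big_cat_nat _ _ _ Y.+1) //=.
have h1 := euler_prod_ge1 z Y; have h2 := euler_prod_ge1 Y Y'.
by rewrite ler_peMr // (le_trans ler01).
Qed.

Lemma sum_inv_prime_le_euler_prod z Y :
  \sum_(z.+1 <= q < Y.+1 | prime q) q%:R^-1 <= euler_prod z Y.
Proof.
suff : 1 + \sum_(z.+1 <= q < Y.+1 | prime q) q%:R^-1 <= euler_prod z Y by lra.
rewrite /euler_prod; elim: (index_iota _ _) => [|q r IH]; first by rewrite !big_nil addr0.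
rewrite !big_cons; case: ifP => // _.
have : 0 <= q%:R^-1 :> R by rewrite invr_ge0.
have : 0 <= \sum_(i <- r | prime i) i%:R^-1 :> R.
  by rewrite sumr_ge0 // => i _; rewrite invr_ge0.
by move: IH; set s := \sum_(_ <- _ | _) _; set p := \prod_(_ <- _ | _) _; nra.
Qed.

Lemma sum_inv_prime_unbounded z (B : R) :
  exists Y, (z <= Y)%N /\ B < \sum_(z.+1 <= q < Y.+1 | prime q) q%:R^-1.
Proof.
have [C hC] := primesum_one R (N := 1) isT.
have C0 : 0 <= C by have := hC 1%N isT; apply: le_trans; exact: normr_ge0.
pose y0 := (2 ^ (Num.Def.archi_bound (4 * C)).+1)%N.
have ly0 : 2 * C <= ln y0%:R.
  rewrite natrX lnXn // -[X in _ <= X]mulr_natl.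
  have := unstable.ltr_bound (4 * C); set k := Num.Def.archi_bound _ => hk.
  have := ln4_ge1 R; rewrite (_ : 4%:R = 2 * 2) ?lnM ?posrE // -?natrM // => l2.
  have l0 : 0 <= ln 2 - 2^-1 :> R by lra.
  have := mulr_ge0 (ler0n R k) l0; rewrite -(natr1 k); lra.
(* Between Y and Y^4 the sum of ln q / q is at least 3 ln Y - 2C, and each ln q is at most 4 ln Y;
   ln Y >= 2C leaves at least 1/2. *)
have step Y : (y0 <= Y)%N -> 2^-1 <= \sum_(Y.+1 <= q < (Y ^ 4).+1 | prime q) q%:R^-1 :> R.
  move=> y0Y; have Y0 : (1 < Y)%N.
    by apply: leq_trans y0Y; rewrite /y0 expnS; have := expn_gt0 2 (Num.Def.archi_bound (4 * C)); lia.
  have YY : (Y <= Y ^ 4)%N by rewrite -[X in (X <= _)%N]expn1 leq_exp2l.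
  have lY : ln y0%:R <= ln Y%:R :> R by rewrite ler_ln_nat // y0Y expn_gt0.
  have := hC Y (ltnW Y0); have := hC (Y ^ 4)%N; rewrite expn_gt0 (ltnW Y0) => /(_ isT).
  rewrite natrX lnXn ?ltr0n ?(ltnW Y0) //.
  rewrite /primesum (@big_cat_nat _ _ _ Y.+1 1 (Y ^ 4).+1) //=.
  set S1 := \sum_(1 <= _ < _ | _) _; set S2 := \sum_(Y.+1 <= _ < _ | _) _.
  set S := \sum_(Y.+1 <= q < _ | _) q%:R^-1.
  have h : S2 <= 4 * ln Y%:R * S.
    rewrite /S2 /S mulr_sumr big_nat_cond [X in _ <= X]big_nat_cond.
    apply: ler_sum => q /andP[/andP[q1 q2] qp].
    rewrite /unit_ind coprimen1 mul1r ler_wpM2r ?invr_ge0 //.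
    have -> : 4 * ln Y%:R = ln (Y ^ 4)%:R :> R.
      by rewrite natrX lnXn ?ltr0n ?(ltnW Y0) // mulr_natl.
    by apply: ler_ln_nat; rewrite prime_gt0.
  have lpos : 0 < ln Y%:R :> R by rewrite ln_gt0 // ltr1n.
  rewrite !ler_norml -[ln _ *+ _]mulr_natl => /andP[a1 a2] /andP[a3 a4].
  rewrite -(ler_pM2l (mulr_gt0 (ltr0Sn R 3) lpos)); lra.
have many k : exists Y, (z + y0 <= Y)%N /\
    k%:R / 2 <= \sum_(z.+1 <= q < Y.+1 | prime q) q%:R^-1 :> R.
  elim: k => [|k [Y [hY hs]]].
    exists (z + y0)%N; split => //; rewrite mul0r sumr_ge0 // => q _.
    by rewrite invr_ge0.
  have Y1 : (0 < Y)%N by apply: leq_trans hY; rewrite addn_gt0 expn_gt0 orbT.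
  have YY : (Y <= Y ^ 4)%N by rewrite -[X in (X <= _)%N]expn1 leq_pexp2l.
  exists (Y ^ 4)%N; split; first exact: leq_trans YY.
  rewrite (@big_cat_nat _ _ _ Y.+1) //=; last by lia.
  have /step := leq_trans (leq_addl z y0) hY.
  by rewrite -(natr1 k); lra.
have [Y [hY hs]] := many (Num.Def.archi_bound (2 * B)).
exists Y; split; first exact: leq_trans (leq_addr _ _) hY.
have := unstable.ltr_bound (2 * B); move: hs; lra.
Qed.

Lemma euler_prod_unbounded z (B : R) : exists Y, (z <= Y)%N /\ B < euler_prod z Y.
Proof.
have [Y [zY h]] := sum_inv_prime_unbounded z B.
by exists Y; split => //; apply: lt_le_trans h (sum_inv_prime_le_euler_prod _ _).
Qed.

(** Greedy choice: stop just before the product exceeds X. The next factor is at most 1 + 1/z, which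
    bounds the overshoot. *)
Lemma euler_prod_approx z (X : R) : (0 < z)%N -> 1 <= X ->
  exists Y, [/\ (z <= Y)%N, euler_prod z Y <= X & X < euler_prod z Y * (1 + z%:R^-1)].
Proof.
move=> z0 X1; have [Y0 [zY0 hY0]] := euler_prod_unbounded z X.
have ex : exists Y, X < euler_prod z Y by exists Y0.
case: (ex_minnP ex) => Y hY min.
have zY : (z < Y)%N.
  rewrite ltnNge; apply/negP => Yz; move: hY; rewrite /euler_prod big_geq ?ltnS //.
  by rewrite ltNge X1.
case: Y hY min zY => // Y hY min; rewrite ltnS => zY.
have le : euler_prod z Y <= X by rewrite leNgt; apply/negP => /min; rewrite ltnn.
exists Y; split => //; apply: lt_le_trans hY _.
have e1 := euler_prod_ge1 z Y; have z0' : 0 < z%:R :> R by rewrite ltr0n.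
have i0 : 0 <= z%:R^-1 :> R by rewrite invr_ge0.
rewrite {1}/euler_prod big_mkcond big_nat_recr ?ltnS //= -big_mkcond -/(euler_prod z Y).
rewrite ler_pM2l ?(lt_le_trans ltr01) //; case: ifP => _; last by lra.
by rewrite lerD2l lef_pV2 ?posrE ?ltr0n // ler_nat; lia.
Qed.

End Abundancy.

(** * The unconditional statement *)

Section Unconditional.
Variable R : realType.
Local Open Scope ring_scope.
Implicit Types (n m p q k z Y Z M a : nat).

Lemma sum_ln_prime_le Z : \sum_(1 <= q < Z.+1 | prime q) ln q%:R <= 6 * Z%:R :> R.
Proof.
apply: le_trans (psi_le R Z); rewrite /psi big_mkcond; apply: ler_sum => q _.
by case: ifP => qp; [rewrite mangoldt_prime|apply: mangoldt_ge0].
Qed.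

Lemma congruence_dvd_succ q a b : (a = b %[mod q])%N -> (q %| a.+1)%N = (q %| b.+1)%N.
Proof. by move=> e; rewrite /dvdn -addn1 -modnDml e modnDml addn1. Qed.

(** M is 4 times the odd primes up to Z, built one prime at a time by Chinese remainders. The last
    bound, from (q - 1)(1 + 1/q) <= q, makes phi(M)/M small through the divergent product. *)
Lemma exists_modulus z Y Z : (2 <= Z)%N -> exists M a,
  [/\ (4 %| M)%N, (0 < M)%N, coprime a M & (a %% 4 = 1)%N] /\
  [/\ forall q, prime q -> (q %| M)%N = (q <= Z)%N,
      forall q, prime q -> (2 < q <= Z)%N -> (q %| a.+1)%N = (z < q <= Y)%N,
      ln M%:R <= ln 2 + \sum_(1 <= q < Z.+1 | prime q) ln q%:R :> R
    & (totient M)%:R * euler_prod R 1 Z <= M%:R].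
Proof.
elim: Z => // Z IH; rewrite leq_eqVlt => /predU1P[[<-]|].
  exists 4, 1; split; first by [].
  split => [q qp|q qp||].
  - rewrite (@Euclid_dvdM 2 2 q qp) orbb dvdn_prime2 //.
    by have := prime_gt1 qp; lia.
  - by lia.
  - rewrite big_ltn_cond //= big_ltn_cond //= big_geq // addr0.
    by rewrite (_ : 4%:R = 2 * 2 :> R) ?lnM ?posrE // -?natrM.
  rewrite /euler_prod big_ltn_cond //= big_geq // mulr1.
  by rewrite (_ : totient 4 = 2) //; lra.
rewrite ltnS => Z2; have [M [a [[M4 M0 ca a4] [h1 h2 h3 h4]]]] := IH Z2.
case: (boolP (prime Z.+1)) => [qp|qn]; last first.
  have qnE q : prime q -> (q <= Z.+1)%N = (q <= Z)%N.
    by move=> qp; rewrite leq_eqVlt ltnS; case: eqP => // e; rewrite e (negPf qn) in qp.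
  exists M, a; split => //; split.
  - by move=> q qp; rewrite qnE // h1.
  - by move=> q qp; rewrite qnE //; apply: h2.
  - by rewrite big_mkcond big_nat_recr //= -big_mkcond (negPf qn) addr0.
  - rewrite /euler_prod big_mkcond big_nat_recr //=; last by lia.
    by rewrite -big_mkcond (negPf qn) mulr1.
set q := Z.+1 in qp *; have q0 := prime_gt0 qp.
have qM : coprime M q by rewrite coprime_sym prime_coprime // h1 // ltnn.
(* Residue -1 puts q into a + 1; residue 1 makes a + 1 = 2 modulo q, which keeps the odd prime q
   out. *)
pose r := if (z < q <= Y)%N then q.-1 else 1%N.
have rq : coprime r q.
  rewrite /r; case: ifP => _; last exact: coprime1n.
  rewrite coprime_sym prime_coprime //; apply/negP => /dvdn_leq; rewrite /q /=; lia.
have aM : (chinese M q a r = a %[mod M])%N by rewrite chinese_modl.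
have ar : (chinese M q a r = r %[mod q])%N by rewrite chinese_modr.
exists (M * q)%N, (chinese M q a r); split.
  split; first exact: dvdn_mulr.
  - by rewrite muln_gt0 M0.
  - by rewrite coprimeMr -coprime_modl aM coprime_modl ca -coprime_modl ar coprime_modl.
  - by rewrite -(modn_dvdm _ M4) aM modn_dvdm.
split.
- move=> s sp; rewrite Euclid_dvdM // h1 // dvdn_prime2 //.
  by rewrite [RHS]leq_eqVlt ltnS orbC.
- move=> s sp /andP[s2]; rewrite leq_eqVlt ltnS => /predU1P[->|sZ].
    rewrite (congruence_dvd_succ ar) /r; case: ifP => _.
      by rewrite prednK // dvdnn.
    by apply/negP => /dvdn_leq; rewrite /q; lia.
  rewrite -(h2 s sp) ?s2 //; apply: congruence_dvd_succ.
  have sM : (s %| M)%N by rewrite h1.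
  by rewrite -(modn_dvdm _ sM) aM modn_dvdm.
- rewrite natrM lnM ?posrE ?ltr0n // big_mkcond big_nat_recr //= -big_mkcond qp /=.
  by rewrite addrA lerD2r.
rewrite totient_coprime // (totient_prime qp) !natrM /euler_prod big_mkcond big_nat_recr ?(prime_gt1 qp) //=.
rewrite -big_mkcond qp -/(euler_prod R 1 Z) mulrACA; apply: ler_pM => //.
- by rewrite mulr_ge0 // (le_trans ler01) ?euler_prod_ge1.
- by rewrite mulr_ge0 // addr_ge0 // invr_ge0.
have q0R : 0 < q%:R :> R by rewrite ltr0n.
have e : q%:R = Z%:R + 1 :> R by rewrite natr1.
have Z0R : 0 <= Z%:R :> R by [].
by rewrite /q /= mulrDr mulr1 -[X in _ <= X]natr1 lerD2l ler_pdivrMr // mul1r ler_nat.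
Qed.

(** The exponents of the primes in k are unknown, so only the bounds by primes are available. On the
    primes in (z, Y] they differ by the product of 1 - 1/q^2, at least 1 - 1/z; those above Z cost a
    factor 1 - d. *)
Lemma primes_abundancy_bounds k z Y Z (d : R) : (0 < k)%N -> (0 < z)%N ->
  (z <= Y <= Z)%N -> 0 <= d < 1 -> z%:R^-1 < 1 :> R ->
  (forall q, prime q -> (q <= Z)%N -> (q %| k)%N = (z < q <= Y)%N) ->
  \sum_(q <- primes k | (Z < q)%N) q%:R^-1 <= d ->
  euler_prod R z Y <= abundancy R k /\
  abundancy R k * ((1 - z%:R^-1) * (1 - d)) <= euler_prod R z Y.
Proof.
move=> k0 z0 /andP[zY YZ] /andP[d0 d1] z1 hk hs.
have [lo hi] := abundancy_bounds R k0.
have i0 q : 0 <= q%:R^-1 :> R by rewrite invr_ge0.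
have i1 q : prime q -> q%:R^-1 <= 1 :> R.
  by move=> qp; rewrite invf_le1 ?ler1n ?ltr0n prime_gt0.
have small (F : nat -> R) : \prod_(q <- primes k | ~~ (Z < q)%N) F q =
    \prod_(z.+1 <= q < Y.+1 | prime q) F q.
  rewrite -big_filter -[RHS]big_filter; apply: perm_big; apply: uniq_perm.
  - by rewrite filter_uniq // primes_uniq.
  - by rewrite filter_uniq // iota_uniq.
  move=> q; rewrite !mem_filter mem_primes k0 mem_index_iota -leqNgt /=.
  rewrite ltnS andbCA; case qp: (prime q) => //=.
  case: (leqP q Z) => qZ /=; first by rewrite hk.
  by apply/esym/negP; lia.
have lo1 (r : seq nat) (P : pred nat) : 1 <= \prod_(q <- r | P q) (1 + q%:R^-1) :> R.
  by elim/big_rec: _ => // q x _ IH; have := i0 q; nra.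
have e1 := euler_prod_ge1 R z Y.
split.
  apply: le_trans lo; rewrite (bigID (fun q => Z < q)%N) /= small -/(euler_prod R z Y).
  by rewrite ler_peMl // (le_trans ler01).
set D := \prod_(q <- primes k) (1 - q%:R^-1) in hi.
have hD : D = \prod_(q <- primes k | (Z < q)%N) (1 - q%:R^-1) *
     \prod_(z.+1 <= q < Y.+1 | prime q) (1 - q%:R^-1).
  by rewrite /D (bigID (fun q => Z < q)%N) /= small.
have hbig : 1 - d <= \prod_(q <- primes k | (Z < q)%N) (1 - q%:R^-1).
  rewrite big_seq_cond; apply: le_trans (weierstrass_prod _ _) => [|q].
    by rewrite -big_seq_cond; lra.
  by rewrite mem_primes => /andP[/and3P[qp _ _] _]; rewrite i0 i1.
have hsmall : 1 - z%:R^-1 <= euler_prod R z Y *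
     \prod_(z.+1 <= q < Y.+1 | prime q) (1 - q%:R^-1).
  have -> : euler_prod R z Y * \prod_(z.+1 <= q < Y.+1 | prime q) (1 - q%:R^-1) =
      \prod_(z.+1 <= q < Y.+1 | prime q) (1 - (q%:R ^+ 2)^-1) :> R.
    rewrite /euler_prod -big_split /=; apply: eq_bigr => q _.
    by rewrite -exprVn; ring.
  apply: le_trans (weierstrass_prod _ _) => [|q qp]; last first.
    rewrite -exprVn exprn_ge0 ?i0 //= expr_le1 ?i0 // i1 //.
  rewrite lerD2l lerN2; apply: le_trans (sum_inv_sq R Y.+1 z0).
  rewrite big_mkcond; apply: ler_sum => q _; case: ifP => // _.
  by rewrite invr_ge0 exprn_ge0.
move: hD hbig hsmall; set B := \prod_(_ <- _ | _) _; set A := \prod_(_ <= _ < _ | _) _.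
set E := euler_prod R z Y in e1 * => hD hbig hsmall.
have A0 : 0 <= A.
  by apply: prodr_ge0 => q qp; rewrite subr_ge0 i1.
have h0 : 0 <= abundancy R k by rewrite divr_ge0.
have p1 : (1 - z%:R^-1) * (1 - d) <= E * D.
  have -> : E * D = E * A * B by rewrite hD; ring.
  by apply: ler_pM => //; rewrite subr_ge0 ltW.
apply: le_trans (ler_wpM2l h0 p1) _; rewrite mulrCA ler_piMr // (le_trans ler01) //.
Qed.

(** p = 1 modulo 4 makes p + 1 twice an odd number k, which splits off the factor [abundancy] 2 =
    3/2. *)
Lemma half_succ_prime_divisors p a M z Y Z : (2 <= z)%N -> (4 %| M)%N -> (a %% 4 = 1)%N ->
  (p = a %[mod M])%N -> (forall q, prime q -> (q %| M)%N = (q <= Z)%N) ->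
  (forall q, prime q -> (2 < q <= Z)%N -> (q %| a.+1)%N = (z < q <= Y)%N) ->
  exists k, [/\ (p.+1 = 2 * k)%N, coprime 2 k, (0 < k)%N,
    forall q, prime q -> (q <= Z)%N -> (q %| k)%N = (z < q <= Y)%N
    & forall q, prime q -> (2 < q)%N -> (q %| p.+1)%N = (q %| k)%N].
Proof.
move=> z2 M4 a4 pa h1 h2.
have p4 : (p %% 4 = 1)%N by rewrite -(modn_dvdm _ M4) pa modn_dvdm.
exists (p.+1 %/ 2)%N; set k := (p.+1 %/ 2)%N.
have pk : (p.+1 = 2 * k)%N by rewrite /k; clear -p4; lia.
have ko : ~~ (2 %| k)%N by rewrite /k; clear -p4; lia.
have k0 : (0 < k)%N by clear -pk; lia.
have dk q : prime q -> (2 < q)%N -> (q %| p.+1)%N = (q %| k)%N.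
  by move=> qp q2; rewrite pk Euclid_dvdM // dvdn_prime2 // gtn_eqF.
split => //; first by rewrite prime_coprime.
move=> q qp qZ; have q1 := prime_gt1 qp; have [->|q2] := eqVneq q 2%N.
  by rewrite (negPf ko); apply/esym/negP; clear -z2; lia.
have q3 : (2 < q)%N by clear -q1 q2; lia.
rewrite -dk // -h2 ?q3 //.
have qM : (q %| M)%N by rewrite h1.
by apply: congruence_dvd_succ; rewrite -(modn_dvdm _ qM) pa modn_dvdm.
Qed.

Lemma dense_prime : dense_in_halfline
    (fun y : R => exists p : nat, prime p /\
        y = ((sigma p.+1)%:R / (sigma p)%:R)%R) (3 / 2).
Proof.
move=> x hx e e0.
(* With t = 1/z the two losses combine to 1/(1 - t)^2 <= 1 + 6 t for t <= 1/2, hence the 6 and the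
   condition z >= 2. *)
have [z [z2 hz]] : exists z, (2 <= z)%N /\ 6 * x / e < z%:R.
  exists (Num.Def.archi_bound (6 * x / e)).+2; split => //.
  apply: lt_le_trans (unstable.ltr_bound _) _.
  by rewrite ler_nat; apply: leqW; apply: leqnSn.
have z0 : (0 < z)%N by apply: ltnW.
have zR : 0 < z%:R :> R by rewrite ltr0n.
have zi : 0 < z%:R^-1 :> R by rewrite invr_gt0.
have zi2 : z%:R^-1 <= 2^-1 :> R by rewrite lef_pV2 ?posrE ?ler_nat.
have ez : 6 * x * z%:R^-1 < e.
  by move: hz; rewrite ltr_pdivrMr // => hz; rewrite ltr_pdivrMr // [X in _ < X]mulrC.
have X1 : 1 <= 2 * x / 3 by lra.
have [Y [zY Ylo Yhi]] := euler_prod_approx z0 X1.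
(* As phi(M) times this product is at most M, this gives 92 phi(M) < M/z, the smallness required for
   a [far_mass] of at most 1/z. *)
have [Z [YZ hE]] : exists Z, (Y <= Z)%N /\ 92 * z%:R < euler_prod R 1 Z.
  have [Z' [Z'1 hZ']] := @euler_prod_unbounded R 1 (92 * z%:R).
  exists (Z' + Y)%N; rewrite leq_addl; split => //.
  by apply: lt_le_trans hZ' _; apply: euler_prod_mono; rewrite Z'1 leq_addr.
have Z2 : (2 <= Z)%N by apply: leq_trans YZ; apply: leq_trans zY.
have Z0 : (0 < Z)%N by apply: ltnW.
have Z0R : 1 <= Z%:R :> R by rewrite ler1n.
have [M [a [[M4 M0 ca a4] [h1 h2 h3 h4]]]] := exists_modulus z Y Z2.
have M2 : (2 <= M)%N by apply: leq_trans (dvdn_leq M0 M4).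
have cop q : prime q -> (Z < q)%N -> coprime q M.
  by move=> qp Zq; rewrite prime_coprime // h1 // -ltnNge.
have lM : ln M%:R <= 7 * Z%:R :> R.
  have := sum_ln_prime_le Z; have := @le_ln1Dx R 1; lra.
have tM : 92 * (totient M)%:R < z%:R^-1 * M%:R :> R.
  have t0 : 0 < (totient M)%:R :> R by rewrite ltr0n totient_gt0.
  rewrite ltr_pdivlMl //; apply: lt_le_trans h4.
  have -> : z%:R * (92 * (totient M)%:R) = (totient M)%:R * (92 * z%:R) :> R by ring.
  by rewrite ltr_pM2l.
have [p [pp pa hp]] := exists_prime_few_large_factors M2 ca Z0 cop zi lM tM.
have [k [pk k2 k0 kP dk]] := half_succ_prime_divisors z2 M4 a4 pa h1 h2.
have hs : \sum_(q <- primes k | (Z < q)%N) q%:R^-1 <= z%:R^-1 :> R.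
  apply: le_trans hp; rewrite /far_mass -big_filter -[X in _ <= X]big_filter.
  rewrite le_eqVlt; apply/orP; left; apply/eqP; apply: perm_big; apply: uniq_perm.
  - by rewrite filter_uniq // primes_uniq.
  - by rewrite filter_uniq // iota_uniq.
  move=> q; rewrite !mem_filter mem_primes k0 mem_index_iota /=.
  case qp: (prime q); rewrite ?andbF //=; case: (ltnP Z q) => //= Zq; rewrite ?andbF //.
  rewrite -dk //; last by apply: leq_ltn_trans Zq.
  by case: (boolP (q %| p.+1)%N) => //= /dvdn_leq => /(_ isT); rewrite ltnS => ->.
have zYZ : (z <= Y <= Z)%N by rewrite zY.
have z1 : z%:R^-1 < 1 :> R by lra.
have d1 : 0 <= (z%:R^-1 : R) < 1 by rewrite ltW.
have [lo hi] := primes_abundancy_bounds k0 z0 zYZ d1 z1 kP hs.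
exists ((sigma p.+1)%:R / (sigma p)%:R); split; first by exists p.
have -> : (sigma p.+1)%:R / (sigma p)%:R = 3 / 2 * abundancy R k.
  rewrite (sigma_prime pp) -/(abundancy R p.+1) pk abundancyM //.
  by rewrite abundancy_prime //; congr (_ * _); lra.
move: Ylo Yhi lo hi; set E := euler_prod R z Y; set h := abundancy R k.
set t := z%:R^-1 in zi zi2 ez * => Ylo Yhi lo hi.
have E0 : 1 <= E by apply: euler_prod_ge1.
have t0 : 0 <= t by apply: ltW.
have t6 : 0 <= 1 + 6 * t by lra.
have h0 : 0 <= h by lra.
have p1 : E * t <= 2 * x / 3 * t by rewrite ler_wpM2r.
have q1 : 1 <= (1 - t) * (1 - t) * (1 + 6 * t).
  have : 0 <= t * ((1 - 2 * t) * (4 - 3 * t)) by rewrite !mulr_ge0 //; lra.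
  by lra.
have q2 : h <= h * ((1 - t) * (1 - t)) * (1 + 6 * t) by rewrite -mulrA ler_peMr.
have q3 : h * ((1 - t) * (1 - t)) * (1 + 6 * t) <= E * (1 + 6 * t) by rewrite ler_wpM2r.
have q4 : E * (1 + 6 * t) <= 2 * x / 3 * (1 + 6 * t) by rewrite ler_wpM2r.
clear -p1 q2 q3 q4 Ylo Yhi lo ez.
by rewrite ltr_norml; apply/andP; split; lra.
Qed.

End Unconditional.

(** * The statements assuming Dickson's conjecture *)

Section DicksonTools.
Implicit Types (n m p q k z Y : nat).

Lemma coprime_no_common_prime a b : 0 < a ->
  (forall q, prime q -> q %| a -> ~~ (q %| b)) -> coprime a b.
Proof.
move=> a0 h; rewrite /coprime; case: eqP => // /eqP g1.
have g0 : 0 < gcdn a b by rewrite gcdn_gt0 a0.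
have qp : prime (pdiv (gcdn a b)) by apply: pdiv_prime; lia.
have qg := pdiv_dvd (gcdn a b).
have := h _ qp (dvdn_trans qg (dvdn_gcdl a b)).
by rewrite (dvdn_trans qg (dvdn_gcdr a b)).
Qed.

Definition prime_prod z Y := \prod_(z.+1 <= q < Y.+1 | prime q) q.

Lemma prime_prod_gt0 z Y : 0 < prime_prod z Y.
Proof. by rewrite /prime_prod big_seq_cond prodn_cond_gt0 // => q /andP[_ /prime_gt0]. Qed.

Lemma prime_prodS z Y : z <= Y ->
  prime_prod z Y.+1 = prime_prod z Y * (if prime Y.+1 then Y.+1 else 1).
Proof.
by move=> zY; rewrite /prime_prod big_mkcond big_nat_recr //= -big_mkcond.
Qed.

Lemma dvdn_prime_prod z Y q : prime q -> (q %| prime_prod z Y) = (z < q <= Y).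
Proof.
move=> qp; have [zY|Yz] := leqP z Y; last first.
  rewrite /prime_prod big_geq; last by rewrite ltnS ltnW.
  rewrite dvdn1.
  by have := prime_gt1 qp; lia.
elim: Y zY => [|Y IH].
  rewrite leqn0 => /eqP ->; rewrite /prime_prod big_geq // dvdn1.
  by have := prime_gt1 qp; lia.
rewrite leq_eqVlt => /predU1P[->|].
  rewrite /prime_prod big_geq // dvdn1.
  by have := prime_gt1 qp; lia.
rewrite ltnS => zY; rewrite prime_prodS // Euclid_dvdM // IH //.
case: ifP => pY; first by rewrite dvdn_prime2 //; lia.
rewrite dvdn1; have := prime_gt1 qp; have : q != Y.+1 by apply: contraFneq pY => <-.
by lia.
Qed.

Lemma not_dvdz_prod (fs : seq (int * int)) (q : nat) (t : int) : prime q ->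
  (forall f, f \in fs -> ~~ (q %| `|lin_eval f t|)) ->
  ~~ (Posz q %| (\prod_(f <- fs) lin_eval f t)%R)%Z.
Proof.
move=> qp; elim: fs => [|f fs IH] h.
  by rewrite big_nil dvdzE /= dvdn1; have := prime_gt1 qp; lia.
rewrite big_cons dvdzE abszM Euclid_dvdM //= negb_or h ?mem_head //=.
apply: contra (IH _) => [|g gf]; first by rewrite dvdzE.
by apply: h; rewrite inE gf orbT.
Qed.

Lemma lin_eval_nat (a b t : nat) : lin_eval (Posz a, Posz b) (Posz t) = Posz (a * t + b).
Proof. by rewrite /lin_eval /= PoszD PoszM. Qed.

Lemma lin_eval_pred (a t : nat) : 0 < a * t ->
  lin_eval (Posz a, (-1)%R) (Posz t) = Posz (a * t).-1.
Proof. by rewrite /lin_eval /=; lia. Qed.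

Lemma int_prime_nat n : int_prime (Posz n) = prime n.
Proof.
rewrite /int_prime /=; case: (boolP (prime n)) => [pn|_]; last by rewrite andbF.
by rewrite andbT ltz_nat prime_gt0.
Qed.

Lemma solve_congruence m q c r : coprime m q -> 0 < q ->
  exists t, c + m * t = r %[mod q].
Proof.
move=> cm q0; have [m' [_ hm']] := unit_inverse q0 cm.
exists (m' * (r + (q - c %% q))).
rewrite mulnCA -modnDmr hm' modnDmr addnCA.
have -> : c + (q - c %% q) = (c %/ q).+1 * q.
  rewrite {1}(divn_eq c q) -addnA subnKC; last by rewrite ltnW // ltn_pmod.
  by rewrite mulSn addnC.
by rewrite addnC modnMDl.
Qed.

Lemma dvdn_congruence q n r c : n = r %[mod q] -> (q %| n + c) = (q %| r + c).
Proof. by move=> e; rewrite /dvdn -modnDml e modnDml. Qed.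

Lemma ndvd_small q c : 0 < c < q -> (q %| c) = false.
Proof. by move=> /andP[c0 cq]; apply: gtnNdvd. Qed.

Lemma prime_ge5 q : prime q -> ~~ (q %| 6) -> 5 <= q.
Proof.
move=> qp q6; rewrite leqNgt; apply: contra q6 => q5.
by case: q qp q5 => [|[|[|[|[|]]]]].
Qed.

Lemma dvdn_pred_eq q n : 0 < n -> n = 2 %[mod q] -> n.-1 = 1 %[mod q].
Proof.
move=> n0 e; apply/eqP; rewrite -(eqn_modDr 1) addn1 prednK //.
by apply/eqP.
Qed.

Hypothesis Dickson : Dickson_conjecture.

(** The forms are t, m t - 1 and m t + 1. Modulo a prime q of m, t = 1 is admissible; 6 | m leaves
    only q >= 5 to treat. *)
Lemma dickson_twin m N : 0 < m -> 6 %| m ->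
  exists p t, [/\ N < t, prime t, prime p, prime p.+2 & p.+1 = m * t].
Proof.
move=> m0 m6.
pose fs : seq (int * int) := [:: (Posz 1, Posz 0); (Posz m, -1)%R; (Posz m, Posz 1)].
have pos f : f \in fs -> (0 < f.1)%R.
  by rewrite !inE => /or3P[] /eqP -> //=; rewrite ltz_nat.
have adm q : prime q -> exists t : int, ~~ (Posz q %| (\prod_(f <- fs) lin_eval f t)%R)%Z.
  move=> qp; have q1 := prime_gt1 qp.
  suff [t [t0 h1 h2 h3]] : exists t : nat,
     [/\ 0 < t, ~~ (q %| t), ~~ (q %| (m * t).-1) & ~~ (q %| m * t + 1)].
    exists (Posz t); apply: not_dvdz_prod => // f; rewrite !inE => /or3P[] /eqP ->.
    - by rewrite lin_eval_nat mul1n addn0.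
    - by rewrite lin_eval_pred // muln_gt0 m0.
    - by rewrite lin_eval_nat.
  have [qm|qm] := boolP (q %| m).
    exists 1; rewrite muln1; split => //.
    - by rewrite dvdn1; clear -q1; lia.
    - apply/negP => qd; move: qm; rewrite -(prednK m0) -addn1 dvdn_addr // dvdn1.
      by clear -q1; lia.
    by rewrite dvdn_addr // dvdn1; clear -q1; lia.
  have q5 : 5 <= q.
    by apply: prime_ge5 => //; apply: contra qm => /dvdn_trans; apply.
  have sm r : 0 < r <= 4 -> (q %| r) = false.
    by move=> /andP[r0 r4]; rewrite ndvd_small // r0 (leq_ltn_trans r4).
  have cmq : coprime m q by rewrite coprime_sym prime_coprime.
  (* With m t = 3 the neighbours are 2 and 4, all nonzero modulo q >= 5. *)
  have [t] := solve_congruence 0 3 cmq (ltnW q1); rewrite add0n => ht.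
  have qmt : ~~ (q %| m * t).
    by rewrite -[m * t]addn0 (dvdn_congruence _ ht) sm.
  have mt0 : 0 < m * t by rewrite lt0n; apply: contra qmt => /eqP ->.
  have hp : (m * t).-1 = 2 %[mod q].
    by apply/eqP; rewrite -(eqn_modDr 1) addn1 prednK //; apply/eqP.
  exists t; split.
  - by move: mt0; rewrite muln_gt0 => /andP[].
  - by apply: contra qmt => qt; apply: dvdn_mull.
  - by rewrite -[_.-1]addn0 (dvdn_congruence _ hp) sm.
  by rewrite (dvdn_congruence _ ht) sm.
have [t [Nt hf]] := Dickson pos adm N.
have t0 : 0 < t by apply: leq_ltn_trans Nt.
have mt0 : 0 < m * t by rewrite muln_gt0 m0.
exists (m * t).-1, t; split => //; last by rewrite prednK.
- have := hf _ (mem_head _ _).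
  by rewrite lin_eval_nat int_prime_nat mul1n addn0.
- have := hf (Posz m, -1)%R; rewrite !inE eqxx orbT => /(_ isT).
  by rewrite lin_eval_pred // int_prime_nat.
have := hf (Posz m, Posz 1); rewrite !inE eqxx !orbT => /(_ isT).
by rewrite lin_eval_nat int_prime_nat addn1 prednK.
Qed.

(** p = m B t + c with m = 12 A, where c is -1 modulo m and 1 modulo 2 B. Every t then gives p + 1
    and p - 1 their prescribed factors, with cofactors k1 and k2 linear in t. *)
Lemma dickson_two_sided A B N : 0 < A -> 0 < B -> coprime (12 * A) B ->
  exists p k1 k2, [/\ N < k1, N < k2, prime k1 & prime k2] /\
    [/\ prime p, prime p.+2, p.+1 = 12 * A * k1 & p.-1 = 2 * B * k2].
Proof.
move=> A0 B0 cop; set m := 12 * A in cop *.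
have m0 : 0 < m by rewrite muln_gt0.
have d12 : 12 %| m by apply: dvdn_mulr.
have d4 : 4 %| m by apply: dvdn_trans d12.
have c2B : coprime 2 B by apply: coprime_dvdl cop; apply: dvdn_trans d12.
have c3B : coprime 3 B by apply: coprime_dvdl cop; apply: dvdn_trans d12.
set c := chinese m B m.-1 1.
have cm : m %| c.+1.
  rewrite (congruence_dvd_succ (b := m.-1)) ?prednK //.
  by rewrite /c chinese_modl.
have c4 : 4 %| c.+1 by apply: dvdn_trans cm.
have c0 : 0 < c by clear -c4; lia.
have cB : 2 * B %| c.-1.
  rewrite Gauss_dvd //; apply/andP; split; first by clear -c4; lia.
  by rewrite -subn1 -eqn_mod_dvd //; apply/eqP; rewrite /c chinese_modr.
have [c1] := dvdnP cm; rewrite mulnC => c1E.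
have [c2] := dvdnP cB; rewrite mulnC => c2E.
have P1 t : (m * B * t + c).+1 = m * (B * t + c1).
  by rewrite -addnS c1E mulnDr mulnA.
have P2 t : (m * B * t + c).-1 = 2 * B * (6 * A * t + c2).
  rewrite mulnDr -c2E -[in LHS](prednK c0) addnS /= /m; congr (_ + _).
  by clear; lia.
pose fs : seq (int * int) := [:: (Posz B, Posz c1); (Posz (6 * A), Posz c2);
  (Posz (m * B), Posz c); (Posz (m * B), Posz c.+2)].
have pos f : f \in fs -> (0 < f.1)%R.
  by rewrite !inE => /or4P[] /eqP -> /=; rewrite ltz_nat // !muln_gt0 ?m0 ?A0.
have adm q : prime q -> exists t : int, ~~ (Posz q %| (\prod_(f <- fs) lin_eval f t)%R)%Z.
  move=> qp; have q1 := prime_gt1 qp.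
  suff [t [h1 h2 h3 h4]] : exists t : nat,
     [/\ ~~ (q %| B * t + c1), ~~ (q %| 6 * A * t + c2),
      ~~ (q %| m * B * t + c) & ~~ (q %| m * B * t + c + 2)].
    exists (Posz t); apply: not_dvdz_prod => // f; rewrite !inE => /or4P[] /eqP ->;
      rewrite lin_eval_nat //.
    by rewrite -addn2 addnA.
  have nd1 : ~~ (q %| 1) by rewrite dvdn1; clear -q1; lia.
  (* If q divides m or B, then p is fixed modulo q and only one cofactor still varies; t = 0 or t =
     1 makes it nonzero. *)
  have toggle a b : ~~ (q %| a) -> exists t : nat, ~~ (q %| a * t + b).
    move=> qa; case: (boolP (q %| b)) => qb.
      by exists 1; rewrite muln1 dvdn_addl.
    by exists 0; rewrite muln0.
  have Ppos t : 0 < m * B * t + c by rewrite addn_gt0 c0 orbT.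
  have [qm|qm] := boolP (q %| m).
    have qB : ~~ (q %| B) by rewrite -prime_coprime //; apply: coprime_dvdl cop.
    have [t ht] := toggle B c1 qB; exists t; set P := m * B * t + c.
    have qP : q %| P.+1 by rewrite P1 dvdn_mulr.
    have P4 : 4 %| P.+1 by rewrite P1 dvdn_mulr.
    split => //.
    (* A common prime q of p + 1 and k2 must be 2, but then 4 | p - 1, against 4 | p + 1. *)
    - apply/negP => q2; have hP := P2 t; rewrite -/P in hP.
      have : q %| P.-1 by rewrite hP dvdn_mull.
      have e : P.+1 = P.-1 + 2 by clear -P4; lia.
      move: (qP); rewrite e => h /dvdn_addr h'; move: h; rewrite h' dvdn_prime2 // => /eqP q2E.
      rewrite q2E in q2.
      have : 2 * 2 %| P.-1 by rewrite hP dvdn_mul // dvdn_mulr.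
      by clear -P4; lia.
    - by apply/negP => h; move: qP; rewrite -addn1 dvdn_addr // (negPf nd1).
    by apply/negP; rewrite addn2 -addn1 dvdn_addr // (negPf nd1).
  have [qB|qB] := boolP (q %| B).
    have q6 : ~~ (q %| 6 * A).
      by apply: contra qm => h; rewrite /m -[12]/(2 * 6) -mulnA dvdn_mull.
    have q2 : q != 2 by apply: contraTneq qB => ->; rewrite -prime_coprime.
    have q3 : q != 3 by apply: contraTneq qB => ->; rewrite -prime_coprime.
    have [t ht] := toggle (6 * A) c2 q6; exists t; set P := m * B * t + c.
    have P0 : 0 < P by apply: Ppos.
    have qP : q %| P.-1 by rewrite P2 dvdn_mulr // dvdn_mull.
    split => //.
    - apply/negP => h; have : q %| P.+1 by rewrite P1 dvdn_mull.
      have -> : P.+1 = P.-1 + 2 by clear -P0; lia.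
      by rewrite dvdn_addr // dvdn_prime2 // (negPf q2).
    - apply/negP; have -> : P = P.-1 + 1 by clear -P0; lia.
      by rewrite dvdn_addr // (negPf nd1).
    apply/negP; have -> : P + 2 = P.-1 + 3 by clear -P0; lia.
    by rewrite dvdn_addr // dvdn_prime2 // (negPf q3).
  have q5 : 5 <= q.
    by apply: prime_ge5 => //; apply: contra qm => h; apply: dvdn_trans d12; apply: dvdn_trans h _.
  have cq : coprime (m * B) q by rewrite coprime_sym prime_coprime // Euclid_dvdM // negb_or qm.
  (* With p = 2 modulo q the numbers p - 1, p, p + 1, p + 2 become 1, 2, 3, 4, all nonzero for q >=
     5. *)
  have [t] := solve_congruence c 2 cq (ltnW q1); rewrite addnC => ht.
  exists t; set P := m * B * t + c in ht *; have P0 : 0 < P by apply: Ppos.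
  have hp := dvdn_pred_eq P0 ht.
  have sm r : 0 < r <= 4 -> (q %| r) = false.
    by move=> /andP[r0 r4]; rewrite ndvd_small // r0 (leq_ltn_trans r4).
  split.
  - apply/negP => h; have : q %| P + 1 by rewrite addn1 P1 dvdn_mull.
    by rewrite (dvdn_congruence _ ht) sm.
  - apply/negP => h; have : q %| P.-1 + 0 by rewrite addn0 P2 dvdn_mull.
    by rewrite (dvdn_congruence _ hp) sm.
  - by rewrite -[P]addn0 (dvdn_congruence _ ht) sm.
  by rewrite (dvdn_congruence _ ht) sm.
have [t [Nt hf]] := Dickson pos adm N.
have key a b : (Posz a, Posz b) \in fs -> prime (a * t + b).
  by move=> /hf; rewrite lin_eval_nat int_prime_nat.
have lt a b : 0 < a -> N < a * t + b.
  move=> a0; apply: leq_trans Nt _; apply: leq_trans (leq_addr _ _).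
  by rewrite leq_pmull.
exists (m * B * t + c), (B * t + c1), (6 * A * t + c2); split; split.
- exact: lt.
- by apply: lt; rewrite muln_gt0.
- by apply: key; rewrite !inE eqxx.
- by apply: key; rewrite !inE eqxx !orbT.
- by apply: key; rewrite !inE eqxx !orbT.
- by have := key (m * B) c.+2; rewrite !addnS; apply; rewrite !inE eqxx !orbT.
- exact: P1.
exact: P2.
Qed.

End DicksonTools.

(** * From prime values of linear forms to dense ratios *)

Section Conditional.
Variable R : realType.
Local Open Scope ring_scope.
Implicit Types (n m p q k z Y : nat).

Lemma coprime_prime_prod c z Y : (0 < c)%N ->
  (forall q, prime q -> (q %| c)%N -> ~~ (z < q <= Y)%N) -> coprime c (prime_prod z Y).
Proof.
by move=> c0 h; apply: coprime_no_common_prime => // q qp qc; rewrite dvdn_prime_prod // h.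
Qed.

Lemma abundancy_prime_prod z Y : (z <= Y)%N -> abundancy R (prime_prod z Y) = euler_prod R z Y.
Proof.
elim: Y => [|Y IH].
  by rewrite leqn0 => /eqP ->; rewrite /prime_prod /euler_prod !big_geq // abundancy1.
rewrite leq_eqVlt => /predU1P[->|].
  by rewrite /prime_prod /euler_prod !big_geq // abundancy1.
rewrite ltnS => zY; rewrite prime_prodS // /euler_prod big_mkcond big_nat_recr //=.
rewrite -big_mkcond -/(euler_prod R z Y) -IH //.
case: ifP => pY; last by rewrite muln1 mulr1.
rewrite abundancyM ?prime_prod_gt0 ?(abundancy_prime R pY) // coprime_sym.
by apply: coprime_prime_prod => // q qp; rewrite dvdn_prime2 // => /eqP ->; rewrite ltnn andbF.
Qed.

Lemma abundancy_mul_prime m k : (0 < m)%N -> prime k -> (m < k)%N ->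
  abundancy R (m * k) = abundancy R m * (1 + k%:R^-1).
Proof.
move=> m0 kp mk; rewrite abundancyM ?(prime_gt0 kp) ?(abundancy_prime R kp) //.
by rewrite coprime_sym prime_coprime // gtnNdvd.
Qed.

Lemma abundancy2 : abundancy R 2 = 3 / 2.
Proof. by rewrite abundancy_prime //; lra. Qed.

Lemma abundancy6 : abundancy R 6 = 2.
Proof.
rewrite (_ : 6%N = (2 * 3)%N) // abundancyM // !abundancy_prime //.
by field.
Qed.

Lemma abundancy12 : abundancy R 12 = 7 / 3.
Proof.
have s4 : sigma (2 ^ 2) = 7%N by rewrite sigma_pfactor // !big_nat_recr //= big_geq.
have -> : abundancy R 12 = abundancy R (2 ^ 2) * abundancy R 3 by rewrite -abundancyM.
by rewrite (@abundancy_prime R 3 isT) /abundancy s4 natrX; field.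
Qed.

Lemma exists_inv_lt (x e : R) n0 : 0 < e -> 0 <= x ->
  exists z, (n0 <= z)%N /\ x * z%:R^-1 < e.
Proof.
move=> e0 x0; exists (n0 + (Num.Def.archi_bound (x / e)).+1)%N; split; first exact: leq_addr.
set z := (n0 + _)%N; have zR : 0 < z%:R :> R by rewrite ltr0n /z addnS.
have hz : x / e < z%:R.
  apply: lt_le_trans (unstable.ltr_bound _) _.
  by rewrite ler_nat /z addnS; apply: leqW; apply: leq_addl.
by move: hz; rewrite ltr_pdivrMr // => hz; rewrite ltr_pdivrMr // [X in _ < X]mulrC.
Qed.

(** As sigma(p) = p + 1, the ratio is exactly the abundancy of p + 1 = 6 [prime_prod z Y] t: twice
    an Euler product aimed at x/2, times 1 + 1/t with t > z. *)
Lemma dense_twin_prime : Dickson_conjecture -> dense_in_halfline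
    (fun y : R => exists p : nat, [/\ prime p, prime p.+2 &
       y = ((sigma p.+1)%:R / (sigma p)%:R)%R]) 2.
Proof.
move=> D x hx e e0; have x0 : 0 <= x by lra.
have [z [z3 hz]] := exists_inv_lt 3 e0 x0.
have z0 : (0 < z)%N by apply: leq_trans z3.
have X1 : 1 <= x / 2 by lra.
have [Y [zY Ylo Yhi]] := euler_prod_approx z0 X1.
have cop : coprime 6 (prime_prod z Y).
  apply: coprime_prime_prod => // q qp; rewrite (_ : 6%N = (2 * 3)%N) // Euclid_dvdM //.
  by rewrite !dvdn_prime2 //; apply: contraTN => /andP[zq _]; clear -z3 zq; lia.
set m := (6 * prime_prod z Y)%N.
have m0 : (0 < m)%N by rewrite muln_gt0 prime_prod_gt0.
have am : abundancy R m = 2 * euler_prod R z Y.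
  by rewrite /m abundancyM ?prime_prod_gt0 // abundancy6 abundancy_prime_prod.
have m6 : (6 %| m)%N by apply: dvdn_mulr.
have [p [t [Nt tp pp pp2 pt]]] := dickson_twin D (m + z) m0 m6.
exists ((sigma p.+1)%:R / (sigma p)%:R); split; first by exists p.
have mt : (m < t)%N by apply: leq_ltn_trans Nt; apply: leq_addr.
rewrite (sigma_prime pp) -/(abundancy R p.+1) pt abundancy_mul_prime // am.
have ti : 0 <= t%:R^-1 :> R by rewrite invr_ge0.
have tz : t%:R^-1 <= z%:R^-1 :> R.
  rewrite lef_pV2 ?posrE ?ltr0n ?(prime_gt0 tp) // ler_nat ltnW //.
  by apply: leq_ltn_trans Nt; apply: leq_addl.
move: Ylo Yhi; have := euler_prod_ge1 R z Y; set E := euler_prod R z Y => E1 Ylo Yhi.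
set s := t%:R^-1 in ti tz *; set u := z%:R^-1 in hz tz Yhi.
have u0 : 0 <= u by lra.
have h1 : E * u <= x / 2 * u by rewrite ler_wpM2r.
have h2 : E * s <= E * u by rewrite ler_wpM2l //; lra.
have h3 : 0 <= E * s by rewrite mulr_ge0 //; lra.
clear -h1 h2 h3 Ylo Yhi hz.
by rewrite ltr_norml; apply/andP; split; lra.
Qed.

(** Here r is the ratio aimed at x, while a, b and c stand for 1/k1, 1/k2 and 2/(p - 1), the last
    from (p + 1)/(p - 1) = 1 + c. *)
Lemma ratio_error (x r y a b c t : R) : 0 < x -> 0 <= t <= 1 ->
  r <= x -> x < r * (1 + t) -> 0 <= a <= t -> 0 <= b <= t -> 0 <= c <= 2 * t ->
  y * (1 + b) = r * (1 + a) * (1 + c) -> `|y - x| <= 5 * (x * t).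
Proof.
move=> x0 /andP[t0 t1] rx xr /andP[a0 a1] /andP[b0 b1] /andP[c0 c1] e.
have r0 : 0 <= r by nra.
have xt : 0 <= x * t by rewrite mulr_ge0 // ltW.
have ac : 1 <= (1 + a) * (1 + c) <= (1 + t) * (1 + 2 * t).
  apply/andP; split; first by nra.
  by apply: ler_pM; lra.
have /andP[ac1 ac2] := ac.
have y0 : 0 <= y.
  have b1' : 0 < 1 + b by lra.
  rewrite -(pmulr_lge0 _ b1') e -mulrA mulr_ge0 //; lra.
have up : y <= x * ((1 + t) * (1 + 2 * t)).
  apply: (@le_trans _ _ (y * (1 + b))); first by rewrite ler_peMr //; lra.
  by rewrite e -mulrA; apply: ler_pM => //; lra.
have lo1 : r <= y * (1 + t).
  apply: (@le_trans _ _ (y * (1 + b))); last by rewrite ler_wpM2l //; lra.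
  by rewrite e -mulrA ler_peMr.
have lo2 : x <= y * ((1 + t) * (1 + t)).
  rewrite mulrA; apply: le_trans (ltW xr) _; rewrite ler_wpM2r //; lra.
have lo3 : x * (1 - 2 * t) <= y.
  have [s|s] := leP (1 - 2 * t) 0.
    by apply: le_trans y0; rewrite mulr_ge0_le0 // ltW.
  apply: (@le_trans _ _ (y * ((1 + t) * (1 + t)) * (1 - 2 * t))).
    by rewrite ler_wpM2r // ltW.
  rewrite -mulrA ler_piMr //; have : 0 <= t * t * (3 + 2 * t) by rewrite !mulr_ge0 //; lra.
  by lra.
have tt : x * t * t <= x * t by rewrite ler_piMr.
rewrite ler_norml; apply/andP; split; lra.
Qed.

Lemma dense_two_sided : Dickson_conjecture -> dense_in_halfline
    (fun y : R => exists p : nat, [/\ prime p, prime p.+2 &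
       y = ((sigma p.+1)%:R / (sigma p.-1)%:R)%R]) 0.
Proof.
(* The target is shifted by e/2 to be positive, since the construction divides by it; this covers
   the endpoint 0. *)
move=> D x0 hx e e0; set x := x0 + e / 2.
have xpos : 0 < x by rewrite /x; lra.
have e2 : 0 < e / 2 by lra.
have x5 : 0 <= 5 * x by lra.
have [w [w4 hw]] := exists_inv_lt 4 e2 x5.
have w0 : (0 < w)%N by apply: leq_trans w4.
(* 14/9 is [abundancy] 12 over [abundancy] 2. The primes in (3, Y1] go to p - 1 and push the ratio
   down to x or below; primes above Y1 then go to p + 1 and raise it back to x. *)
have [Y1' [Y31 hY1']] := @euler_prod_unbounded R 3 (14 / 9 / x).
have [Y1 [wY1 hY1]] : exists Y1, (w <= Y1)%N /\ 14 / 9 / x <= euler_prod R 3 Y1.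
  exists (Y1' + w)%N; split; first exact: leq_addl.
  by apply: le_trans (ltW hY1') _; apply: euler_prod_mono; rewrite Y31 leq_addr.
have Y10 : (0 < Y1)%N by apply: leq_trans wY1.
have Y13 : (3 <= Y1)%N by apply: leq_trans wY1; apply: ltnW.
set E1 := euler_prod R 3 Y1 in hY1.
have E1g : 1 <= E1 by apply: euler_prod_ge1.
have X1 : 1 <= x * E1 * 9 / 14.
  by move: hY1; rewrite ler_pdivrMr // => h; lra.
have [Y2 [Y12 lo hi]] := euler_prod_approx Y10 X1.
set E2 := euler_prod R Y1 Y2 in lo hi.
set A := prime_prod Y1 Y2; set B := prime_prod 3 Y1.
have A0 : (0 < A)%N by apply: prime_prod_gt0.
have B0 : (0 < B)%N by apply: prime_prod_gt0.
have small q : prime q -> (q %| 12)%N -> (q <= 3)%N.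
  move=> qp; rewrite (_ : 12%N = (2 * (2 * 3))%N) // !Euclid_dvdM // !dvdn_prime2 //.
  by move=> /or3P[] /eqP ->.
have c12A : coprime 12 A.
  apply: coprime_prime_prod => // q qp /(small q qp) q3.
  by apply/negP => /andP[h _]; clear -h q3 Y13; lia.
have c12B : coprime 12 B.
  apply: coprime_prime_prod => // q qp /(small q qp) q3.
  by apply/negP => /andP[h _]; clear -h q3; lia.
have cAB : coprime A B.
  apply: coprime_prime_prod => // q qp; rewrite dvdn_prime_prod // => /andP[h _].
  by apply/negP => /andP[_ h']; clear -h h'; lia.
have c2B : coprime 2 B by apply: coprime_dvdl c12B.
have cop : coprime (12 * A) B by rewrite coprimeMl c12B.
have [p [k1 [k2 [[h1 h2 k1p k2p] [pp pp2 p1 p2]]]]] :=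
  dickson_two_sided D (12 * A + 2 * B + w) A0 B0 cop.
exists ((sigma p.+1)%:R / (sigma p.-1)%:R); split; first by exists p.
have k1w : (w < k1)%N by apply: leq_ltn_trans h1; apply: leq_addl.
have k2w : (w < k2)%N by apply: leq_ltn_trans h2; apply: leq_addl.
have k1A : (12 * A < k1)%N by apply: leq_ltn_trans h1; rewrite -addnA leq_addr.
have k2B : (2 * B < k2)%N.
  by apply: leq_ltn_trans h2; rewrite addnAC leq_addl.
have a1 : abundancy R p.+1 = 7 / 3 * E2 * (1 + k1%:R^-1).
  rewrite p1 abundancy_mul_prime ?muln_gt0 // abundancyM // abundancy12.
  by rewrite abundancy_prime_prod.
have a2 : abundancy R p.-1 = 3 / 2 * E1 * (1 + k2%:R^-1).
  rewrite p2 abundancy_mul_prime ?muln_gt0 // abundancyM // abundancy2.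
  by rewrite abundancy_prime_prod.
have k20 : (0 < k2)%N by apply: prime_gt0.
have pm0 : (k2 <= p.-1)%N by rewrite p2 leq_pmull // muln_gt0.
have pR : 0 < p.-1%:R :> R by rewrite ltr0n (leq_trans k20).
have k2R : 0 < k2%:R :> R by rewrite ltr0n.
have k1R : 0 < k1%:R :> R by rewrite ltr0n prime_gt0.
have wR : 0 < w%:R :> R by rewrite ltr0n.
have inv_le k : (w < k)%N -> 0 <= (k%:R^-1 : R) <= w%:R^-1.
  move=> wk; rewrite invr_ge0 ler0n lef_pV2 ?posrE ?ltr0n ?ler_nat //.
    exact: ltnW.
  exact: leq_trans wk.
have p1E : p.+1%:R = p.-1%:R + 2 :> R.
  by rewrite -natrD; congr (_%:R); have := prime_gt0 pp; clear; lia.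
have sE n : (0 < n)%N -> (sigma n)%:R = abundancy R n * n%:R.
  by move=> n0; rewrite /abundancy divfK // pnatr_eq0 -lt0n.
have pm1 : (0 < p.-1)%N by apply: leq_trans pm0.
rewrite (sE p.+1 isT) (sE p.-1 pm1) a1 a2 p1E.
set y := _ / _.
have bound : `|y - x| <= 5 * (x * w%:R^-1).
  apply: (@ratio_error x (14 / 9 * E2 / E1) y k1%:R^-1 k2%:R^-1 (2 * p.-1%:R^-1)) => //.
  - by rewrite invr_ge0 ler0n invf_le1 // ler1n.
  - by rewrite ler_pdivrMr; lra.
  - have l1 : E2 * (1 + Y1%:R^-1) <= E2 * (1 + w%:R^-1).
      rewrite ler_wpM2l ?lerD2l ?lef_pV2 ?posrE ?ltr0n ?ler_nat //.
      by rewrite (le_trans ler01) // euler_prod_ge1.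
    rewrite mulrAC ltr_pdivlMr; lra.
  - exact: inv_le.
  - exact: inv_le.
  - have /andP[i1 i2] := inv_le _ (leq_trans k2w pm0).
    by apply/andP; split; lra.
  rewrite /y; field; rewrite !gt_eqF //; last by lra.
  by rewrite ltr_wpDr // mulr1n.
have : x = x0 + e / 2 by [].
move: bound hw; rewrite ler_norml => /andP[b1 b2] hw xE; clear -b1 b2 hw xE.
rewrite ltr_norml; apply/andP; split; lra.
Qed.

End Conditional.

Theorem theorem4 (R : realType) :
  (Dickson_conjecture ->
     dense_in_halfline
       (fun y : R => exists p : nat, [/\ prime p, prime p.+2 &
           y = ((sigma p.+1)%:R / (sigma p.-1)%:R)%R]) 0%R)
  /\
  dense_in_halfline
    (fun y : R => exists p : nat, prime p /\
        y = ((sigma p.+1)%:R / (sigma p)%:R)%R) (3 / 2)%R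
  /\
  (Dickson_conjecture ->
     dense_in_halfline
       (fun y : R => exists p : nat, [/\ prime p, prime p.+2 &
           y = ((sigma p.+1)%:R / (sigma p)%:R)%R]) 2%R).
Proof.
split; first exact: dense_two_sided.
by split; [exact: dense_prime|exact: dense_twin_prime].
Qed.
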